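(* Let $p\ge 5$ be an integer and let $\Omega\subset\mathbb{R}^2$ be an open domain on which a mixed triangle and quadrilateral mesh is given, with elements $\Omega^{(i)}$ ($i\in\mathcal{I}_\Omega=\mathcal{I}_\triangle\,\dot\cup\,\mathcal{I}_\Box$), edges $\mathcal{E}^{(i)}$ ($i\in\mathcal{I}_{\mathcal{E}}$), vertices $\mathbf{V}^{(i)}$ ($i\in\mathcal{I}_{\mathbf{V}}$) and element parametrizations $\mathbf{F}^{(i)}$. Choose the following points: - for every edge $\mathcal{E}^{(i)}$, $i\in\mathcal{I}_{\mathcal{E}}$: $p-5$ pairwise different points $\mathbf{R}^{(i)}_\ell\in\mathcal{E}^{(i)}$, $\ell=1,\dots,p-5$, and $p-4$ pairwise different points $\mathbf{S}^{(i)}_\ell\in\mathcal{E}^{(i)}$, $\ell=1,\dots,p-4$; - for every quadrilateral element $\Omega^{(i)}$, $i\in\mathcal{I}_\Box$: $(p-3)^2$ pairwise different points $\mathbf{Q}^{(i)}_{\ell,k}=\mathbf{F}^{(i)}(\widehat{\mathbf{Q}}^{(i)}_{\ell,k})$, $\ell,k=1,\dots,p-3$, where the points $\widehat{\mathbf{Q}}^{(i)}_{\ell,k}$ are unisolvent in $\mathrm{span}\{B^{p,p}_{j_1,j_2}: 2\le j_1,j_2\le p-2\}$; - for every triangular element $\Omega^{(i)}$, $i\in\mathcal{I}_\triangle$: $\binom{p-4}{2}$ pairwise different points $\mathbf{Q}^{(i)}_{\ell,k}=\mathbf{F}^{(i)}(\widehat{\mathbf{Q}}^{(i)}_{\ell,k})$,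 $\ell=1,\dots,p-5$, $k=1,\dots,p-4-\ell$, where the points $\widehat{\mathbf{Q}}^{(i)}_{\ell,k}$ are unisolvent in $\mathrm{span}\{B^{\triangle,p}_{j_1,j_2,j_3}: j_1,j_2,j_3\ge 2,\ j_1+j_2+j_3=p\}$. Then, for any given real values $\sigma_{i,a,b}$, $\sigma_{i,\ell}$, $w_{i,\ell}$, $\sigma^{\Box}_{i,\ell,k}$, $\sigma^{\triangle}_{i,\ell,k}$, there exists a unique function $\varphi\in\mathcal{A}_p$ satisfying all of the following interpolation conditions: (A) for every vertex $\mathbf{V}^{(i)}$, $i\in\mathcal{I}_{\mathbf{V}}$: $D_x^aD_y^b\varphi(\mathbf{V}^{(i)})=\sigma_{i,a,b}$ for all integers $a,b\ge0$ with $0\le a+b\le 2$; (B) for every edge $\mathcal{E}^{(i)}$, $i\in\mathcal{I}_{\mathcal{E}}$: $\varphi(\mathbf{R}^{(i)}_\ell)=\sigma_{i,\ell}$ for $\ell=1,\dots,p-5$, and $D_{\mathbf{n}_i}\varphi(\mathbf{S}^{(i)}_\ell)=w_{i,\ell}$ for $\ell=1,\dots,p-4$; (C) for every $i\in\mathcal{I}_\Box$: $\varphi(\mathbf{Q}^{(i)}_{\ell,k})=\sigma^{\Box}_{i,\ell,k}$ for $\ell,k=1,\dots,p-3$; (D) for every $i\in\mathcal{I}_\triangle$: $\varphi(\mathbf{Q}^{(i)}_{\ell,k})=\sigma^{\triangle}_{i,\ell,k}$ for $\ell=1,\dots,p-5$, $k=1,\dots,p-4-\ell$.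
   Context: **Mixed mesh.** $\Omega\subset\mathbb{R}^2$ is an open connected (polygonal) domain whose closure is the disjoint union of (finitely many) open triangular or quadrilateral elements $\Omega^{(i)}$, $i\in\mathcal{I}_\Omega=\mathcal{I}_\triangle\,\dot\cup\,\mathcal{I}_\Box$ (triangles for $i\in\mathcal{I}_\triangle$, quadrilaterals for $i\in\mathcal{I}_\Box$), edges $\mathcal{E}^{(i)}$, $i\in\mathcal{I}_{\mathcal{E}}$, and vertices (points) $\mathbf{V}^{(i)}\in\mathbb{R}^2$, $i\in\mathcal{I}_{\mathbf{V}}$. Each edge is an open segment $\{(1-v)\mathbf{V}^{(i_1)}+v\mathbf{V}^{(i_2)}: v\in(0,1)\}$ between two mesh vertices, the corners of every element are mesh vertices, and there are no hanging vertices (every side of an element is a mesh edge). With $\triangle_0=\{(u,v): u\in[0,1],\,0\le v\le 1-u\}$ and $\Box_0=[0,1]^2$, each element closure is the image of its parametrization $\mathbf{F}^{(i)}$, which is linear for triangles, $\mathbf{F}^{(i)}:\triangle_0\to\overline{\Omega^{(i)}}$, $\mathbf{F}^{(i)}(u,v)=(1-u-v)\mathbf{V}^{(i_1)}+u\mathbf{V}^{(i_2)}+v\mathbf{V}^{(i_3)}$, and bilinear for quadrilaterals, $\mathbf{F}^{(i)}:\Box_0\to\overline{\Omega^{(i)}}$, $\mathbf{F}^{(i)}(u,v)=(1-u)(1-v)\mathbf{V}^{(i_1)}+u(1-v)\mathbf{V}^{(i_2)}+uv\mathbf{V}^{(i_3)}+(1-u)v\mathbf{V}^{(i_4)}$.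 All parametrizations are assumed regular (bijective with non-vanishing Jacobian determinant on the closed parameter domain). **Polynomials.** $\mathbb{P}_p$: univariate polynomials of degree (at most) $p$ on $[0,1]$; $\mathbb{P}^2_p$: bivariate polynomials of total degree $p$; $\mathbb{P}^2_{p,p}$: bivariate polynomials of bi-degree $(p,p)$. Bernstein bases: $B^p_i(u)=\binom{p}{i}u^i(1-u)^{p-i}$; $B^{\triangle,p}_{i,j,k}(u,v)=\frac{p!}{i!j!k!}u^iv^j(1-u-v)^k$ for $i+j+k=p$; $B^{p,p}_{i,j}(u,v)=B^p_i(u)B^p_j(v)$. **Argyris-like space.** For $p\ge5$, $\mathcal{A}_p$ is the set of all $\varphi\in C^1(\overline\Omega)$ such that (i) $\varphi\circ\mathbf{F}^{(i)}\in\mathbb{P}^2_p$ for $i\in\mathcal{I}_\triangle$ and $\varphi\circ\mathbf{F}^{(i)}\in\mathbb{P}^2_{p,p}$ for $i\in\mathcal{I}_\Box$; (ii) $\varphi\in C^2(\mathbf{V}^{(i)})$ for all $i\in\mathcal{I}_{\mathbf{V}}$, i.e. $\varphi$ is $C^2$ at every vertex (the derivatives up to order 2 of the restrictions of $\varphi$ to all elements meeting at the vertex agree there); (iii) for every $i\in\mathcal{I}_{\mathcal{E}}$, $D_{\mathbf{n}_i}\varphi|_{\mathcal{E}^{(i)}}\in\mathbb{P}_{p-1}$ (as a function of the linear edge parameter), where $D_{\mathbf{n}_i}$ is the derivative in the direction of a fixed unit vector $\mathbf{n}_i$ orthogonal to $\mathcal{E}^{(i)}$. Here $\varphi\in C^1(\overline\Omega)$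 means that $\varphi$ is continuous and the values and first derivatives of its elementwise restrictions agree wherever closures of elements meet. **Unisolvence.** A point set is unisolvent in a function space if any function in the space is uniquely determined by interpolating values at the points of this set (here the number of points equals the dimension of the space). *)

(* Defs.v *)
From HB Require Import structures.
From mathcomp Require Import all_boot all_order all_algebra.
From mathcomp Require Import all_classical all_reals all_analysis.

Set Implicit Arguments.
Unset Strict Implicit.
Unset Printing Implicit Defensive.

Import Order.TTheory GRing.Theory Num.Theory.
Import numFieldNormedType.Exports.

Local Open Scope classical_set_scope.
Local Open Scope ring_scope.

Notation plane R := (R * R)%type (only parsing).

(** ** Function spaces on the reference domains *)

Definition lin_span (R : realType) (I : finType) (A : {pred I})
    (b : I -> plane R -> R) : set (plane R -> R) :=
  [set f | exists c : I -> R, forall q, f q = \sum_(i in A) c i * b i q].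

Definition monomial2 (R : realType) (p : nat) (ij : 'I_p.+1 * 'I_p.+1)
    (q : plane R) : R := q.1 ^+ ij.1 * q.2 ^+ ij.2.

Definition polys_total (R : realType) (p : nat) : set (plane R -> R) :=
  lin_span [pred ij : 'I_p.+1 * 'I_p.+1 | (ij.1 + ij.2 <= p)%N] (@monomial2 R p).

Definition polys_bidegree (R : realType) (p : nat) : set (plane R -> R) :=
  lin_span predT (@monomial2 R p).

Definition bernstein (R : realType) (p i : nat) (u : R) : R :=
  'C(p, i)%:R * u ^+ i * (1 - u) ^+ (p - i).

Definition bernstein_quad (R : realType) (p : nat) (ij : 'I_p.+1 * 'I_p.+1)
    (q : plane R) : R := bernstein p ij.1 q.1 * bernstein p ij.2 q.2.

(* Only meaningful for index triples (i, j, k) with i + j + k = p. *)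
Definition bernstein_tri (R : realType) (p : nat)
    (ijk : 'I_p.+1 * 'I_p.+1 * 'I_p.+1) (q : plane R) : R :=
  let: (i, j, k) := ijk in
  p`!%:R / (i`!%:R * j`!%:R * k`!%:R)
    * q.1 ^+ i * q.2 ^+ j * (1 - q.1 - q.2) ^+ k.

Definition inner_quad (R : realType) (p : nat) : set (plane R -> R) :=
  lin_span [pred ij : 'I_p.+1 * 'I_p.+1 |
              (2 <= ij.1 <= p - 2)%N && (2 <= ij.2 <= p - 2)%N]
    (@bernstein_quad R p).

Definition inner_tri (R : realType) (p : nat) : set (plane R -> R) :=
  lin_span [pred ijk : 'I_p.+1 * 'I_p.+1 * 'I_p.+1 |
              let: (i, j, k) := ijk in
              [&& (2 <= i)%N, (2 <= j)%N, (2 <= k)%N & (i + j + k == p)%N]]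
    (@bernstein_tri R p).

Definition unisolvent (R : realType) (J : Type) (pts : J -> plane R)
    (S : set (plane R -> R)) : Prop :=
  forall f g, S f -> S g -> (forall l, f (pts l) = g (pts l)) -> f =1 g.

(* Point indices, shifted to start from 0: the quadrilateral pair (l, k) stands
   for (l+1, k+1) in {1..p-3}^2; the triangular pair stands for (l+1, k+1) with
   l+1 in {1..p-5} and k+1 in {1..p-4-(l+1)}. *)
Definition quad_pt_idx (p : nat) : finType := ('I_(p - 3) * 'I_(p - 3))%type.
Definition tri_pt_idx (p : nat) : finType :=
  {l : 'I_(p - 5) & 'I_(p - 4 - l.+1)}.

(** ** Mixed meshes *)

Definition ref_tri (R : realType) : set (plane R) :=
  [set q | 0 <= q.1 <= 1 /\ 0 <= q.2 <= 1 - q.1].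

Definition ref_quad (R : realType) : set (plane R) :=
  [set q | 0 <= q.1 <= 1 /\ 0 <= q.2 <= 1].

(* Corners are indexed cyclically by Z/3 and Z/4, in the order in which they
   enter the parametrization; the sides join the corners j and j + 1. *)
Record mesh_data (R : realType) := MeshData {
  vtx_idx : finType;
  edge_idx : finType;
  tri_idx : finType;
  quad_idx : finType;
  vtx : vtx_idx -> plane R;
  edge_ends : edge_idx -> vtx_idx * vtx_idx;
  tri_corner : tri_idx -> 'Z_3 -> vtx_idx;
  quad_corner : quad_idx -> 'Z_4 -> vtx_idx
}.

Definition elt_idx (R : realType) (M : mesh_data R) : finType :=
  (tri_idx M + quad_idx M)%type.

Definition tri_param (R : realType) (M : mesh_data R) (i : tri_idx M)
    (q : plane R) : plane R :=
  let V j := vtx (tri_corner i j) in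
  (1 - q.1 - q.2) *: V 0 + q.1 *: V 1 + q.2 *: V 2.

Definition quad_param (R : realType) (M : mesh_data R) (i : quad_idx M)
    (q : plane R) : plane R :=
  let V j := vtx (quad_corner i j) in
  ((1 - q.1) * (1 - q.2)) *: V 0 + (q.1 * (1 - q.2)) *: V 1
    + (q.1 * q.2) *: V 2 + ((1 - q.1) * q.2) *: V 3.

Definition param (R : realType) (M : mesh_data R) (k : elt_idx M) :
    plane R -> plane R :=
  match k with inl i => tri_param i | inr i => quad_param i end.

Definition ref_dom (R : realType) (M : mesh_data R) (k : elt_idx M) :
    set (plane R) :=
  match k with inl _ => @ref_tri R | inr _ => @ref_quad R end.

Definition elt (R : realType) (M : mesh_data R) (k : elt_idx M) :
    set (plane R) := (param k @` ref_dom k)°.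

Definition edge_pt (R : realType) (M : mesh_data R) (e : edge_idx M) (t : R) :
    plane R :=
  (1 - t) *: vtx (edge_ends e).1 + t *: vtx (edge_ends e).2.

Definition edge (R : realType) (M : mesh_data R) (e : edge_idx M) :
    set (plane R) := edge_pt e @` `]0, 1[.

Definition cell (R : realType) (M : mesh_data R)
    (c : elt_idx M + edge_idx M + vtx_idx M) : set (plane R) :=
  match c with
  | inl (inl k) => elt k
  | inl (inr e) => edge e
  | inr i => [set vtx i]
  end.

Definition joins (R : realType) (M : mesh_data R) (e : edge_idx M)
    (i j : vtx_idx M) : Prop := edge_ends e = (i, j) \/ edge_ends e = (j, i).

Definition jacobian_det (R : realType) (F : plane R -> plane R) (q : plane R) :
    R :=
  let Fu := 'D_(1, 0) F q in let Fv := 'D_(0, 1) F q in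
  Fu.1 * Fv.2 - Fu.2 * Fv.1.

Record is_mesh (R : realType) (Omega : set (plane R)) (M : mesh_data R) :
    Prop := IsMesh {
  mesh_open : open Omega;
  mesh_connected : connected Omega;
  mesh_cover : closure Omega = \bigcup_c cell (M := M) c;
  mesh_disjoint : trivIset setT (cell (M := M));
  mesh_edge_ends : forall e : edge_idx M, (edge_ends e).1 != (edge_ends e).2;
  mesh_tri_side : forall (i : tri_idx M) j,
    exists e, joins e (tri_corner i j) (tri_corner i (j + 1));
  mesh_quad_side : forall (i : quad_idx M) j,
    exists e, joins e (quad_corner i j) (quad_corner i (j + 1));
  mesh_param_inj : forall k : elt_idx M,
    {in ref_dom k &, injective (param k)};
  mesh_param_regular : forall (k : elt_idx M) q,
    ref_dom k q -> jacobian_det (param k) q != 0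
}.

Definition unit_normal (R : realType) (M : mesh_data R) (e : edge_idx M)
    (n : plane R) : Prop :=
  let d := vtx (edge_ends e).2 - vtx (edge_ends e).1 in
  n.1 ^+ 2 + n.2 ^+ 2 = 1 /\ n.1 * d.1 + n.2 * d.2 = 0.

(** ** The Argyris-like space *)

(* [mesh_limit M g x c]: [c] is the common value at [x] of the extensions of [g]
   from the open elements to their closures.  Applied to a derivative of [phi],
   this says that the corresponding derivatives at [x] of the restrictions of
   [phi] to all the elements meeting at [x] exist and are equal to [c]. *)
Definition mesh_limit (R : realType) (M : mesh_data R) (g : plane R -> R)
    (x : plane R) (c : R) : Prop :=
  forall k : elt_idx M, closure (elt k) x -> g @ within (elt k) (nbhs x) --> c.

Definition Dxy (R : realType) (a b : nat) (phi : plane R -> R) :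
    plane R -> R :=
  iter a (fun f => 'D_((1, 0) : plane R) f)
    (iter b (fun f => 'D_((0, 1) : plane R) f) phi).

Definition C1_closure (R : realType) (Omega : set (plane R)) (M : mesh_data R)
    (phi : plane R -> R) : Prop :=
  [/\ {within closure Omega, continuous phi},
      forall (k : elt_idx M) x, elt k x -> differentiable phi x
    & forall (v x : plane R), closure Omega x ->
        exists c, mesh_limit M ('D_v phi) x c].

Definition C2_at (R : realType) (M : mesh_data R) (phi : plane R -> R)
    (x : plane R) : Prop :=
  (forall k : elt_idx M, closure (elt k) x ->
     \forall y \near within (elt k) (nbhs x),
       differentiable phi y /\ forall v, differentiable ('D_v phi) y) /\
  (forall a b, (a + b <= 2)%N -> exists c, mesh_limit M (Dxy a b phi) x c).

(* Functions on the closure of [Omega] are represented by functions on the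
   plane; their values outside the closure are irrelevant. *)
Record argyris (R : realType) (Omega : set (plane R)) (M : mesh_data R)
    (n : edge_idx M -> plane R) (p : nat) (phi : plane R -> R) : Prop :=
  Argyris {
  argyris_C1 : C1_closure Omega M phi;
  argyris_tri : forall i : tri_idx M, exists2 f, polys_total p f &
    forall q, ref_tri q -> phi (tri_param i q) = f q;
  argyris_quad : forall i : quad_idx M, exists2 f, polys_bidegree p f &
    forall q, ref_quad q -> phi (quad_param i q) = f q;
  argyris_C2 : forall i : vtx_idx M, C2_at M phi (vtx i);
  argyris_normal : forall e : edge_idx M,
    exists2 f : {poly R}, (size f <= p)%N & forall t : R, 0 < t < 1 ->
      mesh_limit M ('D_(n e) phi) (edge_pt e t) f.[t]
}.

(* Main.v *)
Require Import Defs.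
From HB Require Import structures.
From mathcomp Require Import all_boot all_order all_algebra.
From mathcomp Require Import all_classical all_reals all_analysis.
From mathcomp Require Import ring lra zify.

Set Implicit Arguments.
Unset Strict Implicit.
Unset Printing Implicit Defensive.

Import Order.TTheory GRing.Theory Num.Theory.
Import numFieldNormedType.Exports.

Local Open Scope classical_set_scope.
Local Open Scope ring_scope.

(** The interpolation problem decouples along the mesh.  On an edge, the value
    and the first two derivatives at both ends and the values at [p - 5] inner
    points determine the trace, a polynomial of degree [p]; in the same way the
    normal derivative, a polynomial of degree [p - 1], is determined by its
    value and first derivative at both ends and its values at [p - 4] inner
    points.  Both are Hermite interpolation ([hermite3], [hermite2] and their
    uniqueness counterparts).  The edge data thus fix in advance the value [G]
    and the normal derivative [N] of the interpolant on each edge.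

    In the coordinates of a reference element, the derivative transverse to a
    side is [normal_coef * N + tangent_coef * G'], where the coefficients are
    constant on triangles and affine on quadrilaterals; it has degree [p - 1] or
    [p], as has the transverse derivative of a polynomial of the element space.
    The data of adjacent sides are compatible at the corners ([side_jet_edge]),
    and compatible data are attained ([boundary_interp]).  A polynomial with zero
    boundary data is a multiple of the squared product of the side functions
    ([boundary0_div]), that is, a combination of the inner Bernstein polynomials
    ([inner_spaceP]), and the inner points are unisolvent for these.  Hence
    boundary data and inner values determine one polynomial on each element
    ([local_exists], [local_unique]).

    Both halves of the theorem then compare functions on the plane with their
    polynomial pull-backs.  The increment of a bilinear map is its derivative at
    the midpoint applied to the increment of the argument ([secant]); so a
    bilinear map whose Jacobian determinant has no zero has a Lipschitz inverse
    and open image, and the derivatives of a function with polynomial pull-back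
    are polynomials divided by powers of the Jacobian determinant.  They extend
    continuously to the closed element and satisfy the chain rule there
    ([transported_limit_jet], [transported_chain]).

    For existence, the element polynomials are glued.  Since the cells of the
    mesh are disjoint, elements meet only in common edges and vertices; there
    their gradients, and at the vertices their second derivatives, are given by
    the common data ([edge_values], [vertex_jet]).  The closed elements cover the
    closure of the domain ([closure_Omega]), so the glued function is the
    interpolant.  For uniqueness, the one-sided limits of any interpolant at the
    vertices and edges show that it has the same boundary data ([psi_boundary]),
    and [local_unique] concludes. *)

(** * Interpolation in one variable *)

(** A square linear system that has at most one solution has one; this turns
    uniqueness into existence in the interpolation problems below. *)
Lemma square_system (K : fieldType) (T : finType) (A : T -> T -> K) :
    (forall c : T -> K, (forall l, \sum_k c k * A k l = 0) ->
       forall k, c k = 0) ->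
  forall b : T -> K, exists c : T -> K, forall l, \sum_k c k * A k l = b l.
Proof.
move=> inj b.
pose M : 'M[K]_#|T| := \matrix_(i, j) A (enum_val i) (enum_val j).
have sumE (v : 'rV[K]_#|T|) l :
    (v *m M) 0 (enum_rank l) = \sum_k v 0 (enum_rank k) * A k l.
  rewrite mxE (reindex (@enum_rank T)) /=; last by apply: onW_bij; exact: enum_rank_bij.
  by apply: eq_bigr => k _; rewrite mxE !enum_rankK.
have Mu : M \in unitmx.
  rewrite -row_free_unit -kermx_eq0; apply/eqP/row_matrixP => i.
  rewrite row0; set v := row i _.
  have vM : v *m M = 0 by rewrite -row_mul mulmx_ker row0.
  apply/rowP => k; rewrite [RHS]mxE -(enum_valK k).
  by apply: (inj (fun k => v 0 (enum_rank k))) => l; rewrite -sumE vM mxE.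
pose y : 'rV[K]_#|T| := \row_i b (enum_val i).
exists (fun k => (y *m invmx M) 0 (enum_rank k)) => l.
by rewrite -sumE -mulmxA mulVmx // mulmx1 mxE enum_rankK.
Qed.

Lemma poly_eq0_at (K : idomainType) n (t : 'I_n -> K) (P : {poly K}) :
  injective t -> (size P <= n)%N -> (forall l, P.[t l] = 0) -> P = 0.
Proof.
move=> inj_t szP P0; apply: (@roots_geq_poly_eq0 _ _ (codom t)).
- by apply/allP => _ /codomP[l ->]; apply/rootP/P0.
- by rewrite map_inj_uniq // enum_uniq.
- by rewrite size_codom card_ord.
Qed.

Lemma lagrange_exists (K : fieldType) n (t v : 'I_n -> K) :
  injective t -> exists2 P : {poly K}, (size P <= n)%N & forall l, P.[t l] = v l.
Proof.
move=> inj_t.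
have hornerE' (c : 'I_n -> K) x :
    (\sum_(k < n) c k *: 'X^k).[x] = \sum_(k < n) c k * x ^+ k.
  by rewrite horner_sum; apply: eq_bigr => k _; rewrite !hornerE.
have szE (c : 'I_n -> K) : (size (\sum_(k < n) c k *: 'X^k)%R <= n)%N.
  apply: (leq_trans (size_sum _ _ _)); apply/bigmax_leqP => k _.
  by apply: (leq_trans (size_scale_leq _ _)); rewrite size_polyXn.
have [] := @square_system K _ (fun k l : 'I_n => t l ^+ k) _ v.
  move=> c c0 k.
  have /(congr1 (fun P : {poly K} => P`_k)) : \sum_(k < n) c k *: 'X^k = 0.
    by apply: (poly_eq0_at inj_t (szE c)) => l; rewrite hornerE' c0.
  rewrite coef_sum coef0 (bigD1 k) //= coefZ coefXn eqxx mulr1 big1 ?addr0 //.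
  move=> j jk; rewrite coefZ coefXn.
  by rewrite eq_sym (inj_eq val_inj) (negbTE jk) mulr0.
move=> c cE; exists (\sum_(k < n) c k *: 'X^k); first exact: szE.
by move=> l; rewrite hornerE' cE.
Qed.

Section EndPoints.
Variable R : realFieldType.
Implicit Types P Q : {poly R}.

Lemma double_root P a : P.[a] = 0 -> P^`().[a] = 0 ->
  exists Q, P = ('X - a%:P) ^+ 2 * Q.
Proof.
move=> /rootP/factor_theorem[Q ->].
rewrite derivM derivXsubC mulr1 hornerD hornerM hornerXsubC subrr mulr0 add0r.
by move=> /rootP/factor_theorem[Q' ->]; exists Q'; ring.
Qed.

Lemma triple_root P a : P.[a] = 0 -> P^`().[a] = 0 -> P^`()^`().[a] = 0 ->
  exists Q, P = ('X - a%:P) ^+ 3 * Q.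
Proof.
move=> /double_root H /H[Q ->]; set D := 'X - a%:P.
have dD : D^`() = 1 by rewrite derivXsubC.
have -> : (D ^+ 2 * Q)^`()^`() = 2%:R * Q + D * (4%:R * Q^`() + D * Q^`()^`()).
  by rewrite expr2 !(derivM, derivD, dD, mul1r, mulr1); ring.
rewrite hornerD [X in _ + X]hornerM hornerXsubC subrr mul0r addr0 hornerM.
rewrite -polyC_natr hornerC => /eqP.
rewrite mulf_eq0 pnatr_eq0 /= => /factor_theorem[Q' ->].
by exists Q'; rewrite -/D; ring.
Qed.

(** Its powers measure the order of vanishing at both ends of the unit
    interval. *)
Definition bubble : {poly R} := 'X * (1 - 'X).

Lemma size_1subX : size (1 - 'X : {poly R}) = 2%N.
Proof. by rewrite -opprB size_polyN size_XsubC. Qed.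

Lemma size_bubbleM k n Q :
  (size (bubble ^+ k * Q)%R <= n + k.*2)%N -> (size Q <= n)%N.
Proof.
have [->|Q0] := eqVneq Q 0; first by rewrite mulr0 size_poly0.
have b0 : bubble != 0.
  by rewrite mulf_neq0 ?polyX_eq0 // -size_poly_eq0 size_1subX.
have szb : size bubble = 3%N.
  by rewrite size_mul ?polyX_eq0 // -?size_poly_eq0 size_1subX ?size_polyX.
have := size_exp bubble k; rewrite szb size_mul ?expf_neq0 //.
have : (0 < size (bubble ^+ k)%R)%N by rewrite lt0n size_poly_eq0 expf_neq0.
by move: (size (bubble ^+ k)%R) (size Q) => x y; lia.
Qed.

Lemma bubble_dvd k P Q0 Q1 :
    P = ('X - 0%:P) ^+ k * Q0 -> P = ('X - 1%:P) ^+ k * Q1 ->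
  exists Q, P = bubble ^+ k * Q.
Proof.
move=> P0 P1.
have : ('X - 0%:P) ^+ k * ('X - 1%:P) ^+ k %| P.
  rewrite Gauss_dvdp; last first.
    by apply/coprimep_expl/coprimep_expr/coprimep_XsubC2; rewrite subr0 oner_neq0.
  by rewrite {1}P0 P1 !dvdp_mulr.
move=> /dvdpP[Q ->]; exists ((-1) ^+ k * Q).
rewrite [RHS]mulrA -!exprMn mulrC; congr (_ ^+ k * _).
by rewrite /bubble polyC0 polyC1; ring.
Qed.

Lemma bubble3_dvd P :
    P.[0] = 0 -> P^`().[0] = 0 -> P^`()^`().[0] = 0 ->
    P.[1] = 0 -> P^`().[1] = 0 -> P^`()^`().[1] = 0 ->
  exists Q, P = bubble ^+ 3 * Q.
Proof.
move=> /triple_root a /a{}a /a[Q0 P0] /triple_root b /b{}b /b[Q1 P1].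
exact: bubble_dvd P0 P1.
Qed.

Lemma bubble2_dvd P :
    P.[0] = 0 -> P^`().[0] = 0 -> P.[1] = 0 -> P^`().[1] = 0 ->
  exists Q, P = bubble ^+ 2 * Q.
Proof.
move=> /double_root a /a[Q0 P0] /double_root b /b[Q1 P1].
exact: bubble_dvd P0 P1.
Qed.

Lemma bubble_horner_neq0 t : 0 < t < 1 -> bubble.[t] != 0.
Proof.
move=> /andP[t0 t1]; rewrite !hornerE mulf_neq0 ?gt_eqF //.
by rewrite subr_gt0.
Qed.

Definition jet3 P (a b : R * R * R) : Prop :=
  [/\ P.[0] = a.1.1, P^`().[0] = a.1.2 & P^`()^`().[0] = a.2] /\
  [/\ P.[1] = b.1.1, P^`().[1] = b.1.2 & P^`()^`().[1] = b.2].

Definition jet2 P (a b : R * R) : Prop :=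
  (P.[0] = a.1 /\ P^`().[0] = a.2) /\ (P.[1] = b.1 /\ P^`().[1] = b.2).

(** The jet [a] at 0 divided by the weight [(1 - 'X) ^+ 3], up to order two: the
    weight confines the product [corner3] to the end 0. *)
Definition taylor3 (a : R * R * R) : {poly R} :=
  a.1.1%:P + (a.1.2 + 3%:R * a.1.1)%:P * 'X
    + (a.2 / 2%:R + 3%:R * a.1.2 + 6%:R * a.1.1)%:P * 'X ^+ 2.

Definition corner3 (a : R * R * R) : {poly R} := (1 - 'X) ^+ 3 * taylor3 a.

Definition corner2 (a : R * R) : {poly R} :=
  (1 - 'X) ^+ 2 * (a.1%:P + (a.2 + 2%:R * a.1)%:P * 'X).

Lemma horner1 x : (1 : {poly R}).[x] = 1.
Proof. exact: hornerC. Qed.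

Lemma deriv_cubeM (W Q : {poly R}) :
  (W ^+ 3 * Q)^`() = W ^+ 2 * (3%:R * W^`() * Q + W * Q^`()).
Proof. by rewrite !exprS expr0 mulr1 !derivM; ring. Qed.

Lemma deriv2_cubeM (W Q : {poly R}) :
  (W ^+ 3 * Q)^`()^`() = W * (6%:R * W^`() ^+ 2 * Q + 3%:R * W * W^`()^`() * Q
    + 6%:R * W * W^`() * Q^`() + W ^+ 2 * Q^`()^`()).
Proof.
rewrite deriv_cubeM expr2 !(derivM, derivD) -polyC_natr derivC polyC_natr.
by ring.
Qed.

Lemma deriv_squareM (W Q : {poly R}) :
  (W ^+ 2 * Q)^`() = W * (2%:R * W^`() * Q + W * Q^`()).
Proof. by rewrite expr2 !derivM; ring. Qed.

Lemma deriv_1subX : (1 - 'X : {poly R})^`() = -1.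
Proof. by rewrite derivB derivX -polyC1 derivC sub0r. Qed.

Lemma deriv_affine (a b c : R) :
  (a%:P + b%:P * 'X + c%:P * 'X ^+ 2)^`() = b%:P + (2%:R * c)%:P * 'X.
Proof.
rewrite expr2 !(derivD, derivM, derivC, derivX) polyCM polyC_natr; ring.
Qed.

Lemma corner3_jet a : jet3 (corner3 a) a (0, 0, 0).
Proof.
rewrite /jet3 /corner3 /taylor3 !deriv2_cubeM !deriv_cubeM !deriv_1subX deriv_affine.
rewrite derivN -polyC1 !derivC.
have -> : forall u v : R, (u%:P + v%:P * 'X)^`() = v%:P.
  by move=> u v; rewrite derivD derivM !derivC derivX add0r mul0r add0r mulr1.
rewrite !(hornerM, hornerD, hornerN, horner_exp, hornerC, hornerX, hornerMn) /=.
by split; split; field.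
Qed.

Lemma corner2_jet a : jet2 (corner2 a) a (0, 0).
Proof.
rewrite /jet2 /corner2 !deriv_squareM !deriv_1subX derivD derivM !derivC derivX.
rewrite -!polyC_natr !hornerE /=.
by split; split; ring.
Qed.

Lemma flip_deriv P : (P \Po (1 - 'X))^`() = - (P^`() \Po (1 - 'X)).
Proof.
by rewrite deriv_comp derivB derivX -polyC1 derivC sub0r polyC1 mulrN1.
Qed.

Lemma taylor3_flip a : taylor3 a \Po (1 - 'X) =
  a.1.1%:P + (a.1.2 + 3%:R * a.1.1)%:P * (1 - 'X)
    + (a.2 / 2%:R + 3%:R * a.1.2 + 6%:R * a.1.1)%:P * (1 - 'X) ^+ 2.
Proof.
rewrite /taylor3 expr2 !comp_polyD !comp_polyM !comp_polyC !comp_polyX.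
by rewrite expr2.
Qed.

Lemma corner3_flip a :
  corner3 a \Po (1 - 'X) = 'X ^+ 3 * (taylor3 a \Po (1 - 'X)).
Proof.
rewrite /corner3 comp_polyM !exprS expr0 !mulr1 !comp_polyM.
by rewrite comp_polyB comp_polyX -polyC1 comp_polyC polyC1 subKr.
Qed.

Lemma jet2_ends P Q : jet2 ((1 - 'X) ^+ 2 * P + 'X ^+ 2 * Q)
  (P.[0], P^`().[0] - 2%:R * P.[0]) (Q.[1], Q^`().[1] + 2%:R * Q.[1]).
Proof.
rewrite /jet2 derivD !deriv_squareM deriv_1subX derivX.
rewrite !(horner1, hornerM, hornerD, hornerN, horner_exp, hornerX, hornerMn).
by split; split; rewrite /=; ring.
Qed.

Lemma horner_flip P t : (P \Po (1 - 'X)).[t] = P.[1 - t].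
Proof. by rewrite horner_comp !hornerE. Qed.

Lemma size_flip P : (size (P \Po (1 - 'X))%R <= size P)%N.
Proof.
have [->|P0] := eqVneq P 0; first by rewrite comp_poly0.
apply: leq_trans (size_comp_poly_leq _ _) _; rewrite size_1subX /= muln1.
by rewrite prednK // lt0n size_poly_eq0.
Qed.

Lemma jet3_flip P a b : jet3 P a b ->
  jet3 (P \Po (1 - 'X)) (b.1.1, - b.1.2, b.2) (a.1.1, - a.1.2, a.2).
Proof.
move=> [[? ? ?] [? ? ?]].
by split; split; rewrite ?flip_deriv ?derivN ?flip_deriv ?opprK ?hornerN
  horner_flip ?subr0 ?subrr //=; congr (- _).
Qed.

Lemma jet2_flip P a b : jet2 P a b ->
  jet2 (P \Po (1 - 'X)) (b.1, - b.2) (a.1, - a.2).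
Proof.
move=> [[? ?] [? ?]].
by split; split; rewrite ?flip_deriv ?hornerN horner_flip ?subr0 ?subrr //=;
  congr (- _).
Qed.

Lemma jet3D P Q a b a' b' : jet3 P a b -> jet3 Q a' b' ->
  jet3 (P + Q) (a.1.1 + a'.1.1, a.1.2 + a'.1.2, a.2 + a'.2)
               (b.1.1 + b'.1.1, b.1.2 + b'.1.2, b.2 + b'.2).
Proof.
by move=> [[<- <- <-] [<- <- <-]] [[<- <- <-] [<- <- <-]];
  split; split; rewrite ?derivD hornerD.
Qed.

Lemma jet2D P Q a b a' b' : jet2 P a b -> jet2 Q a' b' ->
  jet2 (P + Q) (a.1 + a'.1, a.2 + a'.2) (b.1 + b'.1, b.2 + b'.2).
Proof.
by move=> [[<- <-] [<- <-]] [[<- <-] [<- <-]];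
  split; split; rewrite ?derivD hornerD.
Qed.

Lemma bubbleM_end k x Q : (x == 0) || (x == 1) -> (bubble ^+ k.+1 * Q).[x] = 0.
Proof.
move=> x01; rewrite exprS -mulrA hornerM.
suff -> : bubble.[x] = 0 by rewrite mul0r.
rewrite /bubble hornerM hornerD hornerN hornerX horner1.
by case/orP: x01 => /eqP ->; rewrite ?mul0r // subrr mulr0.
Qed.

Lemma jet3_bubble Q : jet3 (bubble ^+ 3 * Q) (0, 0, 0) (0, 0, 0).
Proof.
rewrite /jet3 !deriv2_cubeM !deriv_cubeM.
by split; split; rewrite ?bubbleM_end ?eqxx ?orbT //; apply: (@bubbleM_end 0);
  rewrite eqxx ?orbT.
Qed.

Lemma jet2_bubble Q : jet2 (bubble ^+ 2 * Q) (0, 0) (0, 0).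
Proof.
rewrite /jet2 !deriv_squareM.
by split; split; rewrite ?bubbleM_end ?eqxx ?orbT //; apply: (@bubbleM_end 0);
  rewrite eqxx ?orbT.
Qed.

Lemma size_leM P Q m n : (size P <= m.+1)%N -> (size Q <= n.+1)%N ->
  (size (P * Q)%R <= (m + n).+1)%N.
Proof.
move=> szP szQ; apply: leq_trans (size_polyMleq _ _) _.
by move: (size P) (size Q) szP szQ => x y; lia.
Qed.

Lemma size_leD P Q n : (size P <= n)%N -> (size Q <= n)%N ->
  (size (P + Q)%R <= n)%N.
Proof.
by move=> szP szQ; apply: leq_trans (size_polyD _ _) _; rewrite geq_max szP szQ.
Qed.

Lemma size_leX P m k : (size P <= m.+1)%N -> (size (P ^+ k)%R <= (k * m).+1)%N.
Proof.
move=> szP; elim: k => [|k IHk]; first by rewrite expr0 size_poly1.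
by rewrite exprS mulSn; exact: size_leM.
Qed.

Lemma size_affine (a b : R) : (size (a%:P + b%:P * 'X)%R <= 2)%N.
Proof.
apply: size_leD; first by rewrite (leq_trans (size_polyC_leq1 _)).
by apply: (@size_leM _ _ 0 1); rewrite ?size_polyC_leq1 ?size_polyX.
Qed.

Lemma size_corner3 a : (size (corner3 a) <= 6)%N.
Proof.
apply: (@size_leM _ _ 3 2); first by apply: (@size_leX _ 1); rewrite size_1subX.
apply: size_leD; first exact: leq_trans (size_affine _ _) _.
by apply: (@size_leM _ _ 0 2); rewrite ?size_polyC_leq1 ?size_polyXn.
Qed.

Lemma size_corner2 a : (size (corner2 a) <= 4)%N.
Proof.
apply: (@size_leM _ _ 2 1); first by apply: (@size_leX _ 1); rewrite size_1subX.
exact: size_affine.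
Qed.

Lemma size_bubble k : (size (bubble ^+ k)%R <= k.*2.+1)%N.
Proof.
rewrite -muln2; apply: size_leX; apply: (@size_leM _ _ 1 1).
  by rewrite size_polyX.
by rewrite size_1subX.
Qed.

(** Multiples of a power of the bubble correct the values at inner points
    without disturbing the jets at the ends. *)
Lemma bubble_correct k n (t v : 'I_n -> R) (H : {poly R}) :
    injective t -> (forall l, 0 < t l < 1) -> (size H <= n + k.*2)%N ->
  exists Q, (size (H + bubble ^+ k * Q)%R <= n + k.*2)%N /\
    forall l, (H + bubble ^+ k * Q).[t l] = v l.
Proof.
move=> inj_t t01 szH.
have [Q szQ QE] := lagrange_exists
  (fun l => (v l - H.[t l]) / (bubble ^+ k).[t l]) inj_t.
exists Q; split.
  apply: size_leD => //; apply: leq_trans (size_polyMleq _ _) _.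
  by move: (size_bubble k) szQ; move: (size (bubble ^+ k)%R) (size Q) => x y; lia.
move=> l; rewrite hornerD hornerM QE mulrC divfK ?subrKC //.
by rewrite horner_exp expf_neq0 // bubble_horner_neq0.
Qed.

(** Hermite interpolation: the corner polynomials produce the end jets. *)
Lemma hermite3 n (t v : 'I_n -> R) a b :
    injective t -> (forall l, 0 < t l < 1) ->
  exists P, [/\ (size P <= n + 6)%N, jet3 P a b & forall l, P.[t l] = v l].
Proof.
move=> inj_t t01.
pose H := corner3 a + (corner3 (b.1.1, - b.1.2, b.2) \Po (1 - 'X)).
have szH : (size H <= n + 6)%N.
  apply: leq_trans (leq_addl n 6); apply: size_leD; first exact: size_corner3.
  exact: leq_trans (size_flip _) (size_corner3 _).
have [Q [szQ QE]] := @bubble_correct 3 n t v H inj_t t01 szH.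
exists (H + bubble ^+ 3 * Q); split=> //.
have := jet3D (corner3_jet a) (jet3_flip (corner3_jet (b.1.1, - b.1.2, b.2))).
move=> /jet3D-/(_ _ _ _ (jet3_bubble Q)).
rewrite -/H /= !(addr0, add0r, oppr0, opprK).
by case: a b @H szH szQ {QE} => [[? ?] ?] [[? ?] ?].
Qed.

Lemma hermite2 n (t v : 'I_n -> R) a b :
    injective t -> (forall l, 0 < t l < 1) ->
  exists P, [/\ (size P <= n + 4)%N, jet2 P a b & forall l, P.[t l] = v l].
Proof.
move=> inj_t t01.
pose H := corner2 a + (corner2 (b.1, - b.2) \Po (1 - 'X)).
have szH : (size H <= n + 4)%N.
  apply: leq_trans (leq_addl n 4); apply: size_leD; first exact: size_corner2.
  exact: leq_trans (size_flip _) (size_corner2 _).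
have [Q [szQ QE]] := @bubble_correct 2 n t v H inj_t t01 szH.
exists (H + bubble ^+ 2 * Q); split=> //.
have := jet2D (corner2_jet a) (jet2_flip (corner2_jet (b.1, - b.2))).
move=> /jet2D-/(_ _ _ _ (jet2_bubble Q)).
rewrite -/H /= !(addr0, add0r, oppr0, opprK).
by case: a b @H szH szQ {QE} => [? ?] [? ?].
Qed.

(** The cofactor of the bubble has [n] zeros and size at most [n]. *)
Lemma bubble_unique k n (t : 'I_n -> R) P Q :
    injective t -> (forall l, 0 < t l < 1) ->
    (size P <= n + k.*2)%N -> (size Q <= n + k.*2)%N ->
    (exists S, P - Q = bubble ^+ k * S) -> (forall l, P.[t l] = Q.[t l]) ->
  P = Q.
Proof.
move=> inj_t t01 szP szQ [S SE] PQ; apply/eqP; rewrite -subr_eq0; apply/eqP.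
have szPQ : (size (P - Q)%R <= n + k.*2)%N.
  by apply: size_leD; rewrite ?size_polyN.
rewrite SE in szPQ *.
rewrite (@poly_eq0_at _ n t S) ?mulr0 //; first exact: (size_bubbleM szPQ).
move=> l; have /eqP : (P - Q).[t l] = 0 by rewrite hornerD hornerN PQ subrr.
rewrite SE hornerM mulf_eq0 horner_exp expf_eq0.
by rewrite (negbTE (bubble_horner_neq0 _)) // andbF => /eqP.
Qed.

Lemma hermite3_unique n (t : 'I_n -> R) P Q a b :
    injective t -> (forall l, 0 < t l < 1) ->
    (size P <= n + 6)%N -> (size Q <= n + 6)%N -> jet3 P a b -> jet3 Q a b ->
    (forall l, P.[t l] = Q.[t l]) ->
  P = Q.
Proof.
move=> inj_t t01 szP szQ [[p0 p1 p2] [p3 p4 p5]] [[q0 q1 q2] [q3 q4 q5]].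
apply: (@bubble_unique 3) => //; apply: bubble3_dvd; rewrite ?derivB hornerD
  hornerN ?p0 ?p1 ?p2 ?p3 ?p4 ?p5 ?q0 ?q1 ?q2 ?q3 ?q4 ?q5 subrr //.
Qed.

Lemma hermite2_unique n (t : 'I_n -> R) P Q a b :
    injective t -> (forall l, 0 < t l < 1) ->
    (size P <= n + 4)%N -> (size Q <= n + 4)%N -> jet2 P a b -> jet2 Q a b ->
    (forall l, P.[t l] = Q.[t l]) ->
  P = Q.
Proof.
move=> inj_t t01 szP szQ [[p0 p1] [p3 p4]] [[q0 q1] [q3 q4]].
apply: (@bubble_unique 2) => //; apply: bubble2_dvd; rewrite ?derivB hornerD
  hornerN ?p0 ?p1 ?p3 ?p4 ?q0 ?q1 ?q3 ?q4 subrr //.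
Qed.

Lemma poly_eq_on01 P Q : (forall t, 0 < t < 1 -> P.[t] = Q.[t]) -> P = Q.
Proof.
move=> PQ; apply/eqP; rewrite -subr_eq0; apply/eqP.
pose t (i : 'I_(size (P - Q))) : R := (i.+2%:R)^-1.
have t01 i : 0 < t i < 1 by rewrite invr_gt0 ltr0n invf_lt1 ?ltr0n // ltr1n.
apply: (@poly_eq0_at _ _ t) => //.
  move=> i j /invr_inj/eqP; rewrite eqr_nat => /eqP[?]; exact: ord_inj.
by move=> l; rewrite hornerD hornerN PQ ?subrr.
Qed.
End EndPoints.

(** * Polynomials in two variables *)

Section BivariateDefs.
Variable R : realType.
Local Notation bipoly := {poly {poly R}}.
Implicit Types (P : bipoly) (A B g : {poly R}) (q : plane R).

(** A polynomial in [U] and [V] is a polynomial in [V] with coefficients in the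
    polynomials in [U].  [restr A B P] is [P] along the curve [(A, B)], and
    [subst P g] is [g] evaluated at [P]. *)
Definition varU : bipoly := 'X%:P.
Definition varV : bipoly := 'X.
Definition cst2 (c : R) : bipoly := c%:P%:P.

Definition ev q P : R := (P.[q.2%:P]).[q.1].
Definition restr A B P : {poly R} := (map_poly (comp_poly A) P).[B].
Definition subst P g : bipoly := (map_poly cst2 g).[P].
Definition dU P : bipoly := map_poly (@deriv R) P.
Definition dV P : bipoly := P^`().
End BivariateDefs.

(** The directional derivative is locked, so that rewriting with the rules for
    sums and products does not see through it. *)
HB.lock Definition dd (R : realType) (e : plane R) (P : {poly {poly R}}) :
    {poly {poly R}} :=
  cst2 e.1 * dU P + cst2 e.2 * dV P.
Arguments dd {R} e P.

Section Bivariate.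
Variable R : realType.
Local Notation bipoly := {poly {poly R}}.
Implicit Types (P Q : bipoly) (A B g : {poly R}) (q e : plane R) (w : nat * nat).

Local Notation varU := (varU R).
Local Notation varV := (varV R).

Lemma ddE e P : dd e P = cst2 e.1 * dU P + cst2 e.2 * dV P.
Proof. by rewrite unlock. Qed.

HB.instance Definition _ := GRing.RMorphism.copy (@cst2 R) (polyC \o polyC).
HB.instance Definition _ q :=
  GRing.RMorphism.copy (ev q) (horner_eval q.1 \o horner_eval q.2%:P).
HB.instance Definition _ A B :=
  GRing.RMorphism.copy (restr A B) (horner_eval B \o map_poly (comp_poly A)).
HB.instance Definition _ P :=
  GRing.RMorphism.copy (subst P) (horner_eval P \o map_poly (@cst2 R)).

Lemma ev_cst q c : ev q (cst2 c) = c.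
Proof. by rewrite /ev !hornerC. Qed.
Lemma ev_U q : ev q varU = q.1.
Proof. by rewrite /ev hornerC hornerX. Qed.
Lemma ev_V q : ev q varV = q.2.
Proof. by rewrite /ev hornerX hornerC. Qed.

Lemma evD q P Q : ev q (P + Q) = ev q P + ev q Q.
Proof. by rewrite /ev !hornerD. Qed.
Lemma evN q P : ev q (- P) = - ev q P.
Proof. by rewrite /ev !hornerN. Qed.
Lemma evM q P Q : ev q (P * Q) = ev q P * ev q Q.
Proof. by rewrite /ev !hornerM. Qed.
Lemma ev1 q : ev q 1 = 1.
Proof. by rewrite /ev !hornerC. Qed.

Lemma restrD A B P Q : restr A B (P + Q) = restr A B P + restr A B Q.
Proof. by rewrite /restr rmorphD hornerD. Qed.
Lemma restrM A B P Q : restr A B (P * Q) = restr A B P * restr A B Q.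
Proof. by rewrite /restr rmorphM hornerM. Qed.
Lemma restr0 A B : restr A B 0 = 0.
Proof. by rewrite /restr rmorph0 horner0. Qed.
Lemma restr1 A B : restr A B 1 = 1.
Proof. by rewrite /restr rmorph1 hornerC. Qed.
Lemma restrN A B P : restr A B (- P) = - restr A B P.
Proof. by apply/eqP; rewrite -addr_eq0 -restrD addNr restr0. Qed.
Lemma restrX A B P k : restr A B (P ^+ k) = restr A B P ^+ k.
Proof.
by elim: k => [|k IHk]; rewrite ?expr0 ?restr1 // !exprS restrM IHk.
Qed.
Lemma restr_nat A B n : restr A B n%:R = n%:R.
Proof.
by elim: n => [|n IHn]; rewrite ?restr0 // -!natr1 restrD IHn restr1.
Qed.

Lemma cst2N (c : R) : cst2 (- c) = - cst2 c.
Proof. by rewrite /cst2 !polyCN. Qed.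
Lemma cst20 : @cst2 R 0 = 0.
Proof. by rewrite /cst2 !polyC0. Qed.
Lemma cst21 : @cst2 R 1 = 1.
Proof. by rewrite /cst2 !polyC1. Qed.

Lemma restr_poly A B g : restr A B g%:P = g \Po A.
Proof. by rewrite /restr map_polyC hornerC. Qed.
Lemma restr_cst A B c : restr A B (cst2 c) = c%:P.
Proof. by rewrite restr_poly comp_polyC. Qed.
Lemma restr_U A B : restr A B varU = A.
Proof. by rewrite restr_poly comp_polyX. Qed.
Lemma restr_V A B : restr A B varV = B.
Proof. by rewrite /restr map_polyX hornerX. Qed.

Lemma subst_cst P c : subst P c%:P = cst2 c.
Proof. by rewrite /subst map_polyC hornerC. Qed.
Lemma subst_X P : subst P 'X = P.
Proof. by rewrite /subst map_polyX hornerX. Qed.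

Lemma dU_poly g : dU g%:P = (g^`())%:P.
Proof. by rewrite /dU map_polyC. Qed.
Lemma dUD P Q : dU (P + Q) = dU P + dU Q.
Proof. by apply/polyP => j; rewrite !(coef_map_id0, coefD, deriv0) // derivD. Qed.
Lemma dUM P Q : dU (P * Q) = dU P * Q + P * dU Q.
Proof.
apply/polyP => j; rewrite coef_map_id0 ?deriv0 // coefM raddf_sum coefD !coefM.
rewrite -big_split; apply: eq_bigr => i _.
by rewrite /= derivM !coef_map_id0 ?deriv0.
Qed.

Lemma ddD e P Q : dd e (P + Q) = dd e P + dd e Q.
Proof. by rewrite !ddE dUD /dV derivD; ring. Qed.
Lemma ddM e P Q : dd e (P * Q) = dd e P * Q + P * dd e Q.
Proof. by rewrite !ddE dUM /dV derivM; ring. Qed.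
Lemma dd_cst e c : dd e (cst2 c) = 0.
Proof. by rewrite !ddE dU_poly /dV !derivC polyC0 !mulr0 addr0. Qed.
Lemma dd_U e : dd e varU = cst2 e.1.
Proof. by rewrite !ddE dU_poly /dV derivC derivX polyC1 mulr1 mulr0 addr0. Qed.
Lemma dd_V e : dd e varV = cst2 e.2.
Proof.
rewrite ddE /dV derivX mulr1 /dU.
have -> : map_poly (@deriv R) varV = 0.
  apply/polyP => j; rewrite coef_map_id0 ?deriv0 // coefX coef0.
  by case: (j == 1%N); rewrite ?deriv0 // -polyC1 derivC.
by rewrite mulr0 add0r.
Qed.
Lemma dd0 e : dd e 0 = 0.
Proof. by have := dd_cst e 0; rewrite /cst2 !polyC0. Qed.
Lemma dd1 e : dd e 1 = 0.
Proof. by have := dd_cst e 1; rewrite /cst2 !polyC1. Qed.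
Lemma ddN e P : dd e (- P) = - dd e P.
Proof. by apply/eqP; rewrite -addr_eq0 -ddD addNr dd0. Qed.
Lemma ddX e P k : dd e (P ^+ k.+1) = k.+1%:R * P ^+ k * dd e P.
Proof.
elim: k => [|k IHk]; first by rewrite expr1 expr0 !mul1r.
by rewrite exprS ddM IHk !exprS; ring.
Qed.
Lemma bipoly_ind (Pr : bipoly -> Prop) :
    (forall g, Pr g%:P) -> (forall P Q, Pr P -> Pr Q -> Pr (P + Q)) ->
    (forall P, Pr P -> Pr (P * varV)) ->
  forall P, Pr P.
Proof.
by move=> PC PD PV; elim/poly_ind => [|P c IHP]; rewrite -?polyC0; auto.
Qed.

Lemma horner_restr A B P t : (restr A B P).[t] = ev (A.[t], B.[t]) P.
Proof.
elim/bipoly_ind: P => [g|P Q IHP IHQ|P IHP].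
- by rewrite restr_poly /ev hornerC horner_comp.
- by rewrite !rmorphD hornerD IHP IHQ.
- by rewrite !rmorphM hornerM IHP /= restr_V ev_V.
Qed.

Lemma restr_comp A B C P : restr A B P \Po C = restr (A \Po C) (B \Po C) P.
Proof.
elim/bipoly_ind: P => [g|P Q IHP IHQ|P IHP].
- by rewrite !restr_poly comp_polyA.
- by rewrite !rmorphD /= IHP IHQ.
- by rewrite !rmorphM /= IHP !restr_V.
Qed.

Lemma restr_subst A B P g : restr A B (subst P g) = g \Po restr A B P.
Proof.
elim/poly_ind: g => [|g c IHg]; first by rewrite !rmorph0.
rewrite comp_polyD comp_polyM comp_polyX comp_polyC.
by rewrite 2!rmorphD 2!rmorphM /= subst_cst subst_X IHg restr_cst.
Qed.

Lemma dd_subst e P g : dd e P = 0 -> dd e (subst P g) = 0.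
Proof.
move=> P0; elim/poly_ind: g => [|g c IHg]; first by rewrite rmorph0 dd0.
rewrite rmorphD rmorphM /= subst_cst subst_X ddD ddM IHg P0 dd_cst.
by rewrite mul0r mulr0 !addr0.
Qed.

(** The chain rule along a curve with polynomial coordinates. *)
Lemma deriv_restr A B P : (restr A B P)^`() =
  A^`() * restr A B (dU P) + B^`() * restr A B (dV P).
Proof.
elim/bipoly_ind: P => [g|P Q IHP IHQ|P IHP].
- rewrite dU_poly /dV derivC rmorph0 mulr0 addr0 !restr_poly deriv_comp.
  by rewrite mulrC.
- by rewrite dUD /dV derivD !rmorphD derivD IHP IHQ /dV; ring.
- have [dU_V dV_V] : dU varV = 0 /\ dV varV = 1.
    split; last by rewrite /dV derivX.
    have := dd_V (1, 0); rewrite ddE /= /cst2 !polyC0 !polyC1.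
    by rewrite mul1r mul0r addr0.
  have -> : dV (P * varV) = dV P * varV + P * dV varV by rewrite /dV derivM.
  rewrite dUM dU_V dV_V mulr0 addr0 mulr1 rmorphD !rmorphM /= derivM IHP.
  by rewrite restr_V; ring.
Qed.

(** The points with natural coordinates suffice: a nonzero polynomial in one
    variable has finitely many roots, first in [V] and then in [U]. *)
Lemma ev_inj P : (forall q, ev q P = 0) -> P = 0.
Proof.
move=> P0.
have natRI n : injective (fun i : 'I_n => (i : nat)%:R : R).
  by move=> i j /eqP; rewrite eqr_nat => /eqP/val_inj.
apply: (@poly_eq0_at _ _ (fun i : 'I_(size P) => (i : nat)%:R%:P) P) => //.
  by move=> i j /polyC_inj/natRI.
move=> i; set g := P.[_].
apply: (@poly_eq0_at _ _ (fun i : 'I_(size g) => (i : nat)%:R) g) => // j.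
exact: (P0 (_, _)).
Qed.

(** ** Weighted degrees *)

(** The weights [(1, 1)] give the total degree, [(1, 0)] and [(0, 1)] the two
    partial degrees; the degree is less than [n], so that [n = 0] forces the
    zero polynomial. *)
Definition below w n P : Prop :=
  forall i j, (n <= w.1 * i + w.2 * j)%N -> P`_j`_i = 0.

Lemma below_leq w m n P : (m <= n)%N -> below w m P -> below w n P.
Proof. by move=> mn Pm i j nij; apply: Pm; apply: leq_trans nij. Qed.

Lemma below0 w n : below w n 0.
Proof. by move=> i j _; rewrite !coef0. Qed.

Lemma belowD w n P Q : below w n P -> below w n Q -> below w n (P + Q).
Proof. by move=> Pn Qn i j nij; rewrite !coefD Pn // Qn // addr0. Qed.

Lemma belowN w n P : below w n P -> below w n (- P).
Proof. by move=> Pn i j nij; rewrite !coefN Pn // oppr0. Qed.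

Lemma below_sum w n (I : Type) (s : seq I) (r : pred I) (F : I -> bipoly) :
  (forall i, r i -> below w n (F i)) -> below w n (\sum_(i <- s | r i) F i).
Proof.
move=> Fn; apply: (big_ind (below w n)) => //; first exact: below0.
exact: belowD.
Qed.

Lemma belowM w m n P Q :
  below w m.+1 P -> below w n.+1 Q -> below w (m + n).+1 (P * Q).
Proof.
move=> Pm Qn i j mnij; rewrite coefM coef_sum big1 // => -[k /=].
rewrite ltnS => kj _; rewrite coefM big1 // => -[l /=].
rewrite ltnS => li _.
have [lt_m|ge_m] := ltnP m (w.1 * l + w.2 * k); first by rewrite Pm ?mul0r.
rewrite Qn ?mulr0 // !mulnBr; move: mnij ge_m.
have : (w.1 * l <= w.1 * i)%N by rewrite leq_mul2l li orbT.
have : (w.2 * k <= w.2 * j)%N by rewrite leq_mul2l kj orbT.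
by lia.
Qed.

Lemma below_cst w c : below w 1 (cst2 c).
Proof.
move=> i j ij; rewrite coefC; case: eqP => [j0|_]; last by rewrite coef0.
by rewrite coefC; case: eqP => // i0; move: ij; rewrite j0 i0 !muln0.
Qed.

Lemma below_U w : below w w.1.+1 varU.
Proof.
move=> i j ij; rewrite coefC; case: eqP => [j0|_]; last by rewrite coef0.
by rewrite coefX; case: eqP => // i0; move: ij; rewrite j0 i0 muln0; lia.
Qed.

Lemma below_V w : below w w.2.+1 varV.
Proof.
move=> i j ij; rewrite coefX; case: eqP => [j1|_]; last by rewrite coef0.
by rewrite coef1; case: eqP => // i0; move: ij; rewrite j1 i0 muln0; lia.
Qed.

Lemma below1 w : below w 1 1.
Proof. by have := @below_cst w 1; rewrite /cst2 !polyC1. Qed.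

Lemma belowX w n P k : below w n.+1 P -> below w (k * n).+1 (P ^+ k).
Proof.
move=> Pn; elim: k => [|k IHk]; first by rewrite expr0; exact: below1.
by rewrite exprS mulSn; exact: belowM.
Qed.

(** The degree bound is asked for when [0 < n] only: [g] is 0 when [n = 0]. *)
Lemma belowM_subst w m d n N C P g :
    below w m.+1 C -> below w d.+1 P -> (size g <= n)%N ->
    ((0 < n)%N -> (m + n.-1 * d < N)%N) ->
  below w N (C * subst P g).
Proof.
move=> Cm Pd gn mdN.
have -> : subst P g = \sum_(i < n) cst2 g`_i * P ^+ i.
  rewrite /subst (horner_coef_wide _ (leq_trans (size_poly _ _) gn)).
  by apply: eq_bigr => i _; rewrite coef_map.
rewrite mulr_sumr; apply: below_sum => i _.
have lt_in := ltn_ord i.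
apply: (@below_leq _ (m + (0 + i * d)).+1); last first.
  by apply: belowM => //; apply: belowM; [exact: below_cst | exact: belowX].
apply: leq_trans (mdN (leq_ltn_trans (leq0n _) lt_in)).
by rewrite add0n ltnS leq_add2l leq_mul2r; apply/orP; right; lia.
Qed.

(** Division by [varV - a] lowers the weighted degree by the weight of [varV]:
    the coefficients of the quotient are found from the top down by
    [Q_j = P_(j+1) + a * Q_(j+1)]. *)
Lemma below_divV w n (a0 a1 : R) Q : (a1 != 0 -> (w.1 <= w.2)%N) ->
    below w n ((varV - (a0%:P + a1%:P * 'X)%:P) * Q) ->
  below w (n - w.2) Q.
Proof.
move=> a1w PQ i j nij.
have [k] : exists k, (size Q <= j + k)%N by exists (size Q); rewrite leq_addl.
elim: k i j nij => [|k IHk] i l nil szl.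
  by rewrite addn0 in szl; rewrite (nth_default 0 szl) coef0.
have Ql i' : Q`_l`_i' = ((varV - (a0%:P + a1%:P * 'X)%:P) * Q)`_l.+1`_i'
    + a0 * Q`_l.+1`_i' + a1 * ('X * Q`_l.+1)`_i'.
  have -> : ((varV - (a0%:P + a1%:P * 'X)%:P) * Q)`_l.+1 =
      Q`_l - (a0%:P * Q`_l.+1 + a1%:P * ('X * Q`_l.+1)).
    by rewrite mulrBl coefB coefXM coefCM /= mulrDl mulrA.
  by rewrite coefB coefD !coefCM; ring.
rewrite Ql PQ; last by rewrite mulnSr; lia.
rewrite IHk; [|by rewrite mulnSr; lia|by lia].
rewrite add0r mulr0 add0r.
have [->|a10] := eqVneq a1 0; first by rewrite mul0r.
rewrite coefXM; case: i {Ql} nil => [|i] nil; first by rewrite mulr0.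
rewrite /= IHk ?mulr0 //; last by lia.
by move: nil (a1w a10); rewrite !mulnSr; lia.
Qed.

Lemma below_divU w n (a : R) Q :
  below w n ((varU - cst2 a) * Q) -> below w (n - w.1) Q.
Proof.
move=> PQ i j nij.
have [k] : exists k, (size (Q`_j)%R <= i + k)%N.
  by exists (size Q`_j)%R; rewrite leq_addl.
elim: k i nij => [|k IHk] l nil szl.
  by rewrite addn0 in szl; rewrite (nth_default 0 szl).
have -> : Q`_j`_l = ((varU - cst2 a) * Q)`_j`_l.+1 + a * Q`_j`_l.+1.
  by rewrite -polyCB coefCM mulrBl coefB coefXM coefCM /=; ring.
rewrite PQ; last by rewrite mulnSr; lia.
by rewrite IHk ?mulr0 ?addr0 //; [rewrite mulnSr; lia|lia].
Qed.

Lemma divV A P : P.[A] = 0 -> exists Q, P = (varV - A%:P) * Q.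
Proof. by move=> /rootP/factor_theorem[Q ->]; exists Q; rewrite mulrC. Qed.

Lemma divU (a : R) P : restr a%:P 'X P = 0 -> exists Q, P = (varU - cst2 a) * Q.
Proof.
move=> P0; exists (map_poly (fun g => g %/ ('X - a%:P)) P).
apply/polyP => j; rewrite -polyCB coefCM coef_map_id0 ?div0p //.
have /rootP : (P`_j).[a] = 0.
  have /(congr1 (fun g : {poly R} => g`_j)) := P0.
  rewrite /restr coef0.
  have -> : map_poly (comp_poly a%:P) P = map_poly polyC (map_poly (horner_eval a) P).
    by rewrite -map_poly_comp; apply: eq_map_poly => g /=; rewrite comp_polyCr.
  rewrite -/(_ \Po 'X) comp_polyXr.
  by rewrite coef_map_id0 ?rmorph0 //.
by rewrite root_factor_theorem => /divpK {1}<-; rewrite mulrC.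
Qed.

End Bivariate.

(** * The reference triangle and the reference square *)

(** [b] tells the square from the triangle; side [r] joins the corners [r] and
    [r + 1]. *)
Notation side b := 'Z_(3 + nat_of_bool b).

Lemma side_ind (Pr : forall b, side b -> Prop) :
    Pr false 0 -> Pr false 1 -> Pr false 2%:R ->
    Pr true 0 -> Pr true 1 -> Pr true 2%:R -> Pr true 3%:R ->
  forall b r, Pr b r.
Proof.
move=> f0 f1 f2 t0 t1 t2 t3 [] [[|[|[|[|//]]]] i] //.
- by congr (Pr _ _): t0; apply/val_inj.
- by congr (Pr _ _): t1; apply/val_inj.
- by congr (Pr _ _): t2; apply/val_inj.
- by congr (Pr _ _): t3; apply/val_inj.
- by congr (Pr _ _): f0; apply/val_inj.
- by congr (Pr _ _): f1; apply/val_inj.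
- by congr (Pr _ _): f2; apply/val_inj.
Qed.

Section Shapes.
Variable R : realType.
Local Notation bipoly := {poly {poly R}}.
Local Notation U := (varU R).
Local Notation V := (varV R).

(** The affine function that vanishes on side [r], and whose derivative in the
    direction [tau r] is 1. *)
Definition lam b (r : side b) : bipoly :=
  let k := nat_of_ord r in
  if b then match k with 0%N => V | 1%N => 1 - U | 2%N => 1 - V | _ => U end
  else match k with 0%N => V | 1%N => 1 - U - V | _ => U end.

(** Side [r], parametrized from the corner [r] to the corner [r + 1]. *)
Definition spath b (r : side b) : {poly R} * {poly R} :=
  let k := nat_of_ord r in
  if b then match k with
    0%N => ('X, 0) | 1%N => (1, 'X) | 2%N => (1 - 'X, 1) | _ => (0, 1 - 'X) end
  else match k with
    0%N => ('X, 0) | 1%N => (1 - 'X, 'X) | _ => (0, 1 - 'X) end.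

Definition edir b (r : side b) : plane R :=
  let k := nat_of_ord r in
  if b then match k with
    0%N => (1, 0) | 1%N => (0, 1) | 2%N => (-1, 0) | _ => (0, -1) end
  else match k with 0%N => (1, 0) | 1%N => (-1, 1) | _ => (0, -1) end.

(** The direction from the corner [r] to the corner [r - 1]. *)
Definition tau b (r : side b) : plane R :=
  let k := nat_of_ord r in
  if b then match k with
    0%N => (0, 1) | 1%N => (-1, 0) | 2%N => (0, -1) | _ => (1, 0) end
  else match k with 0%N => (0, 1) | 1%N => (-1, 0) | _ => (1, -1) end.

(** The factor that vanishes on the side opposite to [r], if there is one. *)
Definition om b (r : side b) : bipoly := if b then lam (r + 2%:R) else 1.

(** This product is 1 at the corner [r] and vanishes at all other corners. *)
Definition mu b (r : side b) : bipoly := lam (r + 1) * om r.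

(** Trace and transverse derivative on a side. *)
Definition tr b (r : side b) (P : bipoly) : {poly R} :=
  restr (spath r).1 (spath r).2 P.
Definition td b (r : side b) (P : bipoly) : {poly R} := tr r (dd (tau r) P).

Lemma trD b (r : side b) P Q : tr r (P + Q) = tr r P + tr r Q.
Proof. exact: restrD. Qed.
Lemma trM b (r : side b) P Q : tr r (P * Q) = tr r P * tr r Q.
Proof. exact: restrM. Qed.
Lemma trX b (r : side b) P k : tr r (P ^+ k) = tr r P ^+ k.
Proof. exact: restrX. Qed.
Lemma tr0 b (r : side b) : tr r 0 = 0.
Proof. exact: restr0. Qed.
Lemma tr_cst b (r : side b) c : tr r (cst2 c) = c%:P.
Proof. exact: restr_cst. Qed.
Lemma tr1 b (r : side b) : tr r 1 = 1.
Proof. exact: restr1. Qed.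
Lemma trN b (r : side b) P : tr r (- P) = - tr r P.
Proof. exact: restrN. Qed.
Lemma tr_nat b (r : side b) n : tr r n%:R = n%:R.
Proof. exact: restr_nat. Qed.
Lemma tr_sum b (r : side b) (I : finType) (F : I -> bipoly) :
  tr r (\sum_i F i) = \sum_i tr r (F i).
Proof. exact: (big_morph _ (@trD b r) (tr0 r)). Qed.
Lemma tr_subst b (r : side b) P g : tr r (subst P g) = g \Po tr r P.
Proof. exact: restr_subst. Qed.

Local Ltac sides := apply: side_ind;
  rewrite /td /mu /om /tr /lam /spath /tau /=.
Local Ltac compute_restr :=
  rewrite ?(restrD, restrN, restrM, restr1, restr0, restr_U, restr_V, restr_cst).
Local Ltac compute_dd :=
  rewrite ?(ddM, ddD, ddN, dd1, dd_U, dd_V, dd_cst) /= ?(cst2N, cst21, cst20).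

Lemma tr_lam b r : tr r (@lam b r) = 0.
Proof. by move: b r; sides; compute_restr; ring. Qed.
Lemma tr_lam_prev b r : tr r (@lam b (r - 1)) = 'X.
Proof. by move: b r; sides; compute_restr; ring. Qed.
Lemma tr_lam_next b r : tr r (@lam b (r + 1)) = 1 - 'X.
Proof. by move: b r; sides; compute_restr; ring. Qed.
Lemma tr_om b r : tr r (@om b r) = 1.
Proof. by move: b r; sides; compute_restr; ring. Qed.
Lemma tr_mu b r : tr r (@mu b r) = 1 - 'X.
Proof. by rewrite trM tr_lam_next tr_om mulr1. Qed.
Lemma tr_mu_next b r : tr r (@mu b (r + 1)) = 'X.
Proof. by move: b r; sides; compute_restr; ring. Qed.

Lemma dd_lam b r : dd (tau r) (@lam b r) = 1.
Proof. by move: b r; sides; compute_dd; ring. Qed.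
Lemma dd_lam_prev b r : dd (tau r) (@lam b (r - 1)) = 0.
Proof. by move: b r; sides; compute_dd; ring. Qed.
Lemma dd_lam_next b r : dd (tau r) (@lam b (r + 1)) = - cst2 (~~ b)%:R.
Proof. by move: b r; sides; compute_dd; ring. Qed.
Lemma dd_om b r : dd (tau r) (@om b r) = - cst2 b%:R.
Proof. by move: b r; sides; compute_dd; ring. Qed.

Lemma td_mu b r : td r (@mu b r) = - (if b then 1 - 'X else 1).
Proof. by move: b r; sides; compute_dd; compute_restr; ring. Qed.
Lemma td_mu_next b r : td r (@mu b (r + 1)) = - (if b then 'X else 0).
Proof. by move: b r; sides; compute_dd; compute_restr; ring. Qed.

Lemma deriv_tr b (r : side b) P : (tr r P)^`() = tr r (dd (edir r) P).
Proof.
rewrite deriv_restr ddE trD !trM !tr_cst /tr.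
by congr (_ * _ + _ * _); move: b r {P}; sides; rewrite ?derivB ?derivX -?polyC1
  ?derivC ?sub0r -?polyCN.
Qed.

Lemma tdM b (r : side b) P Q : td r (P * Q) = td r P * tr r Q + tr r P * td r Q.
Proof. by rewrite /td ddM trD !trM. Qed.
Lemma tdD b (r : side b) P Q : td r (P + Q) = td r P + td r Q.
Proof. by rewrite /td ddD trD. Qed.
Lemma td0 b (r : side b) : td r 0 = 0.
Proof. by rewrite /td dd0 tr0. Qed.
Lemma td_sum b (r : side b) (I : finType) (F : I -> bipoly) :
  td r (\sum_i F i) = \sum_i td r (F i).
Proof. exact: (big_morph _ (@tdD b r) (td0 r)). Qed.

(** Multiples of the square of [lam r] are invisible to the boundary data of
    side [r]; this is what makes the sides and corners independent. *)
Lemma tr_sqr0 b (r : side b) P Q : lam r ^+ 2 * Q = P -> tr r P = 0.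
Proof. by move=> <-; rewrite trM trX tr_lam expr0n mul0r. Qed.
Lemma td_sqr0 b (r : side b) P Q : lam r ^+ 2 * Q = P -> td r P = 0.
Proof.
move=> <-; rewrite tdM trX tr_lam /td ddX !trM trX tr_lam !expr0n /=.
by rewrite mulr0 !mul0r addr0.
Qed.

Lemma lam_dvd_mu b (r r' : side b) : r' != r -> r' != r + 1 ->
  exists Q, mu r' = lam r * Q.
Proof.
move: b r r'; apply: side_ind; move=> [[|[|[|[|//]]]] i] //= _ _;
  rewrite /mu /om /lam /=; try (by eexists; rewrite mulr1; reflexivity);
  try (by eexists; reflexivity); try (by eexists; rewrite mulrC; reflexivity).
Qed.

Lemma lam_dvd_sides b (r r' : side b) : r' != r ->
  exists Q, om r * lam (r - 1) * lam (r + 1) = lam r' * Q.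
Proof.
move: b r r'; apply: side_ind; move=> [[|[|[|[|//]]]] i] //= _;
  rewrite /om /lam /=.
all: try (by eexists; rewrite mul1r; reflexivity).
all: try (by eexists; rewrite -mulrA; reflexivity).
all: try (by eexists; rewrite mulrC; reflexivity).
all: try (by eexists; rewrite mulrAC mulrC; reflexivity).
Qed.

(** ** Boundary data *)

(** The value and the first and second derivatives at a corner [r], in the
    affine coordinates [lam (r - 1)] and [lam r] centred there. *)
Record jet := Jet { j0 : R; jx : R; jy : R; jxx : R; jxy : R; jyy : R }.

(** The end conditions that the jets [J] at [r] and [J'] at [r + 1] impose on
    the trace and the transverse derivative of side [r].  Along this side the
    coordinates of [r + 1] are 0 and [1 - t]. *)
Definition side_jet b (J J' : jet) (g h : {poly R}) : Prop :=
  jet3 g (j0 J, jx J, jxx J) (j0 J', - jy J', jyy J') /\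
  jet2 h (jy J, jxy J)
    (jx J' - (~~ b)%:R * jy J', - (jxy J' - (~~ b)%:R * jyy J')).

(** The quadratic factor is the Taylor polynomial of the jet divided by
    [mu r ^+ 3]; the mixed coefficient depends on the shape because [mu r] is
    [1 - x - y] on the triangle and [(1 - x) * (1 - y)] on the square. *)
Definition quadratic b (J : jet) (x y : bipoly) : bipoly :=
  cst2 (j0 J) + cst2 (jx J + 3%:R * j0 J) * x + cst2 (jy J + 3%:R * j0 J) * y
  + cst2 (jxx J / 2%:R + 3%:R * jx J + 6%:R * j0 J) * x ^+ 2
  + cst2 (jxy J + 3%:R * jx J + 3%:R * jy J + (if b then 9 else 12)%:R * j0 J)
      * (x * y)
  + cst2 (jyy J / 2%:R + 3%:R * jy J + 6%:R * j0 J) * y ^+ 2.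

Definition corner_poly b (J : jet) (r : side b) : bipoly :=
  mu r ^+ 3 * quadratic b J (lam (r - 1)) (lam r).

Lemma tr_corner b J r : tr r (@corner_poly b J r) = corner3 (j0 J, jx J, jxx J).
Proof.
rewrite /corner_poly /quadratic.
rewrite !(tr_mu, tr_lam, tr_lam_prev, tr_cst, trD, trX, trM) /corner3 /taylor3 /=.
by rewrite !(mulr0, addr0, expr0n).
Qed.

Lemma tr_corner_next b J r : tr r (@corner_poly b J (r + 1)) =
  corner3 (j0 J, jy J, jyy J) \Po (1 - 'X).
Proof.
rewrite /corner_poly /quadratic addrK.
rewrite !(tr_mu_next, tr_lam, tr_lam_next, tr_cst, trD, trX, trM).
rewrite corner3_flip taylor3_flip /=; ring.
Qed.

Lemma td_corner b J r : td r (@corner_poly b J r) = (1 - 'X) ^+ 2 *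
  (3%:R * (- (if b then 1 - 'X else 1)) * taylor3 (j0 J, jx J, jxx J)
   + (1 - 'X) * ((jy J + 3%:R * j0 J)%:P
       + (jxy J + 3%:R * jx J + 3%:R * jy J
          + (if b then 9 else 12)%:R * j0 J)%:P * 'X)).
Proof.
have q0 : tr r (quadratic b J (lam (r - 1)) (lam r)) =
    taylor3 (j0 J, jx J, jxx J).
  rewrite /quadratic !(tr_lam, tr_lam_prev, tr_cst, trD, trX, trM) /taylor3 /=.
  by ring.
rewrite /corner_poly tdM trX tr_mu q0 /quadratic.
rewrite {1}/td ddX !(tr_mu, tr_nat, trX, trM) -/(td r (mu r)) td_mu.
rewrite /td !(dd_lam, dd_lam_prev, dd_cst, ddX, ddD, ddM).
rewrite !(tr_lam, tr_lam_prev, tr_cst, tr1, tr0, tr_nat, trD, trX, trM).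
by case: b r {q0} => r; ring.
Qed.

Lemma td_corner_next b J r : td r (@corner_poly b J (r + 1)) = 'X ^+ 2 *
  (3%:R * (- (if b then 'X else 0))
     * (taylor3 (j0 J, jy J, jyy J) \Po (1 - 'X))
   + 'X * ((jx J + 3%:R * j0 J)%:P
       + (jxy J + 3%:R * jx J + 3%:R * jy J
          + (if b then 9 else 12)%:R * j0 J)%:P * (1 - 'X)
       - (~~ b)%:R * ((jy J + 3%:R * j0 J)%:P
           + (jyy J + 6%:R * jy J + 12%:R * j0 J)%:P * (1 - 'X)))).
Proof.
have q0 : tr r (quadratic b J (lam r) (lam (r + 1))) =
    taylor3 (j0 J, jy J, jyy J) \Po (1 - 'X).
  rewrite /quadratic !(tr_lam, tr_lam_next, tr_cst, trD, trX, trM).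
  by rewrite taylor3_flip /=; ring.
rewrite /corner_poly addrK tdM trX tr_mu_next q0 /quadratic.
rewrite {1}/td ddX !(tr_mu_next, tr_nat, trX, trM).
rewrite -/(td r (mu (r + 1))) td_mu_next.
rewrite /td !(dd_lam, dd_lam_next, dd_cst, ddX, ddD, ddM).
rewrite !(tr_lam, tr_lam_next, tr_cst, tr1, tr0, tr_nat, trN, trD, trX, trM).
have -> : (jyy J + 6%:R * jy J + 12%:R * j0 J)%:P =
    2%:R * (jyy J / 2%:R + 3%:R * jy J + 6%:R * j0 J)%:P.
  by rewrite -polyC_natr -polyCM; congr (_%:P); field.
by case: b r {q0} => r; ring.
Qed.

Lemma side_jet_corner b J J' r :
  side_jet b J J' (tr r (@corner_poly b J r + corner_poly J' (r + 1)))
    (td r (@corner_poly b J r + corner_poly J' (r + 1))).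
Proof.
split.
  rewrite trD tr_corner tr_corner_next.
  have := jet3D (corner3_jet (j0 J, jx J, jxx J))
    (jet3_flip (corner3_jet (j0 J', jy J', jyy J'))).
  by rewrite /= !(addr0, add0r, oppr0).
rewrite tdD td_corner td_corner_next.
set Z := (X in jet2 (_ * X + _)); set W := (X in jet2 (_ + _ * X)).
have := jet2_ends Z W; congr jet2; congr (_, _); rewrite {}/Z {}/W;
  rewrite ?taylor3_flip /taylor3;
  rewrite !(derivM, derivD, derivN, derivC, derivX, deriv_1subX, expr2) -?polyC_natr;
  rewrite !(derivM, derivD, derivN, derivC, derivX, hornerM, hornerD, hornerN, horner_exp, hornerC, hornerX, hornerMn).
all: case: b r => r /=; rewrite ?derivC ?derivX ?deriv_1subX !(hornerM, hornerD, hornerN, horner_exp, hornerC, hornerX, hornerMn).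
all: by field.
Qed.

End Shapes.

(** * Interpolation of boundary data *)

Section LocalExistence.
Variable R : realType.
Local Notation bipoly := {poly {poly R}}.

Definition weights (b : bool) : seq (nat * nat) :=
  if b then [:: (1, 0); (0, 1)]%N else [:: (1, 1)%N].

(** Degree less than [n]: total degree on the triangle, both partial degrees on
    the square. *)
Definition deg_lt (b : bool) (n : nat) (P : bipoly) : Prop :=
  forall w, w \in weights b -> below w n P.

(** The weighted degree of [lam r]. *)
Definition wlam b (r : side b) (w : nat * nat) : nat :=
  if b && ~~ odd r then w.2 else w.1.

Lemma below_lam b (r : side b) w :
  w \in weights b -> below w (wlam r w).+1 (lam R r).
Proof.
move: b r w; apply: side_ind => w; rewrite /weights /wlam /lam !inE /=.
all: first [move=> /eqP -> | move=> /orP[] /eqP ->] => /=.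
all: do ?[apply: belowD | apply: belowN].
all: match goal with
  | |- below ?w _ (varU _) => apply: (@below_leq _ w w.1.+1 _ _ _ (@below_U R w))
  | |- below ?w _ (varV _) => apply: (@below_leq _ w w.2.+1 _ _ _ (@below_V R w))
  | |- below ?w _ 1 => apply: (@below_leq _ w 1 _ _ _ (@below1 R w))
  end.
all: by [].
Qed.

Lemma weights_cases b (r : side b) w : w \in weights b ->
  [\/ [/\ b = false, wlam (r - 1) w = 1%N & wlam r w = 1%N],
      [/\ b = true, wlam (r - 1) w = 1%N & wlam r w = 0%N]
    | [/\ b = true, wlam (r - 1) w = 0%N & wlam r w = 1%N]].
Proof.
move: b r w; apply: side_ind => w; rewrite /weights /wlam !inE /=.
all: first [move=> /eqP -> | move=> /orP[] /eqP ->] => /=.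
all: first [by constructor 1 | by constructor 2 | by constructor 3].
Qed.

Lemma wlam_next b (r : side b) w : wlam (r + 1) w = wlam (r - 1) w.
Proof. by move: b r w; apply: side_ind. Qed.

Lemma below_om b (r : side b) w : w \in weights b ->
  below w (if b then wlam r w else 0%N).+1 (om R r).
Proof.
move=> wb; rewrite /om; case: b r wb => r wb; last exact: below1.
have -> : wlam r w = wlam (r + 2%:R) w.
  by move: (r : 'Z_4) => -[[|[|[|[|//]]]] i].
exact: below_lam.
Qed.

Lemma below_mu b (r : side b) w : w \in weights b -> below w 2 (mu R r).
Proof.
move=> wb; have := belowM (@below_lam _ (r + 1) w wb) (@below_om _ r w wb).
rewrite -/(mu R r) wlam_next.
by case: (weights_cases r wb) => -[bE -> ->]; rewrite [X in if X then _ else _]bE.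
Qed.

Lemma deg_lt_corner b J (r : side b) : deg_lt b 6 (corner_poly J r).
Proof.
move=> w wb; rewrite /corner_poly.
apply: (@belowM _ w 3 2); first exact: (@belowX _ w 1 _ 3 (@below_mu _ r w wb)).
have bx := @below_lam _ (r - 1) w wb; have bx' := @below_lam _ r w wb.
have [xw yw] : (wlam (r - 1)%R w <= 1 /\ wlam r w <= 1)%N.
  by case: (weights_cases r wb) => -[_ -> ->].
have {xw}bx : below w 2 (lam R (r - 1)) by apply: below_leq bx.
have {yw bx'}by_ : below w 2 (lam R r) by apply: below_leq bx'.
have bc c P n : (n <= 3)%N -> below w n P -> below w 3 (cst2 c * P).
  move=> n3 Pn; apply: (@belowM _ w 0 2); first exact: below_cst.
  exact: below_leq Pn.
rewrite /quadratic; do !apply: belowD.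
- by apply: (@below_leq _ w 1); last exact: below_cst.
- exact: bc bx.
- exact: bc by_.
- exact: bc (@belowX _ w 1 _ 2 bx).
- exact: bc (@belowM _ w 1 1 _ _ bx by_).
- exact: bc (@belowX _ w 1 _ 2 by_).
Qed.

(** The polynomials with arbitrary traces and transverse derivatives on side
    [r], up to the bubble factors, that are invisible on all other sides. *)
Definition side_poly b (r : side b) (g h : {poly R}) : bipoly :=
  om R r ^+ 2 * lam R (r - 1) ^+ 3 * lam R (r + 1) ^+ 3 * subst (lam R (r - 1)) g
  + om R r ^+ 2 * lam R r * lam R (r - 1) ^+ 2 * lam R (r + 1) ^+ 2
    * subst (lam R (r - 1)) h.

Lemma below_side b (r : side b) w m n o N k l (g h : {poly R}) :
    below w m.+1 (lam R (r - 1)) -> below w m.+1 (lam R (r + 1)) ->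
    below w n.+1 (lam R r) -> below w o.+1 (om R r) ->
    (size g <= k)%N -> (size h <= l)%N ->
    ((0 < k)%N -> (2 * o + 3 * m + 3 * m + k.-1 * m < N)%N) ->
    ((0 < l)%N -> (2 * o + n + 2 * m + 2 * m + l.-1 * m < N)%N) ->
  below w N (side_poly r g h).
Proof.
move=> am bm ln oo gk hl kN lN.
apply: belowD; [apply: (belowM_subst _ am gk kN) | apply: (belowM_subst _ am hl lN)].
  by apply: belowM; [apply: belowM|]; exact: belowX.
by apply: belowM; [apply: belowM; [apply: belowM|]|]; try exact: belowX.
Qed.

Lemma deg_lt_side b (r : side b) p (g h : {poly R}) : (5 <= p)%N ->
    (size g <= p - 5)%N -> (size h <= p - 4 + b)%N ->
  deg_lt b p.+1 (side_poly r g h).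
Proof.
move=> hp szg szh w wb.
have := @below_lam _ (r + 1) w wb; have := @below_lam _ (r - 1) w wb.
have := @below_lam _ r w wb; have := @below_om _ r w wb.
rewrite wlam_next.
case: (weights_cases r wb) => -[bE -> ->] o0 l0 l1 l2.
all: apply: (below_side l1 l2 l0 o0 szg szh); clear -hp bE.
all: by rewrite bE /=; lia.
Qed.

Lemma tr_side b (r : side b) g h : tr r (side_poly r g h) = bubble R ^+ 3 * g.
Proof.
rewrite /side_poly /bubble.
rewrite !(tr_om, tr_lam, tr_lam_prev, tr_lam_next, tr_subst, trD, trX, trM).
by rewrite !comp_polyXr; ring.
Qed.

Lemma td_side b (r : side b) g h : td r (side_poly r g h) =
  bubble R ^+ 2 * (h - (2 * b)%:R * bubble R * g - (3 * ~~ b)%:R * 'X * g).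
Proof.
rewrite /side_poly /td /bubble ddD !ddM.
rewrite !(dd_subst _ (dd_lam_prev R r)) !(dd_om, dd_lam, dd_lam_prev, dd_lam_next, ddX).
rewrite !(trD, trM, trX, trN, tr_om, tr_lam, tr_lam_prev, tr_lam_next, tr_subst, tr_cst, tr_nat, tr0, tr1).
by rewrite !comp_polyXr; case: b r => r /=; ring.
Qed.

Lemma side_poly_other b (r r' : side b) g h : r' != r ->
  tr r (side_poly r' g h) = 0 /\ td r (side_poly r' g h) = 0.
Proof.
move=> rr'.
have [Q QE] : exists Q, om R r' * lam R (r' - 1) * lam R (r' + 1) = lam R r * Q.
  by apply: lam_dvd_sides; rewrite eq_sym.
have E : lam R r ^+ 2 * (Q ^+ 2 * (lam R (r' - 1) * lam R (r' + 1)
      * subst (lam R (r' - 1)) g + lam R r' * subst (lam R (r' - 1)) h)) =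
    side_poly r' g h.
  by rewrite mulrA -exprMn -QE /side_poly; ring.
by split; [exact: (tr_sqr0 E)|exact: (td_sqr0 E)].
Qed.

Lemma corner_poly_other b (r r' : side b) (J : jet R) : r' != r -> r' != r + 1 ->
  tr r (corner_poly J r') = 0 /\ td r (corner_poly J r') = 0.
Proof.
move=> n1 n2; have [Q QE] := lam_dvd_mu R n1 n2.
have E : lam R r ^+ 2 * (lam R r * Q ^+ 3
      * quadratic b J (lam R (r' - 1)) (lam R r')) = corner_poly J r'.
  by rewrite /corner_poly QE; ring.
by split; [exact: (tr_sqr0 E)|exact: (td_sqr0 E)].
Qed.

Lemma size_polyN_nat n (P : {poly R}) k :
  (size P <= k)%N -> (size (n%:R * P)%R <= k)%N.
Proof.
by move=> szP; rewrite -polyC_natr mul_polyC (leq_trans (size_scale_leq _ _)).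
Qed.

Lemma size_taylor3 a : (size (taylor3 a : {poly R}) <= 3)%N.
Proof.
apply: size_leD; first exact: leq_trans (size_affine _ _) _.
by apply: (@size_leM _ _ _ 0 2); rewrite ?size_polyC_leq1 ?size_polyXn.
Qed.

Lemma size_corner_td b (J J' : jet R) (r : side b) :
  (size (td r (corner_poly J r + corner_poly J' (r + 1)%R)%R) <= 5 + b)%N.
Proof.
have sz1 : (size (1 - 'X : {poly R})%R <= 2)%N by rewrite size_1subX.
have szX : (size ('X : {poly R})%R <= 2)%N by rewrite size_polyX.
have szA (a c : R) : (size (a%:P + c%:P * (1 - 'X) : {poly R})%R <= 2)%N.
  apply: size_leD; first by rewrite (leq_trans (size_polyC_leq1 _)).
  by apply: (@size_leM _ _ _ 0 1); rewrite ?size_polyC_leq1.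
have sz_le k (P : {poly R}) : (size P <= k)%N -> (size P <= k + b)%N.
  by move=> /leq_trans; apply; exact: leq_addr.
have szb : (size (- (if b then 1 - 'X else 1) : {poly R})%R <= b.+1)%N.
  by rewrite size_polyN; case: (b); rewrite ?size_poly1.
have szb' : (size (- (if b then 'X else 0) : {poly R})%R <= b.+1)%N.
  by rewrite size_polyN; case: (b); rewrite ?size_poly0.
rewrite tdD td_corner td_corner_next; apply: size_leD.
  apply: (@size_leM _ _ _ 2 (2 + b)); first exact: (@size_leX _ _ 1).
  apply: size_leD; last first.
    by apply: (sz_le 3%N); apply: (@size_leM _ _ _ 1 1) => //; exact: size_affine.
  rewrite addnC; apply: (@size_leM _ _ _ b 2); last exact: size_taylor3.
  exact: size_polyN_nat.
apply: (@size_leM _ _ _ 2 (2 + b)); first exact: (@size_leX _ _ 1).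
apply: size_leD; last first.
  apply: (sz_le 3%N); apply: (@size_leM _ _ _ 1 1) => //.
  by apply: size_leD => //; rewrite size_polyN; apply: size_polyN_nat.
rewrite addnC; apply: (@size_leM _ _ _ b 2); first exact: size_polyN_nat.
exact: leq_trans (size_flip _) (size_taylor3 _).
Qed.

Lemma size_corner_tr b (J J' : jet R) (r : side b) :
  (size (tr r (corner_poly J r + corner_poly J' (r + 1)%R)%R) <= 6)%N.
Proof.
rewrite trD tr_corner tr_corner_next; apply: size_leD; first exact: size_corner3.
exact: leq_trans (size_flip _) (size_corner3 _).
Qed.

Lemma side_jet_diff b (J J' : jet R) g h g' h' :
    side_jet b J J' g h -> side_jet b J J' g' h' ->
  jet3 (g - g') (0, 0, 0) (0, 0, 0) /\ jet2 (h - h') (0, 0) (0, 0).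
Proof.
move=> [[[a1 a2 a3] [a4 a5 a6]] [[a7 a8] [a9 a10]]].
move=> [[[b1 b2 b3] [b4 b5 b6]] [[b7 b8] [b9 b10]]].
split; split; split; rewrite ?derivB hornerD hornerN.
all: by apply/eqP; rewrite subr_eq0; apply/eqP; etransitivity; eauto.
Qed.

(** Boundary data that fit together at the corners are attained: the corner
    polynomials produce the jets at the corners; what then remains on each
    side is divisible by the bubble factors and is produced by a side
    polynomial. *)
Lemma boundary_interp b p (J : side b -> jet R) (g h : side b -> {poly R}) :
    (5 <= p)%N -> (forall r, size (g r) <= p.+1)%N ->
    (forall r, size (h r) <= p + b)%N ->
    (forall r, side_jet b (J r) (J (r + 1)) (g r) (h r)) ->
  exists P, deg_lt b p.+1 P /\ forall r, tr r P = g r /\ td r P = h r.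
Proof.
move=> hp szg szh jets.
pose C r := corner_poly (J r) r.
(* What the two corner polynomials of a side leave over of its data. *)
have res r : exists gh : {poly R} * {poly R},
    [/\ (size gh.1 <= p - 5)%N, (size gh.2 <= p - 4 + b)%N,
        tr r (C r + C (r + 1) + side_poly r gh.1 gh.2) = g r
      & td r (C r + C (r + 1) + side_poly r gh.1 gh.2) = h r].
  have [[[a1 a2 a3] [a4 a5 a6]] [[b1 b2] [b3 b4]]] :=
    side_jet_diff (jets r) (side_jet_corner (J r) (J (r + 1)) r).
  have [g' gE] := bubble3_dvd a1 a2 a3 a4 a5 a6.
  have [h' hE] := bubble2_dvd b1 b2 b3 b4.
  have szg' : (size g' <= p - 5)%N.
    apply: (@size_bubbleM _ 3); rewrite -gE; apply: size_leD.
      by apply: leq_trans (szg r) _; lia.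
    by rewrite size_polyN (leq_trans (size_corner_tr _ _ _)) //; lia.
  have szh' : (size h' <= p - 4 + b)%N.
    apply: (@size_bubbleM _ 2); rewrite -hE; apply: size_leD.
      by apply: leq_trans (szh r) _; lia.
    by rewrite size_polyN (leq_trans (size_corner_td _ _ _)) //; lia.
  exists (g', h' + (2 * b)%:R * bubble R * g' + (3 * ~~ b)%:R * 'X * g').
  split => //=.
  - apply: size_leD; first apply: size_leD => //.
      case: (b); last by rewrite muln0 mul0r mul0r size_poly0.
      rewrite -mulrA size_polyN_nat // (leq_trans (size_polyMleq _ _)) //.
      move: (size_bubble R 1) szg'; rewrite expr1 /=.
      by move: (size (bubble R)) (size g') => x y; clear -hp; lia.
    rewrite -mulrA size_polyN_nat // (leq_trans (size_polyMleq _ _)) //.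
    by rewrite size_polyX; move: szg'; clear -hp; move: (size g') => y; lia.
  - by rewrite trD tr_side -gE subrKC.
  - rewrite tdD td_side.
    rewrite -[RHS](subrKC (td r (C r + C (r + 1)))) hE; congr (_ + _ * _).
    by ring.
have [gh ghE] := fin_all_exists res.
exists (\sum_r C r + \sum_r side_poly r (gh r).1 (gh r).2); split.
  move=> w wb; apply: belowD; apply: below_sum => r _.
    by apply: below_leq (deg_lt_corner _ _ wb); lia.
  by have [? ? _ _] := ghE r; apply: (deg_lt_side r).
move=> r; have [_ _ <- <-] := ghE r.
have r1r : r + 1 != r by rewrite addrC -subr_eq0 addrK oner_eq0.
have C0 r' : (r' != r) && (r' != r + 1) -> tr r (C r') = 0 /\ td r (C r') = 0.
  by move=> /andP[? ?]; exact: corner_poly_other.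
have S0 r' : r' != r -> tr r (side_poly r' (gh r').1 (gh r').2) = 0 /\
    td r (side_poly r' (gh r').1 (gh r').2) = 0 by exact: side_poly_other.
rewrite !trD !tdD !tr_sum !td_sum.
do 2![rewrite (bigD1 r) //= (bigD1 (r + 1)) //= big1 => [|r' /C0[]] //;
  rewrite (bigD1 r) //= big1 => [|r' /S0[]] //].
by rewrite !addr0 /side_poly !(trD, tdD).
Qed.

End LocalExistence.

(** * Interpolation on a reference element *)

Section LocalUniqueness.
Variable R : realType.
Local Notation bipoly := {poly {poly R}}.
Implicit Types (P Q : bipoly).

Lemma tr_lam_neq0 b (r r' : side b) : r' != r -> tr r (lam R r') != 0.
Proof.
have X0 : 'X != 0 :> {poly R} by rewrite polyX_eq0.
have X1 : 1 - 'X != 0 :> {poly R} by rewrite -size_poly_eq0 size_1subX.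
move: b r r'; apply: side_ind; move=> [[|[|[|[|//]]]] i] //= _;
  rewrite /tr /lam /spath /= ?(restrD, restrN, restr1, restr_U, restr_V)
    ?subKr ?subr0 ?oner_neq0 //.
all: by rewrite ?subKr ?subrr ?sub0r ?opprB ?addrK ?subrK ?oner_neq0.
Qed.

Lemma restr_flip A B P : restr A B P = 0 ->
  restr (A \Po (1 - 'X)) (B \Po (1 - 'X)) P = 0.
Proof. by move=> P0; rewrite -restr_comp P0 comp_poly0. Qed.

Lemma line_dvdV (a0 a1 : R) P : restr 'X (a0%:P + a1%:P * 'X) P = 0 ->
  exists2 Q, P = (varV R - (a0%:P + a1%:P * 'X)%:P) * Q &
    forall (w : nat * nat) n, (a1 != 0 -> (w.1 <= w.2)%N) -> below w n P -> below w (n - w.2) Q.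
Proof.
have -> A : restr 'X A P = P.[A].
  rewrite /restr; congr (_.[_]); rewrite -[RHS](@map_poly_id _ id) //.
  by apply: eq_map_poly => g; rewrite comp_polyXr.
move=> /divV[Q PQ]; exists Q => // w n a1w; rewrite {1}PQ.
exact: below_divV.
Qed.

Lemma line_dvdU (a : R) P : restr a%:P 'X P = 0 ->
  exists2 Q, P = (varU R - cst2 a) * Q &
    forall w n, below w n P -> below w (n - w.1) Q.
Proof.
by move=> /divU[Q PQ]; exists Q => // w n; rewrite {1}PQ; exact: below_divU.
Qed.

(** Division by a side function lowers the degrees by those of the side
    function.  Each side lies on a line of the form [V = a0 + a1 * U] or [U = a];
    those that are traversed backwards are reversed first. *)
Lemma lam_div b (r : side b) P : tr r P = 0 ->
  exists2 Q, P = lam R r * Q &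
    forall w n, w \in weights b -> below w n P -> below w (n - wlam r w) Q.
Proof.
have f1X : (1 - 'X) \Po (1 - 'X) = 'X :> {poly R}.
  by rewrite comp_polyB comp_polyX -polyC1 comp_polyC polyC1 subKr.
have a00 : 0%:P + 0%:P * 'X = 0 :> {poly R} by rewrite polyC0 mul0r addr0.
have a10 : 1%:P + 0%:P * 'X = 1 :> {poly R} by rewrite polyC0 mul0r addr0.
have a11 : 1%:P + (-1)%:P * 'X = 1 - 'X :> {poly R}.
  by rewrite polyCN !polyC1 mulN1r.
move: b r P; apply: side_ind => P; rewrite /tr /spath /lam /wlam /weights /=.
- move=> P0; have [] := @line_dvdV 0 0 P; first by rewrite a00.
  rewrite a00 polyC0 subr0 => Q PQ Qn; exists Q => // w n.
  rewrite !inE => /eqP ->; exact: Qn.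
- move=> /restr_flip; rewrite f1X comp_polyX -a11 => /line_dvdV[Q PQ Qn].
  exists (- Q); first by rewrite PQ a11 /varU polyCB polyC1; ring.
  by move=> w n; rewrite !inE => /eqP -> Pn; apply/belowN/Qn.
- move=> /restr_flip; rewrite f1X comp_poly0 -polyC0 => /line_dvdU[Q PQ Qn].
  exists Q; first by rewrite PQ cst20 subr0.
  by move=> w n _; exact: Qn.
- move=> P0; have [] := @line_dvdV 0 0 P; first by rewrite a00.
  rewrite a00 polyC0 subr0 => Q PQ Qn; exists Q => // w n _.
  by apply: Qn; rewrite eqxx.
- rewrite -polyC1 => /line_dvdU[Q PQ Qn].
  exists (- Q); first by rewrite PQ cst21; ring.
  by move=> w n _ Pn; apply/belowN/Qn.
- move=> /restr_flip; rewrite f1X -polyC1 comp_polyC polyC1 -a10.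
  move=> /line_dvdV[Q PQ Qn].
  exists (- Q); first by rewrite PQ a10 polyC1; ring.
  by move=> w n _ Pn; apply/belowN/Qn => //; rewrite eqxx.
- move=> /restr_flip; rewrite f1X comp_poly0 -polyC0 => /line_dvdU[Q PQ Qn].
  exists Q; first by rewrite PQ cst20 subr0.
  by move=> w n _; exact: Qn.
Qed.

Lemma lam_sqr_div b (r : side b) P : tr r P = 0 -> td r P = 0 ->
  exists2 Q, P = lam R r ^+ 2 * Q &
    forall w n, w \in weights b ->
      below w n P -> below w (n - 2 * wlam r w) Q.
Proof.
move=> /lam_div[Q PQ Qn]; rewrite {1}PQ tdM tr_lam mul0r addr0 /td dd_lam tr1 mul1r.
move=> /lam_div[Q' QQ' Qn']; exists Q'; first by rewrite {1}PQ QQ'; ring.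
move=> w n wb Pn; rewrite mul2n -addnn subnDA; apply: (Qn' _ _ wb).
exact: (Qn _ _ wb Pn).
Qed.

(** The interior bubble of the element. *)
Definition lams b : bipoly := \prod_(r : side b) lam R r.

(** The degree of the squared interior bubble. *)
Definition inner_drop (b : bool) : nat := if b then 4 else 6.

Lemma sum_wlam b w :
  w \in weights b -> (2 * \sum_(r : side b) wlam r w)%N = inner_drop b.
Proof.
rewrite /inner_drop /weights; case: b; rewrite !big_ord_recl big_ord0 !inE /=.
  by move=> /orP[] /eqP ->.
by move=> /eqP ->.
Qed.

Lemma lams_sqr b (r : side b) :
  lams b ^+ 2 = lam R r ^+ 2 * (\prod_(r' | r' != r) lam R r') ^+ 2.
Proof. by rewrite /lams (bigD1 r) //= exprMn. Qed.

(** A polynomial with zero boundary data is a multiple of the squared bubble: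
    the squares of the side functions split off one after the other, since
    none of them vanishes identically on another side. *)
Lemma boundary0_div b p P : deg_lt b p.+1 P ->
    (forall r : side b, tr r P = 0) -> (forall r : side b, td r P = 0) ->
  exists2 Q, P = lams b ^+ 2 * Q & deg_lt b (p.+1 - inner_drop b) Q.
Proof.
move=> degP trP tdP.
have [s [sE us]] : exists s : seq (side b), s = index_enum _ /\ uniq s.
  by exists (index_enum _); split; rewrite ?index_enum_uniq.
suff [Q [PQ Qn _]] : exists Q, [/\ P = (\prod_(r <- s) lam R r) ^+ 2 * Q,
    forall w, w \in weights b ->
      below w (p.+1 - 2 * \sum_(r <- s) wlam r w) Q
  & forall r, r \notin s -> tr r Q = 0 /\ td r Q = 0].
  exists Q; first by rewrite PQ sE.
  by move=> w wb; have := Qn w wb; rewrite sE sum_wlam.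
elim: s us {sE} => [_|r s IHs /= /andP[rs us]].
  exists P; split; rewrite ?big_nil ?expr1n ?mul1r // => w wb.
  by rewrite big_nil muln0 subn0; exact: degP.
have [Q [PQ Qn Q0]] := IHs us.
have [Q' QQ' Qn'] := lam_sqr_div (Q0 r rs).1 (Q0 r rs).2.
exists Q'; split.
- by rewrite big_cons exprMn PQ QQ'; ring.
- move=> w wb; rewrite big_cons mulnDr addnC subnDA.
  by apply: (Qn' _ _ wb); exact: Qn.
- move=> r'; rewrite inE negb_or => /andP[r'r r's].
  have lam0 : tr r' (lam R r) ^+ 2 != 0.
    by rewrite expf_neq0 // tr_lam_neq0 // eq_sym.
  have [trQ tdQ] := Q0 r' r's; move: trQ tdQ; rewrite QQ' trM trX tdM trX.
  move=> /eqP; rewrite mulf_eq0 (negbTE lam0) /= => /eqP ->.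
  by rewrite mulr0 add0r => /eqP; rewrite mulf_eq0 (negbTE lam0) /= => /eqP ->.
Qed.

(** ** Polynomial functions *)

Definition poly_space (b : bool) (p : nat) : set (plane R -> R) :=
  if b then @polys_bidegree R p else @polys_total R p.

Definition inner_space (b : bool) (p : nat) : set (plane R -> R) :=
  if b then @inner_quad R p else @inner_tri R p.

Lemma ev_expand n P q :
    (forall i j, (n <= i)%N || (n <= j)%N -> P`_j`_i = 0) ->
  ev q P = \sum_(ij : 'I_n * 'I_n) P`_ij.2`_ij.1 * (q.1 ^+ ij.1 * q.2 ^+ ij.2).
Proof.
move=> Pn.
have szP : (size P <= n)%N.
  apply/leq_sizeP => j nj; apply/polyP => i.
  by rewrite coef0 Pn // nj orbT.
have szPj j : (size (P`_j)%R <= n)%N.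
  by apply/leq_sizeP => i ni; rewrite Pn // ni.
rewrite /ev (horner_coef_wide _ szP) horner_sum.
transitivity (\sum_(i < n) \sum_(j < n) P`_j`_i * (q.1 ^+ i * q.2 ^+ j)).
  rewrite exchange_big; apply: eq_bigr => j _.
  rewrite hornerM horner_exp hornerC (horner_coef_wide _ (szPj j)) mulr_suml.
  by apply: eq_bigr => i _; ring.
by rewrite pair_big.
Qed.

Definition mono2 (i j : nat) : bipoly := varU R ^+ i * varV R ^+ j.

Lemma ev_mono2 q i j : ev q (mono2 i j) = q.1 ^+ i * q.2 ^+ j.
Proof. by rewrite rmorphM !rmorphXn /= ev_U ev_V. Qed.

Lemma coef_mono2 i j k l :
  (mono2 i j)`_l`_k = ((k == i) && (l == j))%:R.
Proof.
rewrite /mono2 /varU /varV -polyC_exp coefCM coefXn.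
case: (l == j); last by rewrite mulr0 coef0 andbF.
by rewrite mulr1 coefXn andbT.
Qed.

Lemma below_mono2 w i j : below w (w.1 * i + w.2 * j).+1 (mono2 i j).
Proof.
move=> k l kl; rewrite coef_mono2; case: eqP => // ki; case: eqP => // lj.
by rewrite ki lj ltnn in kl.
Qed.

Lemma ev_sum q (I : finType) (r : pred I) (F : I -> bipoly) :
  ev q (\sum_(i | r i) F i) = \sum_(i | r i) ev q (F i).
Proof. exact: rmorph_sum. Qed.

Lemma ev_cstM q c P : ev q (cst2 c * P) = c * ev q P.
Proof. by rewrite rmorphM /= ev_cst. Qed.

Lemma below_cstM w n c P : below w n P -> below w n (cst2 c * P).
Proof.
by move=> Pn i j nij; rewrite /cst2 coefCM coefCM Pn // mulr0.
Qed.

Lemma poly_spaceP b p (f : plane R -> R) : poly_space b p f <->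
  exists2 P, deg_lt b p.+1 P & forall q, f q = ev q P.
Proof.
rewrite /poly_space; split.
- case: b => -[c fE].
    exists (\sum_(ij in predT) cst2 (c ij) * mono2 ij.1 ij.2).
      move=> w; rewrite !inE => wb; apply: below_sum => ij _; apply: below_cstM.
      apply: below_leq (@below_mono2 w _ _).
      have := ltn_ord ij.1; have := ltn_ord ij.2.
      by case/orP: wb => /eqP -> /=; rewrite !(mul0n, mul1n) ?addn0.
    by move=> q; rewrite fE ev_sum; apply: eq_bigr => ij _; rewrite ev_cstM ev_mono2.
  exists (\sum_(ij in [pred ij : 'I_p.+1 * 'I_p.+1 | (ij.1 + ij.2 <= p)%N])
            cst2 (c ij) * mono2 ij.1 ij.2).
    move=> w; rewrite !inE => /eqP ->; apply: below_sum => ij; rewrite inE => ijp.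
    apply: below_cstM; apply: below_leq (@below_mono2 _ _ _).
    by rewrite /= !mul1n.
  by move=> q; rewrite fE ev_sum; apply: eq_bigr => ij _; rewrite ev_cstM ev_mono2.
- move=> [P degP fE].
  have Pn i j : (p.+1 <= i)%N || (p.+1 <= j)%N -> P`_j`_i = 0.
    case: b degP => degP.
      case/orP => pij; [apply: (degP (1, 0)%N)|apply: (degP (0, 1)%N)];
        by rewrite ?inE ?eqxx ?orbT //= ?mul1n ?mul0n ?addn0 ?add0n.
    move=> pij; apply: (degP (1, 1)%N); rewrite ?inE //= !mul1n.
    by case/orP: pij => /leq_trans; apply; rewrite ?leq_addr ?leq_addl.
  case: b degP => degP;
    exists (fun ij : 'I_p.+1 * 'I_p.+1 => P`_ij.2`_ij.1) => q.
    by rewrite fE (ev_expand q Pn).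
  rewrite fE (ev_expand q Pn) [LHS](bigID (fun ij : 'I_p.+1 * 'I_p.+1 => (ij.1 + ij.2 <= p)%N)) /=.
  rewrite [X in _ + X]big1 ?addr0 // => ij; rewrite -ltnNge => ijp.
  by rewrite (degP (1, 1)%N) ?mul0r ?inE //= !mul1n.
Qed.

Lemma lin_span_basis (I : finType) (A : {pred I}) (B : I -> plane R -> R) i c :
  i \in A -> lin_span A B (fun q => c * B i q).
Proof.
move=> Ai; exists (fun j => if j == i then c else 0) => q.
rewrite (bigD1 i) //= eqxx big1 ?addr0 // => j /andP[_ /negbTE ->].
by rewrite mul0r.
Qed.

Lemma lin_spanD (I : finType) (A : {pred I}) (B : I -> plane R -> R) f g :
  lin_span A B f -> lin_span A B g -> lin_span A B (fun q => f q + g q).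
Proof.
move=> [c fE] [d gE]; exists (fun i => c i + d i) => q.
by rewrite fE gE -big_split; apply: eq_bigr => i _; rewrite mulrDl.
Qed.

Lemma lin_span_ext (I : finType) (A : {pred I}) (B : I -> plane R -> R) f g :
  f =1 g -> lin_span A B f -> lin_span A B g.
Proof. by move=> fg [c fE]; exists c => q; rewrite -fg. Qed.

Lemma lin_span0 (I : finType) (A : {pred I}) (B : I -> plane R -> R) :
  lin_span A B (fun=> 0).
Proof. by exists (fun=> 0) => q; rewrite big1 // => i _; rewrite mul0r. Qed.

Lemma lin_spanZ (I : finType) (A : {pred I}) (B : I -> plane R -> R) c f :
  lin_span A B f -> lin_span A B (fun q => c * f q).
Proof.
move=> [d fE]; exists (fun i => c * d i) => q.
by rewrite fE mulr_sumr; apply: eq_bigr => i _; rewrite mulrA.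
Qed.

(** The Bernstein polynomials span because the barycentric coordinates sum to
    1: multiplying by this sum raises a monomial in them to the full degree.
    On the square the same is done in each variable. *)
Lemma inner_tri_mono p d i j k :
    (2 <= i)%N -> (2 <= j)%N -> (2 <= k)%N -> (i + j + k + d)%N = p ->
  @inner_tri R p (fun q => q.1 ^+ i * q.2 ^+ j * (1 - q.1 - q.2) ^+ k).
Proof.
elim: d i j k => [|d IHd] i j k i2 j2 k2 ijk.
  have [ip jp kp] : [/\ i < p.+1, j < p.+1 & k < p.+1]%N by split; lia.
  pose ijk' : 'I_p.+1 * 'I_p.+1 * 'I_p.+1 := (inord i, inord j, inord k).
  set a : R := p`!%:R / (i`!%:R * j`!%:R * k`!%:R).
  have a0 : a != 0.
    by rewrite !mulf_neq0 ?invr_neq0 ?mulf_neq0 // pnatr_eq0 -lt0n fact_gt0.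
  apply: (lin_span_ext _ (@lin_span_basis _ _ _ ijk' a^-1 _)); last first.
    by rewrite inE /= !inordK // i2 j2 k2 /=; lia.
  move=> q; rewrite /bernstein_tri /ijk' !inordK // -/a.
  by move: (a) a0 => c c0; rewrite -!mulrA mulKf // !mulrA.
apply: lin_span_ext (lin_spanD (lin_spanD (IHd i.+1 j k _ _ _ _)
  (IHd i j.+1 k _ _ _ _)) (IHd i j k.+1 _ _ _ _)); try lia.
by move=> q; rewrite !exprS; ring.
Qed.

Lemma inner_quad_mono p d d' i j k l :
    (2 <= i)%N -> (2 <= j)%N -> (2 <= k)%N -> (2 <= l)%N ->
    (i + k + d)%N = p -> (j + l + d')%N = p ->
  @inner_quad R p (fun q =>
    (q.1 ^+ i * (1 - q.1) ^+ k) * (q.2 ^+ j * (1 - q.2) ^+ l)).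
Proof.
elim: d i k => [|d IHd] i k i2 j2 k2 l2 ik jl; last first.
  apply: lin_span_ext (lin_spanD (IHd i.+1 k _ _ _ _ _ _)
    (IHd i k.+1 _ _ _ _ _ _)); try lia.
  by move=> q; rewrite !exprS; ring.
elim: d' j l j2 l2 jl => [|d' IHd'] j l j2 l2 jl; last first.
  apply: lin_span_ext (lin_spanD (IHd' j.+1 l _ _ _)
    (IHd' j l.+1 _ _ _)); try lia.
  by move=> q; rewrite !exprS; ring.
have [ip jp] : (i < p.+1 /\ j < p.+1)%N by lia.
pose ij : 'I_p.+1 * 'I_p.+1 := (inord i, inord j).
set a : R := 'C(p, i)%:R; set c : R := 'C(p, j)%:R.
have ac0 : a * c != 0.
  by rewrite mulf_neq0 // pnatr_eq0 -lt0n bin_gt0.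
apply: (lin_span_ext _ (@lin_span_basis _ _ _ ij (a * c)^-1 _)); last first.
  by rewrite inE /= !inordK // i2 j2 /=; lia.
move=> q; rewrite /bernstein_quad /bernstein /= !inordK // -/a -/c.
have -> : (p - i = k)%N by lia.
have -> : (p - j = l)%N by lia.
move: ac0; rewrite mulf_eq0 negb_or => /andP[a0 c0].
by field; rewrite ?a0 ?c0.
Qed.

Lemma ev_lams b q : ev q (lams b) =
  if b then q.1 * (1 - q.1) * (q.2 * (1 - q.2)) else q.1 * q.2 * (1 - q.1 - q.2).
Proof.
rewrite /lams rmorph_prod; case: b; rewrite !big_ord_recl big_ord0 /lam /=;
  by rewrite !(ev_U, ev_V, ev1, evD, evN); ring.
Qed.

Lemma inner_ext b p f g : f =1 g -> inner_space b p f -> inner_space b p g.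
Proof. by rewrite /inner_space; case: b; exact: lin_span_ext. Qed.

Lemma inner_sum b p (I : finType) (F : I -> plane R -> R) :
  (forall i, inner_space b p (F i)) ->
  inner_space b p (fun q => \sum_i F i q).
Proof.
move=> FS; elim: (index_enum I) => [|i s IHs].
  apply: (@inner_ext b p (fun=> 0)) => [q|]; first by rewrite big_nil.
  by rewrite /inner_space; case: (b); exact: lin_span0.
apply: (@inner_ext b p (fun q => F i q + \sum_(j <- s) F j q)).
  by move=> q; rewrite big_cons.
by move: (FS i) IHs; rewrite /inner_space; case: (b); exact: lin_spanD.
Qed.

(** The squared bubble raises all exponents of a Bernstein monomial by two;
    therefore its multiples are the combinations of the inner Bernstein
    polynomials. *)
Lemma inner_spaceP b p Q : (5 <= p)%N -> deg_lt b (p.+1 - inner_drop b) Q ->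
  inner_space b p (fun q => ev q (lams b ^+ 2 * Q)).
Proof.
move=> hp degQ.
have Qn i j : (p <= i)%N || (p <= j)%N -> Q`_j`_i = 0.
  case: b degQ => degQ.
    case/orP => pij; [apply: (degQ (1, 0)%N)|apply: (degQ (0, 1)%N)];
      by rewrite ?inE ?eqxx ?orbT //= ?mul1n ?mul0n ?addn0 ?add0n; lia.
  move=> pij; apply: (degQ (1, 1)%N); rewrite ?inE //= !mul1n.
  by case/orP: pij => pij; lia.
apply: (@inner_ext b p (fun q => \sum_(ij : 'I_p * 'I_p)
    Q`_ij.2`_ij.1 * (ev q (lams b) ^+ 2 * (q.1 ^+ ij.1 * q.2 ^+ ij.2)))).
  move=> q; rewrite rmorphM rmorphXn /= (ev_expand q Qn) mulr_sumr.
  by apply: eq_bigr => ij _; ring.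
apply: inner_sum => -[i j].
have [Q0|Qij] := eqVneq Q`_j`_i 0.
  apply: (@inner_ext b p (fun=> 0)) => [q|]; first by rewrite Q0 mul0r.
  by rewrite /inner_space; case: (b); exact: lin_span0.
rewrite /inner_space; case: b degQ {Qn} => degQ; apply: lin_spanZ => /=.
  have [ip jp] : (i < p - 3 /\ j < p - 3)%N.
    split; rewrite ltnNge; apply/negP => le3; case/eqP: Qij.
      by apply: (degQ (1, 0)%N); rewrite ?inE ?eqxx //= mul1n mul0n addn0; lia.
    by apply: (degQ (0, 1)%N); rewrite ?inE ?eqxx ?orbT //= mul1n mul0n; lia.
  apply: lin_span_ext (@inner_quad_mono p (p - 4 - i) (p - 4 - j) i.+2 j.+2 2 2
    _ _ _ _ _ _); try lia.
  by move=> q; rewrite ev_lams !exprS; ring.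
have ijp : (i + j < p - 5)%N.
  rewrite ltnNge; apply/negP => le5; case/eqP: Qij.
  by apply: (degQ (1, 1)%N); rewrite ?inE ?eqxx //= !mul1n; lia.
apply: lin_span_ext (@inner_tri_mono p (p - 6 - (i + j)) i.+2 j.+2 2
  _ _ _ _); try lia.
by move=> q; rewrite ev_lams !exprS; ring.
Qed.

(** ** Interior interpolation points *)

Definition pt_idx (b : bool) (p : nat) : finType :=
  if b then quad_pt_idx p else tri_pt_idx p.

(** The index types of the points also index the monomials of the cofactor of
    the squared bubble, so the interior interpolation problem is square. *)
Definition expo b p : pt_idx b p -> nat * nat :=
  match b return pt_idx b p -> nat * nat with
  | true => fun k => (nat_of_ord k.1, nat_of_ord k.2)
  | false => fun k => (nat_of_ord (tag k), nat_of_ord (tagged k))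
  end.

Lemma expo_inj b p : injective (@expo b p).
Proof.
case: b => [[k1 k2] [l1 l2]|[k1 k2] [l1 l2]] /= [].
  by move=> /val_inj -> /val_inj ->.
move=> kl; have {}kl : k1 = l1 by apply: val_inj.
by case: _ / kl l2 => l2 /val_inj ->.
Qed.

Lemma deg_lt_expo b p (k : pt_idx b p) : (5 <= p)%N ->
  deg_lt b (p.+1 - inner_drop b) (mono2 (expo k).1 (expo k).2).
Proof.
move=> hp w wb; apply: below_leq (@below_mono2 w _ _); move: wb.
rewrite /weights; case: b k => -[k l]; rewrite !inE /=.
  have := ltn_ord k; have := ltn_ord l.
  by move=> ? ? /orP[] /eqP -> /=; rewrite mul1n mul0n; lia.
have := ltn_ord k; have := ltn_ord l.
by move=> ? ? /eqP -> /=; rewrite !mul1n; lia.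
Qed.

Lemma lams_neq0 b : lams b != 0.
Proof.
apply/eqP => /(congr1 (ev (2%:R^-1, 3%:R^-1))).
rewrite ev_lams rmorph0; case: b => /=; lra.
Qed.

Lemma inner_zero b p (pts : pt_idx b p -> plane R) Q : (5 <= p)%N ->
    unisolvent pts (inner_space b p) -> deg_lt b (p.+1 - inner_drop b) Q ->
    (forall l, ev (pts l) (lams b ^+ 2 * Q) = 0) ->
  Q = 0.
Proof.
move=> hp uni degQ Q0.
have /eqP : lams b ^+ 2 * Q = 0.
  apply: ev_inj; apply: (uni _ (fun=> 0) (inner_spaceP hp degQ)) => //.
  by rewrite /inner_space; case: (b); exact: lin_span0.
by rewrite mulf_eq0 expf_eq0 (negbTE (lams_neq0 b)) /= => /eqP.
Qed.

(** Unisolvence is uniqueness for a system with as many unknown coefficients as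
    points. *)
Lemma inner_exists b p (pts : pt_idx b p -> plane R) (v : pt_idx b p -> R) :
    (5 <= p)%N -> unisolvent pts (inner_space b p) ->
  exists2 Q, deg_lt b (p.+1 - inner_drop b) Q &
    forall l, ev (pts l) (lams b ^+ 2 * Q) = v l.
Proof.
move=> hp uni.
pose m (k : pt_idx b p) := mono2 (expo k).1 (expo k).2.
pose comb (c : pt_idx b p -> R) := \sum_k cst2 (c k) * m k.
have degc c : deg_lt b (p.+1 - inner_drop b) (comb c).
  by move=> w wb; apply: below_sum => k _; apply/below_cstM/deg_lt_expo.
have evc c l : ev (pts l) (lams b ^+ 2 * comb c) =
    \sum_k c k * ev (pts l) (lams b ^+ 2 * m k).
  rewrite rmorphM /= ev_sum mulr_sumr; apply: eq_bigr => k _.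
  by rewrite ev_cstM rmorphM /=; ring.
have [] := @square_system R _ (fun k l => ev (pts l) (lams b ^+ 2 * m k)) _ v.
  move=> c c0 k.
  have /(congr1 (fun Q : bipoly => Q`_(expo k).2`_(expo k).1)) : comb c = 0.
    by apply: (inner_zero hp uni (degc c)) => l; rewrite evc c0.
  rewrite /comb !coef_sum coef0 coef0 (bigD1 k) //= big1 => [|l lk].
    by rewrite /cst2 !coefCM coef_mono2 !eqxx mulr1 addr0.
  rewrite /cst2 !coefCM coef_mono2; case: andP => [[/eqP e1 /eqP e2]|_].
    case/eqP: lk; apply: expo_inj.
    by rewrite [LHS]surjective_pairing [RHS]surjective_pairing e1 e2.
  by rewrite mulr0.
by move=> c cE; exists (comb c) => // l; rewrite evc cE.
Qed.

(** The boundary data are attained first; a multiple of the squared bubble then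
    corrects the inner values without changing them. *)
Lemma local_exists b p (J : side b -> jet R) (g h : side b -> {poly R})
    (pts : pt_idx b p -> plane R) (v : pt_idx b p -> R) :
    (5 <= p)%N -> unisolvent pts (inner_space b p) ->
    (forall r, size (g r) <= p.+1)%N -> (forall r, size (h r) <= p + b)%N ->
    (forall r, side_jet b (J r) (J (r + 1)) (g r) (h r)) ->
  exists P, [/\ deg_lt b p.+1 P, forall r, tr r P = g r /\ td r P = h r
    & forall l, ev (pts l) P = v l].
Proof.
move=> hp uni szg szh jets.
have [P [degP PE]] := boundary_interp hp szg szh jets.
have [Q degQ QE] := inner_exists (fun l => v l - ev (pts l) P) hp uni.
exists (P + lams b ^+ 2 * Q); split.
- move=> w wb; apply: belowD; first exact: degP.
  have ub : below w (inner_drop b).+1 (lams b ^+ 2).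
    rewrite -(sum_wlam wb); apply: belowX; rewrite /lams.
    elim/big_ind2: _ => [|n m P1 P2 ? ?|r _]; first exact: below1.
      exact: belowM.
    exact: below_lam.
  have [->|Q0] := eqVneq Q 0; first by rewrite mulr0; exact: below0.
  have lt_drop : (inner_drop b < p.+1)%N.
    rewrite ltnNge; apply/negP => le_p; case/eqP: Q0; apply/polyP => j.
    apply/polyP => i; rewrite !coef0; apply: (degQ w wb).
    by have -> : (p.+1 - inner_drop b = 0)%N by apply/eqP.
  have := belowM ub (_ : below w (p - inner_drop b).+1 Q).
  rewrite subnKC //; apply; rewrite -subSn //.
  exact: degQ.
- move=> r; have [trP tdP] := PE r.
  have E : lam R r ^+ 2 * ((\prod_(r' | r' != r) lam R r') ^+ 2 * Q) =
      lams b ^+ 2 * Q by rewrite (lams_sqr r) mulrA.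
  by rewrite trD tdD (tr_sqr0 E) (td_sqr0 E) !addr0.
- by move=> l; rewrite rmorphD /= QE subrKC.
Qed.

(** The difference has zero boundary data, so it is a multiple of the squared
    bubble that vanishes at the unisolvent points. *)
Lemma local_unique b p (pts : pt_idx b p -> plane R) P P' :
    (5 <= p)%N -> unisolvent pts (inner_space b p) ->
    deg_lt b p.+1 P -> deg_lt b p.+1 P' ->
    (forall r : side b, tr r P = tr r P' /\ td r P = td r P') ->
    (forall l, ev (pts l) P = ev (pts l) P') ->
  P = P'.
Proof.
move=> hp uni degP degP' bd ptsE; apply/eqP; rewrite -subr_eq0; apply/eqP.
have tdB (r : side b) : td r (P - P') = 0.
  by have [_ e] := bd r; rewrite tdD /td ddN trN -!/(td r _) e subrr.
have trB (r : side b) : tr r (P - P') = 0.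
  by have [e _] := bd r; rewrite trD trN e subrr.
have [|Q QE degQ] := boundary0_div _ trB tdB (p := p).
  by move=> w wb; apply: belowD; [exact: degP|apply/belowN/degP'].
rewrite QE (inner_zero hp uni degQ) ?mulr0 // => l.
by rewrite -QE evD evN ptsE subrr.
Qed.

End LocalUniqueness.

(** * Differentiability of functions transported by a bilinear map *)

Section Caratheodory.
Variable R : realType.
Implicit Types (f g : plane R -> R) (x q : plane R).

(** Caratheodory differentiability: the increment of [f] at [x] is a linear
    combination of the coordinate increments, with coefficients that are
    continuous at [x] and equal to [l1] and [l2] there. *)
Definition caratheodory f x (l1 l2 : R) : Prop :=
  exists L1 L2 : plane R -> R,
  [/\ L1 y @[y --> x] --> l1, L2 y @[y --> x] --> l2
    & \forall y \near x,
        f y - f x = L1 y * (y.1 - x.1) + L2 y * (y.2 - x.2)].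

Definition linear_form (l1 l2 : R) (v : plane R) : R := l1 * v.1 + l2 * v.2.

Lemma linear_form_is_linear l1 l2 : linear (linear_form l1 l2).
Proof.
move=> k u v; rewrite /linear_form /=.
rewrite -[k *: u.1]/(k * u.1) -[k *: u.2]/(k * u.2).
by rewrite -[k *: (_ + _)]/(k * (_ + _)); ring.
Qed.

HB.instance Definition _ l1 l2 :=
  GRing.isLinear.Build R (plane R) R _ (linear_form l1 l2)
    (linear_form_is_linear l1 l2).

Lemma cvg_coord1 x : y.1 @[y --> x] --> x.1.
Proof. exact: cvg_fst. Qed.
Lemma cvg_coord2 x : y.2 @[y --> x] --> x.2.
Proof. exact: cvg_snd. Qed.

Lemma norm_fst (v : plane R) : `|v.1| <= `|v|.
Proof. by rewrite [leRHS]prod_normE le_max lexx. Qed.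
Lemma norm_snd (v : plane R) : `|v.2| <= `|v|.
Proof. by rewrite [leRHS]prod_normE le_max lexx orbT. Qed.

Lemma caratheodory_diff f x l1 l2 : caratheodory f x l1 l2 ->
  differentiable f x /\ forall v, 'D_v f x = l1 * v.1 + l2 * v.2.
Proof.
move=> [L1 [L2 [L1c L2c fE]]].
have dfc : continuous (linear_form l1 l2).
  move=> y; apply: cvgD; apply: cvgM; try exact: cvg_cst.
    exact: cvg_coord1.
  exact: cvg_coord2.
have littleo (eps : R) : 0 < eps -> \forall h \near (0 : plane R),
    `|f (h + x) - (f x + linear_form l1 l2 h)| <= eps * `|h|.
  move=> /posnumP[e].
  have e2 : 0 < e%:num / 2 by [].
  move/cvgrPdist_le: L1c => /(_ _ e2) L1c.
  move/cvgrPdist_le: L2c => /(_ _ e2) L2c.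
  have : \forall y \near x,
      f y - f x = L1 y * (y.1 - x.1) + L2 y * (y.2 - x.2) /\
      (`|l1 - L1 y| <= e%:num / 2 /\ `|l2 - L2 y| <= e%:num / 2).
    by apply: filterI => //; apply: filterI.
  rewrite (near_shift 0) subr0; apply: filterS => h /= [fh [h1 h2]].
  rewrite opprD addrA fh /linear_form /=.
  have -> : L1 (h + x) * (h.1 + x.1 - x.1) + L2 (h + x) * (h.2 + x.2 - x.2)
      - (l1 * h.1 + l2 * h.2) =
      - ((l1 - L1 (h + x)) * h.1 + (l2 - L2 (h + x)) * h.2) by ring.
  rewrite normrN (le_trans (ler_normD _ _)) // !normrM [leRHS](_ : _ =
    e%:num / 2 * `|h| + e%:num / 2 * `|h|); last by field.
  by apply: lerD; apply: ler_pM => //; [exact: norm_fst|exact: norm_snd].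
have dE : 'd f x = linear_form l1 l2 :> (plane R -> R).
  by apply: diff_unique => //; apply/eqaddoP; exact: littleo.
have df : differentiable f x.
  by apply/diff_locallyP; rewrite dE; split => //; apply/eqaddoP; exact: littleo.
by split=> // v; rewrite deriveE // dE.
Qed.

Lemma caratheodory_continuous f x l1 l2 : caratheodory f x l1 l2 ->
  f y @[y --> x] --> f x.
Proof.
by move=> /caratheodory_diff[df _]; exact: differentiable_continuous.
Qed.

Lemma caratheodoryM f g x a1 a2 b1 b2 :
    caratheodory f x a1 a2 -> caratheodory g x b1 b2 ->
  caratheodory (fun y => f y * g y) x (a1 * g x + f x * b1) (a2 * g x + f x * b2).
Proof.
move=> fC; have := caratheodory_continuous fC; move: fC.
move=> [F1 [F2 [F1c F2c fE]]] fc [G1 [G2 [G1c G2c gE]]].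
exists (fun y => F1 y * g x + f y * G1 y), (fun y => F2 y * g x + f y * G2 y).
split.
- apply: cvgD; apply: cvgM => //; exact: cvg_cst.
- apply: cvgD; apply: cvgM => //; exact: cvg_cst.
near=> y.
rewrite -[f y](subrK (f x)) -[g y](subrK (g x)).
rewrite (near fE y) // (near gE y) //; ring.
Unshelve. all: by end_near. Qed.

Lemma caratheodoryD f g x a1 a2 b1 b2 :
    caratheodory f x a1 a2 -> caratheodory g x b1 b2 ->
  caratheodory (fun y => f y + g y) x (a1 + b1) (a2 + b2).
Proof.
move=> [F1 [F2 [F1c F2c fE]]] [G1 [G2 [G1c G2c gE]]].
exists (fun y => F1 y + G1 y), (fun y => F2 y + G2 y).
split; [exact: cvgD|exact: cvgD|near=> y].
rewrite opprD addrACA (near fE y) // (near gE y) //; ring.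
Unshelve. all: by end_near. Qed.

Lemma caratheodory_div f g x a1 a2 b1 b2 : g x != 0 ->
    caratheodory f x a1 a2 -> caratheodory g x b1 b2 ->
  caratheodory (fun y => f y / g y) x
    ((a1 * g x - f x * b1) / g x ^+ 2) ((a2 * g x - f x * b2) / g x ^+ 2).
Proof.
move=> gx0 [F1 [F2 [F1c F2c fE]]] gC; have := caratheodory_continuous gC.
move: gC => [G1 [G2 [G1c G2c gE]]] gc.
have gy0 : \forall y \near x, g y != 0.
  by apply: (cvgr_neq0 _ gc).
exists (fun y => (F1 y * g x - f x * G1 y) / (g x * g y)),
  (fun y => (F2 y * g x - f x * G2 y) / (g x * g y)).
have lim F' G' (l m : R) : F' y @[y --> x] --> l -> G' y @[y --> x] --> m ->
    (F' y * g x - f x * G' y) / (g x * g y) @[y --> x] -->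
    (l * g x - f x * m) / g x ^+ 2.
  move=> lF mG; apply: cvgM.
    by apply: cvgB; apply: cvgM => //; exact: cvg_cst.
  apply: cvgV; first by rewrite expf_neq0.
  by rewrite expr2; apply: cvgM => //; exact: cvg_cst.
split; [exact: lim|exact: lim|near=> y].
have g0 : g y != 0 by near: y.
have fy : f y = f x + (F1 y * (y.1 - x.1) + F2 y * (y.2 - x.2)).
  by rewrite -(near fE y) // subrKC.
have gyE : g y = g x + (G1 y * (y.1 - x.1) + G2 y * (y.2 - x.2)).
  by rewrite -(near gE y) // subrKC.
have -> : f y / g y - f x / g x = ((f y - f x) * g x - f x * (g y - g x)) / (g x * g y).
  by field; rewrite g0 gx0.
rewrite (near fE y) // (near gE y) //; field; rewrite gx0 g0 //.
Unshelve. all: by end_near. Qed.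

Lemma continuous_ev (P : {poly {poly R}}) x : ev y P @[y --> x] --> ev x P.
Proof.
elim/bipoly_ind: P => [g|P Q IHP IHQ|P IHP].
- under eq_fun do rewrite /ev hornerC.
  rewrite /ev hornerC; apply: continuous_comp; first exact: cvg_coord1.
  exact: continuous_horner.
- by under eq_fun do rewrite evD; rewrite evD; exact: cvgD.
- under eq_fun do rewrite evM ev_V; rewrite evM ev_V.
  by apply: cvgM => //; exact: cvg_coord2.
Qed.

Definition e1 : plane R := (1, 0).
Definition e2 : plane R := (0, 1).

(** In one variable the difference quotient is a polynomial by the factor
    theorem; the general case follows by sums and products. *)
Lemma caratheodory_ev (P : {poly {poly R}}) x :
  caratheodory (fun y => ev y P) x (ev x (dd e1 P)) (ev x (dd e2 P)).
Proof.
elim/bipoly_ind: P => [g|P Q IHP IHQ|P IHP].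
- have /factor_theorem[h gh] : root (g - (g.[x.1])%:P) x.1.
    by apply/rootP; rewrite hornerD hornerN hornerC subrr.
  have gE : g = h * ('X - (x.1)%:P) + (g.[x.1])%:P by rewrite -gh subrK.
  exists (fun y => h.[y.1]), (fun=> 0); split.
  + have -> : ev x (dd e1 g%:P) = h.[x.1].
      rewrite ddE dU_poly /dV derivC cst21 cst20 mul1r mul0r addr0 /ev hornerC gE.
      rewrite derivD derivM derivXsubC derivC addr0 mulr1 hornerD hornerM.
      by rewrite hornerXsubC subrr mulr0 add0r.
    apply: (continuous_comp (f := fun y : plane R => y.1) (g := horner h)).
      exact: cvg_coord1.
    exact: continuous_horner.
  + rewrite ddE dU_poly /dV derivC cst20 mul0r mulr0 addr0.
    by rewrite /ev !horner0; exact: cvg_cst.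
  + apply: filterE => y; rewrite /ev !hornerC {1}gE hornerD hornerM hornerXsubC.
    by rewrite hornerC; ring.
- have := caratheodoryD IHP IHQ; rewrite !ddD !evD.
  by under eq_fun do rewrite -evD.
- have IHV : caratheodory (fun y => ev y (varV R)) x 0 1.
    exists (fun=> 0), (fun=> 1); split; try exact: cvg_cst.
    by apply: filterE => y; rewrite !ev_V; ring.
  have ddE e : ev x (dd e (P * varV R)) =
      ev x (dd e P) * ev x (varV R) + ev x P * e.2.
    by rewrite ddM evD (evM _ (dd e P)) evM dd_V ev_cst.
  by have := caratheodoryM IHP IHV; rewrite !ddE; under eq_fun do rewrite -evM.
Qed.

Lemma dU_dV (P : {poly {poly R}}) : dU (dV P) = dV (dU P).
Proof.
apply/polyP => j; rewrite /dV coef_deriv !coef_map_id0 ?deriv0 //.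
by rewrite coef_deriv raddfMn.
Qed.

Lemma dd_e1 (P : {poly {poly R}}) : dd e1 P = dU P.
Proof. by rewrite ddE cst20 cst21 mul0r mul1r addr0. Qed.
Lemma dd_e2 (P : {poly {poly R}}) : dd e2 P = dV P.
Proof. by rewrite ddE cst20 cst21 mul0r mul1r add0r. Qed.
Lemma dd_comm (P : {poly {poly R}}) : dd e1 (dd e2 P) = dd e2 (dd e1 P).
Proof. by rewrite !dd_e1 !dd_e2 dU_dV. Qed.
Lemma dd_coord v (P : {poly {poly R}}) :
  dd v P = cst2 v.1 * dd e1 P + cst2 v.2 * dd e2 P.
Proof. by rewrite ddE dd_e1 dd_e2. Qed.

End Caratheodory.

(** Locked, so that evaluation and differentiation meet these polynomials only
    through the rules stated for them. *)
HB.lock Definition affine_poly (R : realType) (s t : R) (X : {poly {poly R}}) :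
    {poly {poly R}} :=
  cst2 s + cst2 t * X.
HB.lock Definition det_poly (R : realType) (A B C D : {poly {poly R}}) :
    {poly {poly R}} :=
  A * B - C * D.

Section BilinearMap.
Variable R : realType.
Implicit Types (a b c d q v x y : plane R).

Definition det2 (v w : plane R) : R := v.1 * w.2 - v.2 * w.1.

(** The common form of the element parametrizations; [d = 0] for triangles. *)
Definition bilin a b c d q : plane R :=
  a + q.1 *: b + q.2 *: c + (q.1 * q.2) *: d.

(** A [jet] also records the value and the derivatives up to order two at a
    point of the plane. *)
Definition jlin (S : jet R) v : R := v.1 * jx S + v.2 * jy S.
Definition jquad (S : jet R) v w : R :=
  jxx S * (v.1 * w.1) + jxy S * (v.1 * w.2 + v.2 * w.1) + jyy S * (v.2 * w.2).

(** The one-sided jet at [x] of the restriction of [f] to [A]. *)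
Record limit_jet (A : set (plane R)) (f : plane R -> R) x (S : jet R) : Prop :=
  LimitJet {
  lim_j0 : f y @[y --> within A (nbhs x)] --> j0 S;
  lim_jlin : forall v, 'D_v f y @[y --> within A (nbhs x)] --> jlin S v;
  lim_jxx : Dxy 2 0 f y @[y --> within A (nbhs x)] --> jxx S;
  lim_jxy : Dxy 1 1 f y @[y --> within A (nbhs x)] --> jxy S;
  lim_jyy : Dxy 0 2 f y @[y --> within A (nbhs x)] --> jyy S
}.

Definition bilin_u b d q : plane R := b + q.2 *: d.
Definition bilin_v c d q : plane R := c + q.1 *: d.
Definition jac b c d q : R := det2 (bilin_u b d q) (bilin_v c d q).

Definition midpoint q q' : plane R := 2^-1 *: (q + q').

Lemma planeD1 x y : (x + y).1 = x.1 + y.1. Proof. by []. Qed.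
Lemma planeD2 x y : (x + y).2 = x.2 + y.2. Proof. by []. Qed.
Lemma planeN1 x : (- x).1 = - x.1. Proof. by []. Qed.
Lemma planeN2 x : (- x).2 = - x.2. Proof. by []. Qed.
Lemma planeZ1 (k : R) x : (k *: x).1 = k * x.1. Proof. by []. Qed.
Lemma planeZ2 (k : R) x : (k *: x).2 = k * x.2. Proof. by []. Qed.
Definition planeE := (planeD1, planeD2, planeN1, planeN2, planeZ1, planeZ2).

(** The increment of a bilinear map is exactly its derivative at the midpoint
    applied to the increment of the argument; Cramer's rule then recovers the
    latter. *)
Lemma secant a b c d q q' (m := midpoint q q')
    (w := bilin a b c d q' - bilin a b c d q) :
  (q'.1 - q.1) * jac b c d m = det2 w (bilin_v c d m) /\
  (q'.2 - q.2) * jac b c d m = det2 (bilin_u b d m) w.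
Proof.
rewrite /w /m /jac /det2 /bilin /bilin_u /bilin_v /midpoint !planeE /=.
by split; field.
Qed.

Lemma cramer_rule u v x : det2 u v != 0 ->
  (det2 x v / det2 u v) *: u + (det2 u x / det2 u v) *: v = x.
Proof.
rewrite /det2 => uv0; rewrite [LHS]surjective_pairing [RHS]surjective_pairing.
by rewrite !planeE; congr pair; field.
Qed.

Lemma norm_det2 v w : `|det2 v w| <= 2 * `|v| * `|w|.
Proof.
rewrite /det2 (le_trans (ler_normB _ _)) // !normrM mulr_natl mulr2n mulrDl.
by rewrite lerD ?ler_pM ?norm_fst ?norm_snd.
Qed.

(** What is needed of a parametrization: [K] is the closed and [Ko] the open
    reference element. *)
Record regular_map (K Ko : set (plane R)) a b c d : Prop := RegularMap {
  reg_sub : Ko `<=` K;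
  reg_mid : forall q q', K q -> K q' -> K (midpoint q q');
  reg_box : forall q, K q -> `|q| <= 1;
  reg_compact : compact K;
  reg_jac : forall q, K q -> jac b c d q != 0;
  reg_open : open Ko;
  reg_dense : K `<=` closure Ko
}.

Section Regular.
Variables (K Ko : set (plane R)) (a b c d : plane R).
Hypothesis reg : regular_map K Ko a b c d.
Local Notation F := (bilin a b c d).
Local Notation E := (bilin a b c d @` Ko).
Local Notation J := (jac b c d).

Lemma continuous_bilin : continuous F.
Proof.
move=> q; apply: cvgD.
  apply: cvgD; last by apply: cvgZr_tmp; exact: cvg_coord2.
  by apply: cvgD; [exact: cvg_cst|apply: cvgZr_tmp; exact: cvg_coord1].
apply: cvgZr_tmp; apply: cvgM; [exact: cvg_coord1|exact: cvg_coord2].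
Qed.

Lemma continuous_jac : continuous J.
Proof.
move=> q; have c1 := @cvg_coord1 R q; have c2 := @cvg_coord2 R q.
apply: cvgB; apply: cvgM; apply: cvgD; try exact: cvg_cst;
  by apply: cvgM => //; exact: cvg_cst.
Qed.

Lemma jac_bound : exists2 e : R, 0 < e & forall q, K q -> e <= `|J q|.
Proof.
have [K0|/nonemptyPn K0] := pselect (K !=set0); last by exists 1 => // q; rewrite K0.
have [|q qK qmin] := compact_EVT_min K0 (reg_compact reg) (f := fun q => `|J q|).
  apply: continuous_subspaceT => q; apply: cvg_norm; exact: continuous_jac.
exists `|J q|; first by rewrite normr_gt0 (reg_jac reg) // -in_setE.
by move=> q' Kq'; apply: qmin; rewrite in_setE.
Qed.

(** Cramer's rule in [secant], with a lower bound for the Jacobian determinant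
    at the midpoint. *)
Lemma bilin_lipschitz : exists2 C : R, 0 < C &
  forall q q', K q -> K q' -> `|q' - q| <= C * `|F q' - F q|.
Proof.
have [e e0 Je] := jac_bound.
pose B := 1 + `|b| + `|c| + `|d|.
have B0 : 0 < B by rewrite /B -!addrA ltr_pwDl ?addr_ge0.
exists (2 * B / e) => [|q q' Kq Kq']; first by rewrite divr_gt0 ?mulr_gt0.
have Km := reg_mid reg Kq Kq'; have [s1 s2] := secant a b c d q q'.
have m1 := le_trans (norm_fst _) (reg_box reg Km).
have m2 := le_trans (norm_snd _) (reg_box reg Km).
have bu : `|bilin_u b d (midpoint q q')| <= B.
  rewrite /bilin_u (le_trans (ler_normD _ _)) // normrZ.
  have := ler_wpM2r (normr_ge0 d) m2; rewrite mul1r => h.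
  rewrite /B -!addrA (addrCA `|b|); have := normr_ge0 c; lra.
have bv : `|bilin_v c d (midpoint q q')| <= B.
  rewrite /bilin_v (le_trans (ler_normD _ _)) // normrZ.
  have := ler_wpM2r (normr_ge0 d) m1; rewrite mul1r => h.
  rewrite /B; have := normr_ge0 b; lra.
have main (s D : R) : s * J (midpoint q q') = D ->
    `|D| <= 2 * B * `|F q' - F q| -> `|s| <= 2 * B / e * `|F q' - F q|.
  move=> sD DB; rewrite mulrAC ler_pdivlMr // (le_trans _ DB) // -sD normrM.
  by rewrite ler_wpM2l // Je.
rewrite prod_normE ge_max; apply/andP; split; [apply: main s1 _|apply: main s2 _].
  rewrite (le_trans (norm_det2 _ _)) // mulrAC ler_wpM2r // ler_wpM2l //.
by rewrite (le_trans (norm_det2 _ _)) // ler_wpM2r // ler_wpM2l.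
Qed.

Lemma bilin_inj q q' : K q -> K q' -> F q = F q' -> q = q'.
Proof.
move=> Kq Kq' FE; have [C _ lip] := bilin_lipschitz.
apply/eqP; rewrite eq_sym -subr_eq0 -normr_le0 (le_trans (lip _ _ Kq Kq')) //.
by rewrite FE subrr normr0 mulr0.
Qed.

Definition normsq (v : plane R) : R := v.1 ^+ 2 + v.2 ^+ 2.

Lemma normsq_ge v : `|v| ^+ 2 <= normsq v.
Proof.
rewrite prod_normE /normsq maxEle.
by case: ifP => _; rewrite real_normK ?num_real // (lerDl, lerDr) sqr_ge0.
Qed.

Lemma normsq_le v : normsq v <= 2 * `|v| ^+ 2.
Proof.
rewrite /normsq mulr_natl mulr2n -[v.1 ^+ 2]real_normK ?num_real //.
rewrite -[v.2 ^+ 2]real_normK ?num_real //.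
by rewrite lerD ?lerXn2r ?nnegrE ?norm_fst ?norm_snd.
Qed.

Lemma normsq_gt0 v : v != 0 -> 0 < normsq v.
Proof.
move=> v0; apply: lt_le_trans (normsq_ge v).
by rewrite exprn_gt0 // normr_gt0.
Qed.

Lemma bilin_step q h (t : R) : F (q + t *: h) - F q =
  t *: (h.1 *: bilin_u b d q + h.2 *: bilin_v c d q)
  + (t ^+ 2 * (h.1 * h.2)) *: d.
Proof.
rewrite /bilin /bilin_u /bilin_v [LHS]surjective_pairing [RHS]surjective_pairing.
by rewrite !planeE; congr pair; ring.
Qed.

(** Near an image point of [Ko], the squared distance from [y] to [F q] has a
    minimum inside [Ko]; there the derivative of [F] is invertible, so that the
    distance could be decreased if it were positive. *)
Lemma image_open : open E.
Proof.
rewrite openE => _ [q0 Koq0 <-]; have Kq0 := reg_sub reg Koq0.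
have [C C0 lip] := bilin_lipschitz.
have /nbhs_normP[dl dl0 ball_dl] : nbhs q0 Ko.
  by apply: open_nbhs_nbhs; split; [exact: (reg_open reg)|].
have e0 : 0 < dl / (3 * C) by rewrite divr_gt0 // mulr_gt0.
apply: (proj2 (@nbhs_normP _ _ (F q0) E)); exists (dl / (3 * C)) => // y /= ylt.
have [|||q1 q1K q1min] := @compact_EVT_min _ _ (fun q => normsq (F q - y)) K.
- by exists q0.
- exact: (reg_compact reg).
- apply: continuous_subspaceT => q.
  have Fc : F q' - y @[q' --> q] --> F q - y.
    by apply: cvgB; [exact: continuous_bilin|exact: cvg_cst].
  have F1 : (F q' - y).1 @[q' --> q] --> (F q - y).1.
    apply: (@cvg_comp _ _ _ (fun z => F z - y) (fun z : plane R => z.1) _ _ _ Fc).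
    exact: cvg_coord1.
  have F2 : (F q' - y).2 @[q' --> q] --> (F q - y).2.
    apply: (@cvg_comp _ _ _ (fun z => F z - y) (fun z : plane R => z.2) _ _ _ Fc).
    exact: cvg_coord2.
  by apply: cvgD; rewrite expr2; under eq_fun do rewrite expr2; apply: cvgM.
have Kq1 : K q1 by rewrite -in_setE.
(* [F q1] is within three times the tolerance of [F q0], hence [q1] is close to
   [q0] by the Lipschitz bound. *)
have Koq1 : Ko q1.
  apply: ball_dl => /=; rewrite distrC (le_lt_trans (lip _ _ Kq0 Kq1)) //.
  have near_y : `|F q1 - y| <= 2 * (dl / (3 * C)).
    have ge0 : 0 <= 2 * (dl / (3 * C)) by rewrite mulr_ge0 // ltW.
    rewrite -(@ler_pXn2r _ 2) ?nnegrE // (le_trans (normsq_ge _)) //.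
    have := q1min q0; rewrite in_setE => /(_ Kq0)/le_trans; apply.
    rewrite (le_trans (normsq_le _)) // exprMn.
    have : `|F q0 - y| ^+ 2 <= (dl / (3 * C)) ^+ 2.
      by rewrite lerXn2r ?nnegrE // ltW.
    have := sqr_ge0 (dl / (3 * C)); lra.
  have : `|F q1 - F q0| < 3 * (dl / (3 * C)).
    rewrite -[F q1](subrK y) -addrA (le_lt_trans (ler_normD _ _)) //.
    by have -> : `|y - F q0| = `|F q0 - y| by [exact: distrC]; lra.
  have -> : 3 * (dl / (3 * C)) = dl / C by field; exact: lt0r_neq0.
  by rewrite ltr_pdivlMr // mulrC.
exists q1 => //; apply/eqP; rewrite -subr_eq0; apply/negPn/negP => Fy0.
have J0 := reg_jac reg Kq1.
set w := F q1 - y in Fy0.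
pose u := bilin_u b d q1; pose v := bilin_v c d q1.
pose h : plane R := (det2 (- w) v / J q1, det2 u (- w) / J q1).
have hE : h.1 *: bilin_u b d q1 + h.2 *: bilin_v c d q1 = - w.
  exact: cramer_rule.
pose D := (h.1 * h.2) *: d.
have step t : F (q1 + t *: h) - y = (1 - t) *: w + t ^+ 2 *: D.
  rewrite -[F (q1 + t *: h)](subrKC (F q1)) addrAC -/w (bilin_step q1 h t) hE.
  by rewrite /D scalerA scalerN scalerBl scale1r addrA.
pose s := w.1 * D.1 + w.2 * D.2.
pose P : {poly R} := (- 2 * normsq w)%:P + (normsq w)%:P * 'X
  + (2 * s)%:P * (1 - 'X) * 'X + (normsq D)%:P * 'X ^+ 3.
have PE t : normsq (F (q1 + t *: h) - y) - normsq w = t * P.[t].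
  rewrite step /P !(hornerD, hornerM, hornerN, hornerC, hornerX, horner_exp).
  by rewrite /normsq /s !planeE; ring.
have P0 : P.[0] < 0.
  rewrite /P !(hornerD, hornerM, hornerN, hornerC, hornerX, horner_exp).
  rewrite !(mulr0, addr0, expr0n) mulNr oppr_lt0 mulr_gt0 //.
  exact: normsq_gt0.
have nP : \forall t \near (0 : R), P.[t] < 0.
  by apply: (cvgr_lt _ (@continuous_horner _ P 0)).
have nK : \forall t \near (0 : R), Ko (q1 + t *: h).
  have hc : q1 + t *: h @[t --> (0 : R)] --> q1.
    have {2}-> : q1 = q1 + 0 *: h by rewrite scale0r addr0.
    by apply: cvgD; [exact: cvg_cst|apply: cvgZr_tmp; exact: cvg_id].
  by apply: hc; apply: open_nbhs_nbhs; split; [exact: (reg_open reg)|].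
have [r r0 near0] := proj1 (@nbhs_normP _ _ (0 : R) _) (filterI nP nK).
have r2 : 0 < r / 2 by rewrite divr_gt0.
have [] : P.[r / 2] < 0 /\ Ko (q1 + (r / 2) *: h).
  apply: near0 => /=; rewrite sub0r normrN gtr0_norm //.
  by rewrite ltr_pdivrMr // ltr_pMr // ltr1n.
move=> Pr Kor; have := q1min (q1 + (r / 2) *: h).
rewrite in_setE => /(_ (reg_sub reg Kor)); rewrite leNgt => /negP; apply.
by rewrite -subr_lt0 PE pmulr_rlt0.
Qed.

Lemma image_dense q : K q -> closure E (F q).
Proof.
move=> Kq B /continuous_bilin/(reg_dense reg Kq)[q' [Koq' Bq']].
by exists (F q'); split => //; exists q'.
Qed.

Lemma image_closed : closed (F @` K).
Proof.
apply: compact_closed; first exact: norm_hausdorff.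
apply: continuous_compact; last exact: (reg_compact reg).
by apply: continuous_subspaceT; exact: continuous_bilin.
Qed.

Lemma closure_image : closure E = F @` K.
Proof.
apply/seteqP; split.
  rewrite [X in _ `<=` X](closure_id _).1; last exact: image_closed.
  by apply: closure_subset; apply: image_subset; exact: (reg_sub reg).
by move=> _ [q Kq <-]; exact: image_dense.
Qed.

Definition bilin_inv y : plane R := xget 0 [set q | K q /\ F q = y].

Lemma bilinK q : K q -> bilin_inv (F q) = q.
Proof.
move=> Kq; rewrite /bilin_inv; case: xgetP => [q' _ [Kq' FE]|/(_ q)].
  exact: bilin_inj.
by case.
Qed.

Lemma bilin_inv_cvg q : K q ->
  bilin_inv y @[y --> within (F @` K) (nbhs (F q))] --> q.
Proof.
move=> Kq; have [C C0 lip] := bilin_lipschitz.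
apply/cvgrPdist_lt => e e0; rewrite near_withinE.
have eC : 0 < e / C by rewrite divr_gt0.
have : \forall y \near F q, `|F q - y| < e / C.
  by apply/nbhs_normP; exists (e / C).
apply: filterS => y ylt [q' Kq' yE]; move: ylt.
rewrite -yE bilinK // ltr_pdivlMr // => dlt.
by rewrite (le_lt_trans (lip _ _ Kq' Kq)) // mulrC.
Qed.

Lemma transport_cvg (f r : plane R -> R) (A : set (plane R)) q :
    A `<=` K -> (forall q', A q' -> f (F q') = r q') -> K q ->
    r y @[y --> q] --> r q ->
  f y @[y --> within (F @` A) (nbhs (F q))] --> r q.
Proof.
move=> AK fr Kq rc.
have FAK : F @` A `<=` F @` K by exact: image_subset.
apply: (@cvg_trans _ ((r \o bilin_inv) y @[y --> within (F @` A) (nbhs (F q))])).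
  apply: near_eq_cvg; rewrite near_withinE; apply: filterE => _ [q' Aq' <-] /=.
  by rewrite bilinK ?fr //; exact: AK.
apply: cvg_comp rc; apply: cvg_trans (bilin_inv_cvg Kq).
by apply: cvg_app; apply: within_subset.
Qed.

Local Notation bipoly := {poly {poly R}}.
Local Notation e1 := (e1 R).
Local Notation e2 := (e2 R).

Definition u1p : bipoly := affine_poly b.1 d.1 (varV R).
Definition u2p : bipoly := affine_poly b.2 d.2 (varV R).
Definition v1p : bipoly := affine_poly c.1 d.1 (varU R).
Definition v2p : bipoly := affine_poly c.2 d.2 (varU R).
Definition jacp : bipoly := det_poly u1p v2p u2p v1p.

Lemma ev0 q : ev q 0 = 0.
Proof. by rewrite /ev !horner0. Qed.
Lemma ev_affine q s t (X : bipoly) : ev q (affine_poly s t X) = s + t * ev q X.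
Proof. by rewrite affine_poly.unlock evD evM !ev_cst. Qed.
Lemma dd_affine x s t (X : bipoly) :
  dd x (affine_poly s t X) = cst2 t * dd x X.
Proof. by rewrite affine_poly.unlock ddD ddM !dd_cst mul0r !add0r. Qed.
Lemma ev_det q (A B C D : bipoly) :
  ev q (det_poly A B C D) = ev q A * ev q B - ev q C * ev q D.
Proof. by rewrite det_poly.unlock evD evN !evM. Qed.
Lemma ev_dd_det q x (A B C D : bipoly) : ev q (dd x (det_poly A B C D)) =
  ev q (dd x A) * ev q B + ev q A * ev q (dd x B)
  - (ev q (dd x C) * ev q D + ev q C * ev q (dd x D)).
Proof. by rewrite det_poly.unlock ddD ddN !ddM evD evN !evD !evM. Qed.

Lemma ev_u1p q : ev q u1p = (bilin_u b d q).1.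
Proof. by rewrite /u1p ev_affine ev_V mulrC. Qed.
Lemma ev_u2p q : ev q u2p = (bilin_u b d q).2.
Proof. by rewrite /u2p ev_affine ev_V mulrC. Qed.
Lemma ev_v1p q : ev q v1p = (bilin_v c d q).1.
Proof. by rewrite /v1p ev_affine ev_U mulrC. Qed.
Lemma ev_v2p q : ev q v2p = (bilin_v c d q).2.
Proof. by rewrite /v2p ev_affine ev_U mulrC. Qed.
Lemma ev_jacp q : ev q jacp = J q.
Proof. by rewrite /jacp ev_det ev_u1p ev_u2p ev_v1p ev_v2p. Qed.

(** The coefficients of the increment in the reference coordinates are carried
    over by [secant]; they stay continuous because the inverse map is. *)
Lemma transport_diff (f r : plane R -> R) q r1 r2 :
    Ko q -> (forall q', Ko q' -> f (F q') = r q') -> caratheodory r q r1 r2 ->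
  caratheodory f (F q)
    ((r1 * (bilin_v c d q).2 - r2 * (bilin_u b d q).2) / J q)
    ((r2 * (bilin_u b d q).1 - r1 * (bilin_v c d q).1) / J q).
Proof.
move=> Koq fr [R1 [R2 [R1c R2c rE]]].
have Kq : K q := reg_sub reg Koq.
have nE : nbhs (F q) E.
  by apply: open_nbhs_nbhs; split; [exact: image_open|exists q].
have Gc : bilin_inv y @[y --> F q] --> q.
  have -> : nbhs (F q) = within E (nbhs (F q)).
    by rewrite within_interior //; exact: nE.
  apply: cvg_trans (bilin_inv_cvg Kq); apply: cvg_app.
  by apply: within_subset; apply: image_subset; exact: (reg_sub reg).
pose m y := midpoint q (bilin_inv y).
have mc : m y @[y --> F q] --> q.
  have {2}-> : q = 2^-1 *: (q + q).
    rewrite [LHS]surjective_pairing [RHS]surjective_pairing !planeE.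
    by congr pair; field.
  by apply: cvgZl_tmp; apply: cvgD => //; exact: cvg_cst.
have lim Q : ev (m y) Q @[y --> F q] --> ev q Q.
  exact: cvg_comp mc (@continuous_ev R Q q).
have R1Gc : R1 (bilin_inv y) @[y --> F q] --> r1 by exact: cvg_comp R1c.
have R2Gc : R2 (bilin_inv y) @[y --> F q] --> r2 by exact: cvg_comp R2c.
rewrite -ev_jacp -ev_u1p -ev_u2p -ev_v1p -ev_v2p.
exists (fun y => (R1 (bilin_inv y) * ev (m y) v2p
    - R2 (bilin_inv y) * ev (m y) u2p) / ev (m y) jacp),
  (fun y => (R2 (bilin_inv y) * ev (m y) u1p
    - R1 (bilin_inv y) * ev (m y) v1p) / ev (m y) jacp).
have rGE : \forall y \near F q, r (bilin_inv y) - r q =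
    R1 (bilin_inv y) * ((bilin_inv y).1 - q.1)
    + R2 (bilin_inv y) * ((bilin_inv y).2 - q.2).
  exact: Gc rE.
have J0 : ev q jacp != 0 by rewrite ev_jacp; exact: (reg_jac reg).
have nE' : \forall y \near F q, E y by exact: nE.
split; last near=> y.
- by apply: cvgM; [apply: cvgB; apply: cvgM|apply: cvgV].
- by apply: cvgM; [apply: cvgB; apply: cvgM|apply: cvgV].
have [q' Koq' yE] : E y by near: y.
have Kq' : K q' := reg_sub reg Koq'.
have [s1 s2] := secant a b c d q q'.
have : r (bilin_inv y) - r q =
    R1 (bilin_inv y) * ((bilin_inv y).1 - q.1)
    + R2 (bilin_inv y) * ((bilin_inv y).2 - q.2) by near: y.
rewrite /m -yE bilinK // !fr // => ->.
rewrite ev_jacp ev_u1p ev_u2p ev_v1p ev_v2p.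
have Jm : J (midpoint q q') != 0 by apply: (reg_jac reg); exact: (reg_mid reg).
have -> : q'.1 - q.1 = det2 (F q' - F q) (bilin_v c d (midpoint q q'))
    / J (midpoint q q') by rewrite -s1 mulfK.
have -> : q'.2 - q.2 = det2 (bilin_u b d (midpoint q q')) (F q' - F q)
    / J (midpoint q q') by rewrite -s2 mulfK.
move: (F q') (F q) (bilin_u _ _ _) (bilin_v _ _ _) (J _) Jm => z z' u v j j0.
by rewrite /det2 !planeE; field.
Unshelve. all: by end_near. Qed.

Lemma ev_dd_u1p q x : ev q (dd x u1p) = x.2 * d.1.
Proof. by rewrite /u1p dd_affine dd_V evM !ev_cst mulrC. Qed.
Lemma ev_dd_u2p q x : ev q (dd x u2p) = x.2 * d.2.
Proof. by rewrite /u2p dd_affine dd_V evM !ev_cst mulrC. Qed.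
Lemma ev_dd_v1p q x : ev q (dd x v1p) = x.1 * d.1.
Proof. by rewrite /v1p dd_affine dd_U evM !ev_cst mulrC. Qed.
Lemma ev_dd_v2p q x : ev q (dd x v2p) = x.1 * d.2.
Proof. by rewrite /v2p dd_affine dd_U evM !ev_cst mulrC. Qed.

(** The numerator in Cramer's rule for the derivative in the direction [w] of
    a transported function with partial derivatives [Q1] and [Q2]. *)
Definition cramer (w : plane R) (Q1 Q2 : bipoly) : bipoly :=
  det_poly (det_poly (cst2 w.1) v2p (cst2 w.2) v1p) Q1
    (det_poly (cst2 w.1) u2p (cst2 w.2) u1p) Q2.

Definition grad_num w (P : bipoly) : bipoly := cramer w (dd e1 P) (dd e2 P).

(** Each further derivative of a quotient by a power of the Jacobian determinant
    is again such a quotient; this is the numerator of the second one. *)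
Definition hess_num w v (P : bipoly) : bipoly :=
  cramer w (det_poly (dd e1 (grad_num v P)) jacp (grad_num v P) (dd e1 jacp))
           (det_poly (dd e2 (grad_num v P)) jacp (grad_num v P) (dd e2 jacp)).

Lemma ev_cramer q w Q1 Q2 : ev q (cramer w Q1 Q2) =
  (w.1 * (bilin_v c d q).2 - w.2 * (bilin_v c d q).1) * ev q Q1
  - (w.1 * (bilin_u b d q).2 - w.2 * (bilin_u b d q).1) * ev q Q2.
Proof. by rewrite /cramer !ev_det !ev_cst ev_u1p ev_u2p ev_v1p ev_v2p. Qed.

Lemma ev_dd_jacp q x : ev q (dd x jacp) =
  x.2 * d.1 * (bilin_v c d q).2 + (bilin_u b d q).1 * (x.1 * d.2)
  - (x.2 * d.2 * (bilin_v c d q).1 + (bilin_u b d q).2 * (x.1 * d.1)).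
Proof.
by rewrite /jacp ev_dd_det ev_dd_u1p ev_dd_u2p ev_dd_v1p ev_dd_v2p
  ev_u1p ev_u2p ev_v1p ev_v2p.
Qed.

Lemma ev_dd_cramer q x w Q1 Q2 : ev q (dd x (cramer w Q1 Q2)) =
  x.1 * (w.1 * d.2 - w.2 * d.1) * ev q Q1
  + (w.1 * (bilin_v c d q).2 - w.2 * (bilin_v c d q).1) * ev q (dd x Q1)
  - (x.2 * (w.1 * d.2 - w.2 * d.1) * ev q Q2
     + (w.1 * (bilin_u b d q).2 - w.2 * (bilin_u b d q).1) * ev q (dd x Q2)).
Proof.
rewrite /cramer ev_dd_det !ev_det !ev_dd_det !dd_cst !ev0 !ev_cst ev_u1p ev_u2p
  ev_v1p ev_v2p ev_dd_u1p ev_dd_u2p ev_dd_v1p ev_dd_v2p.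
move: (ev q Q1) (ev q Q2) (ev q (dd x Q1)) (ev q (dd x Q2)) => Q1q Q2q P1 P2.
by ring.
Qed.

Lemma ev_grad q v P : ev q (grad_num v P) =
  (v.1 * (bilin_v c d q).2 - v.2 * (bilin_v c d q).1) * ev q (dd e1 P)
  - (v.1 * (bilin_u b d q).2 - v.2 * (bilin_u b d q).1) * ev q (dd e2 P).
Proof. exact: ev_cramer. Qed.

Lemma ev_dd_grad q x v P : ev q (dd x (grad_num v P)) =
  x.1 * (v.1 * d.2 - v.2 * d.1) * ev q (dd e1 P)
  + (v.1 * (bilin_v c d q).2 - v.2 * (bilin_v c d q).1)
    * ev q (dd x (dd e1 P))
  - (x.2 * (v.1 * d.2 - v.2 * d.1) * ev q (dd e2 P)
     + (v.1 * (bilin_u b d q).2 - v.2 * (bilin_u b d q).1)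
       * ev q (dd x (dd e2 P))).
Proof. exact: ev_dd_cramer. Qed.

Lemma ev_hess q w v P : ev q (hess_num w v P) =
  (w.1 * (bilin_v c d q).2 - w.2 * (bilin_v c d q).1) *
    (ev q (dd e1 (grad_num v P)) * J q
     - ev q (grad_num v P) * ev q (dd e1 jacp))
  - (w.1 * (bilin_u b d q).2 - w.2 * (bilin_u b d q).1) *
    (ev q (dd e2 (grad_num v P)) * J q
     - ev q (grad_num v P) * ev q (dd e2 jacp)).
Proof. by rewrite /hess_num ev_cramer 2!(ev_det q _ jacp) ev_jacp. Qed.

Section Transported.
Variables (f : plane R -> R) (P : bipoly).
Hypothesis fP : forall q, Ko q -> f (F q) = ev q P.

Lemma transported_grad q : Ko q ->
  differentiable f (F q) /\
  forall v, 'D_v f (F q) = ev q (grad_num v P) / ev q jacp.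
Proof.
move=> Koq; have Kq := reg_sub reg Koq.
have [df Df] := caratheodory_diff (transport_diff Koq fP (caratheodory_ev P q)).
split=> // v; rewrite Df ev_grad ev_jacp.
move: (reg_jac reg Kq) (ev q (dd e1 P)) (ev q (dd e2 P)) => j0 x y.
by field; exact: j0.
Qed.

Lemma transported_hess q v : Ko q ->
  differentiable ('D_v f) (F q) /\
  forall w, 'D_w ('D_v f) (F q) = ev q (hess_num w v P) / ev q jacp ^+ 3.
Proof.
move=> Koq; have Kq := reg_sub reg Koq.
have J0 : ev q jacp != 0 by rewrite ev_jacp (reg_jac reg).
have gC := caratheodory_div J0 (caratheodory_ev (grad_num v P) q)
  (caratheodory_ev jacp q).
have Dv q' : Ko q' -> (fun y => 'D_v f y) (F q') =
    ev q' (grad_num v P) / ev q' jacp.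
  by move=> Koq'; exact: (transported_grad Koq').2.
have [df Df] := caratheodory_diff
  (@transport_diff (fun y => 'D_v f y) _ _ _ _ Koq Dv gC).
split=> // w; rewrite Df ev_hess -ev_jacp.
move: (ev q jacp) J0 => j j0; move: (ev q (dd _ jacp)) (ev q (dd _ jacp)).
move: (ev q (dd _ (grad_num _ _))) (ev q (dd _ (grad_num _ _))).
move: (ev q (grad_num _ _)) (bilin_u b d q) (bilin_v c d q) => z u u' x y x' y'.
by field.
Qed.

Lemma continuous_ratio Q k q : K q ->
  (ev y Q / ev y jacp ^+ k) @[y --> q] --> ev q Q / ev q jacp ^+ k.
Proof.
move=> Kq; apply: cvgM; first exact: continuous_ev.
apply: cvgV; first by rewrite expf_neq0 // ev_jacp (reg_jac reg).
rewrite -rmorphXn /=; under eq_fun do rewrite -rmorphXn /=.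
exact: continuous_ev.
Qed.

(** The derivatives of [P] in the reference coordinates are obtained from those
    of the transported function by the chain rule, with [S] the jet of the
    latter. *)
Definition chain_rule q (S : jet R) : Prop :=
  let u := bilin_u b d q in let v := bilin_v c d q in
  [/\ ev q P = j0 S, ev q (dd e1 P) = jlin S u, ev q (dd e2 P) = jlin S v
    & [/\ ev q (dd e1 (dd e1 P)) = jquad S u u,
          ev q (dd e1 (dd e2 P)) = jquad S u v + jlin S d
        & ev q (dd e2 (dd e2 P)) = jquad S v v]].

Definition transported_jet q : jet R :=
  Jet (ev q P) (ev q (grad_num e1 P) / ev q jacp)
    (ev q (grad_num e2 P) / ev q jacp)
    (ev q (hess_num e1 e1 P) / ev q jacp ^+ 3)
    (ev q (hess_num e1 e2 P) / ev q jacp ^+ 3)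
    (ev q (hess_num e2 e2 P) / ev q jacp ^+ 3).

Lemma transported_chain q : K q -> chain_rule q (transported_jet q).
Proof.
move=> Kq; have j0 := reg_jac reg Kq; rewrite -ev_jacp in j0.
have jE : ev q jacp = (bilin_u b d q).1 * (bilin_v c d q).2
  - (bilin_u b d q).2 * (bilin_v c d q).1 by rewrite ev_jacp.
rewrite /chain_rule /transported_jet (ev_hess q e1 e1 P) (ev_hess q e1 e2 P) (ev_hess q e2 e2 P).
rewrite !(ev_dd_grad q) !(ev_grad q) !(ev_dd_jacp q) -ev_jacp -(dd_comm P).
move: (ev q (dd e1 P)) (ev q (dd e2 P)) => p1 p2.
move: (ev q (dd e1 (dd e1 P))) (ev q (dd e1 (dd e2 P))) (ev q (dd e2 (dd e2 P))).
move=> p11 p12 p22; move: (ev q jacp) jE j0 => j ->.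
move: (bilin_u b d q) (bilin_v c d q) => [u1 u2] [v1 v2].
case: d => d1 d2 /= j0; rewrite /jlin /jquad /= !(mul1r, mul0r).
rewrite !(mulr0, addr0, add0r, subr0, sub0r).
by split=> //; [field|field|split; field].
Qed.

Lemma transported_limit_jet q : K q -> limit_jet E f (F q) (transported_jet q).
Proof.
move=> Kq.
have lim g Q k : (forall q', Ko q' -> g (F q') = ev q' Q / ev q' jacp ^+ k) ->
    g y @[y --> within E (nbhs (F q))] --> ev q Q / ev q jacp ^+ k.
  move=> gE; apply: (transport_cvg (r := fun q => ev q Q / ev q jacp ^+ k)) => //.
    exact: (reg_sub reg).
  exact: continuous_ratio.
split.
- have -> : j0 (transported_jet q) = ev q P / ev q jacp ^+ 0.
    by rewrite expr0 divr1.
  by apply: lim => q' Koq'; rewrite expr0 divr1 fP.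
- move=> v.
  have -> : jlin (transported_jet q) v = ev q (grad_num v P) / ev q jacp ^+ 1.
    rewrite /jlin /= expr1 (ev_grad q v) !(ev_grad q) /= !(mul1r, mul0r).
    move: (ev q (dd e1 P)) (ev q (dd e2 P)) (ev q jacp)^-1 => x y z; ring.
  by apply: lim => q' Koq'; rewrite expr1 (transported_grad Koq').2.
- by apply: lim => q' Koq'; exact: (transported_hess _ Koq').2.
- by apply: lim => q' Koq'; exact: (transported_hess _ Koq').2.
- by apply: lim => q' Koq'; exact: (transported_hess _ Koq').2.
Qed.

Definition bilin_d q x : plane R := x.1 *: bilin_u b d q + x.2 *: bilin_v c d q.

Lemma chain_rule_dir q S : chain_rule q S ->
  (forall x, ev q (dd x P) = jlin S (bilin_d q x)) /\
  (forall x y, ev q (dd x (dd y P)) = jquad S (bilin_d q x) (bilin_d q y)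
     + (x.1 * y.2 + x.2 * y.1) * jlin S d).
Proof.
move=> [_ p1 p2 [p11 p12 p22]].
have D1 x : ev q (dd x P) = x.1 * ev q (dd e1 P) + x.2 * ev q (dd e2 P).
  by rewrite dd_coord evD !ev_cstM.
have D2 x y : ev q (dd x (dd y P)) = x.1 * (y.1 * ev q (dd e1 (dd e1 P))
      + y.2 * ev q (dd e1 (dd e2 P)))
    + x.2 * (y.1 * ev q (dd e1 (dd e2 P)) + y.2 * ev q (dd e2 (dd e2 P))).
  rewrite [dd x _]dd_coord evD !ev_cstM (dd_coord y P) !ddD !ddM !dd_cst.
  by rewrite !mul0r !add0r !evD !ev_cstM dd_comm.
split=> [x|x y].
  rewrite D1 p1 p2 /jlin /bilin_d !planeE.
  by move: (bilin_u b d q) (bilin_v c d q) => u v; ring.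
rewrite D2 p11 p12 p22 /bilin_d.
move: (bilin_u b d q) (bilin_v c d q) (jlin S d) => u v l.
by rewrite /jquad !planeE; ring.
Qed.

End Transported.
End Regular.
End BilinearMap.

(** * Images of the reference elements *)

Definition side_eq b (x y : side b) (xy : val x = val y) : x = y := val_inj xy.

(** Tables of the addition of corner indices modulo 3 and modulo 4. *)
Definition corner_idx3 := (
  @side_eq false (- 1) (2%:R) erefl,
  @side_eq false (0 + 1) (1) erefl,
  @side_eq false (0 + 2%:R) (2%:R) erefl,
  @side_eq false (1 + 1) (2%:R) erefl,
  @side_eq false (1 + 2%:R) (0) erefl,
  @side_eq false (2%:R + 1) (0) erefl,
  @side_eq false (2%:R + 2%:R) (1) erefl).
Definition corner_idx4 := (
  @side_eq true (- 1) (3%:R) erefl,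
  @side_eq true (0 + 1) (1) erefl,
  @side_eq true (0 + 2%:R) (2%:R) erefl,
  @side_eq true (0 + 3%:R) (3%:R) erefl,
  @side_eq true (1 + 1) (2%:R) erefl,
  @side_eq true (1 + 2%:R) (3%:R) erefl,
  @side_eq true (1 + 3%:R) (0) erefl,
  @side_eq true (2%:R + 1) (3%:R) erefl,
  @side_eq true (2%:R + 2%:R) (0) erefl,
  @side_eq true (2%:R + 3%:R) (1) erefl,
  @side_eq true (3%:R + 1) (0) erefl,
  @side_eq true (3%:R + 2%:R) (1) erefl,
  @side_eq true (3%:R + 3%:R) (2%:R) erefl).

Section Elements.
Variable (R : realType) (b : bool).
Implicit Types (r : side b) (q : plane R) (t : R) (V : side b -> plane R).

Definition ref_elt : set (plane R) :=
  [set q | forall r : side b, 0 <= ev q (lam R r)].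
Definition ref_eltO : set (plane R) :=
  [set q | forall r : side b, 0 < ev q (lam R r)].

Definition side_pt r t : plane R := ((spath R r).1.[t], (spath R r).2.[t]).

Lemma tr_horner r P t : (tr r P).[t] = ev (side_pt r t) P.
Proof. exact: horner_restr. Qed.

Lemma lam_convex r q q' t :
  ev ((1 - t) *: q + t *: q') (lam R r) =
  (1 - t) * ev q (lam R r) + t * ev q' (lam R r).
Proof.
by move: b r; apply: side_ind; rewrite /lam /= ?(evD, evN, ev1, ev_U, ev_V)
  !planeE; ring.
Qed.

Lemma lam_center r : 0 < ev (3^-1, 3^-1) (lam R r).
Proof.
by move: b r; apply: side_ind; rewrite /lam /= ?(evD, evN, ev1, ev_U, ev_V) /=;
  lra.
Qed.

Lemma ref_elt_box q : ref_elt q -> 0 <= q.1 <= 1 /\ 0 <= q.2 <= 1.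
Proof.
rewrite /ref_elt; case: b => Kq; have := Kq 0; have := Kq 1; have := Kq 2%:R.
  have := Kq 3%:R; rewrite /lam /= ?(evD, evN, ev1, ev_U, ev_V) /=; lra.
by rewrite /lam /= ?(evD, evN, ev1, ev_U, ev_V) /=; lra.
Qed.

Lemma ref_elt_compact : compact ref_elt.
Proof.
apply: (@subclosed_compact _ ref_elt
  ((`[0, 1]%classic : set R) `*` (`[0, 1]%classic : set R))).
- have -> : ref_elt = \bigcap_(r : side b) [set q | 0 <= ev q (lam R r)].
    by apply/seteqP; split=> q Kq r; [move=> _|]; exact: Kq.
  apply: closed_bigI => r _.
  apply: (preimage_closed _ (@closed_ge _ 0)) => q _.
  exact: continuous_ev.
- by apply: compact_setX; exact: segment_compact.
- by move=> q /ref_elt_box[? ?]; split; rewrite /= in_itv.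
Qed.

Lemma ref_eltO_open : open ref_eltO.
Proof.
rewrite openE => q Kq; rewrite /interior /ref_eltO.
apply: (@filter_forall _ _ (fun r => [set y | 0 < ev y (lam R r)]) (nbhs q)) => r.
exact: (cvgr_gt _ (@continuous_ev R (lam R r) q) 0 (Kq r)).
Qed.

Lemma ref_elt_dense : ref_elt `<=` closure ref_eltO.
Proof.
move=> q Kq B nB; pose p0 : plane R := (3^-1, 3^-1).
have hc : (1 - t) *: q + t *: p0 @[t --> (0 : R)] --> q.
  have {2}-> : q = (1 - 0) *: q + 0 *: p0 by rewrite subr0 scale1r scale0r addr0.
  apply: cvgD; apply: cvgZr_tmp; last exact: cvg_id.
  by apply: cvgB; [exact: cvg_cst|exact: cvg_id].
have [e e0 Be] := proj1 (@nbhs_normP _ _ (0 : R) _) (hc _ nB).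
pose t := Num.min (e / 2) 2^-1.
have t0 : 0 < t by rewrite lt_min divr_gt0 //= invr_gt0.
have [te t2] : t <= e / 2 /\ t <= 2^-1 by split; rewrite ge_min lexx ?orbT.
exists ((1 - t) *: q + t *: p0); split.
  move=> r; rewrite lam_convex; have := lam_center r; have := Kq r.
  rewrite -/p0; move: (ev q _) (ev p0 _) => x y x0 y0.
  by rewrite ltr_wpDl ?mulr_ge0 ?mulr_gt0 //; lra.
apply: (Be t); rewrite /= sub0r normrN gtr0_norm //.
have e0' : 0 < e := e0; lra.
Qed.

(** The twist, up to sign the mixed derivative of the parametrization, as seen
    from the corner [r]. *)
Definition twist V r : plane R :=
  (b%:R : R) *: (V r - V (r + 1) + V (r + 2%:R) - V (r - 1)).

Definition elt_map V : plane R -> plane R :=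
  bilin (V 0) (V 1 - V 0) (V (- 1) - V 0) (twist V 0).
Definition elt_jac V : plane R -> R :=
  jac (V 1 - V 0) (V (- 1) - V 0) (twist V 0).

Lemma regular_shape V : (forall q, ref_elt q -> elt_jac V q != 0) ->
  regular_map ref_elt ref_eltO
    (V 0) (V 1 - V 0) (V (- 1) - V 0) (twist V 0).
Proof.
move=> J0; split.
- by move=> q Kq r; exact: ltW.
- move=> q q' Kq Kq' r.
  have -> : midpoint q q' = (1 - 2^-1) *: q + 2^-1 *: q'.
    rewrite /midpoint [LHS]surjective_pairing [RHS]surjective_pairing !planeE.
    by congr pair; field.
  rewrite lam_convex; have := Kq r; have := Kq' r.
  by move=> x y; rewrite addr_ge0 ?mulr_ge0 //; lra.
- move=> q /ref_elt_box[/andP[? ?] /andP[? ?]].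
  by rewrite prod_normE ge_max !ger0_norm //; apply/andP.
- exact: ref_elt_compact.
- exact: J0.
- exact: ref_eltO_open.
- exact: ref_elt_dense.
Qed.

Lemma side_pt_in r t : 0 <= t <= 1 -> ref_elt (side_pt r t).
Proof.
move=> t01 r'; rewrite -tr_horner; move: b r r'; apply: side_ind;
  move=> [[|[|[|[|//]]]] i] //=; rewrite /tr /lam /spath /=
   ?(restrD, restrN, restrM, restr1, restr0, restr_U, restr_V, restr_cst)
   !hornerE; lra.
Qed.

Lemma boundary_side q : ref_elt q -> ~ ref_eltO q ->
  exists r t, 0 <= t <= 1 /\ q = side_pt r t.
Proof.
move=> Kq /existsNP[r /negP]; rewrite -leNgt => lq.
have lam0 : ev q (lam R r) = 0 by apply/eqP; rewrite eq_le lq Kq.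
have [q1 q2] := ref_elt_box Kq; exists r.
move: q q1 q2 lam0 {lq Kq} => [x y] /= q1 q2.
rewrite /side_pt; move: b r; apply: side_ind; rewrite /spath /lam /=
  ?(evD, evN, ev1, ev_U, ev_V) /= => l0;
 [exists x|exists y|exists (1 - y)|exists x|exists y|exists (1 - x)|exists (1 - y)];
 rewrite !hornerE; (split; [lra|congr pair; lra]).
Qed.

Local Ltac on_corners b r V :=
  rewrite /elt_map /bilin_d /bilin_u /bilin_v /twist /bilin /side_pt /edir /tau
    /spath [LHS]surjective_pairing [RHS]surjective_pairing;
  move: b r V; apply: side_ind => V; first [rewrite !corner_idx3|rewrite !corner_idx4];
  move: (V 0) (V 1) (V 2%:R) => v0 v1 v2; try move: (V 3%:R) => v3;
  rewrite !planeE /= ?(hornerX, hornerD, hornerN, hornerC, horner0, horner1);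
  congr pair; ring.

Lemma shape_side V r t : elt_map V (side_pt r t) = (1 - t) *: V r + t *: V (r + 1).
Proof. on_corners b r V. Qed.

Lemma bilin_d_edir V r t : bilin_d (V 1 - V 0) (V (- 1) - V 0) (twist V 0)
  (side_pt r t) (edir R r) = V (r + 1) - V r.
Proof. on_corners b r V. Qed.

Lemma bilin_d_tau V r t : bilin_d (V 1 - V 0) (V (- 1) - V 0) (twist V 0)
  (side_pt r t) (tau R r) = V (r - 1) - V r + t *: twist V r.
Proof. on_corners b r V. Qed.

End Elements.

(** ** Boundary data of an element *)

Section BoundaryData.
Variables (R : realType) (b : bool).
Implicit Types (r : side b) (t : R) (V : side b -> plane R).

(** The jet in the reference coordinates that the chain rule yields at the
    corner [r] from the jet [S] at its image. *)
Definition local_jet V r (S : jet R) : jet R :=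
  let d1 := V (r + 1) - V r in let d2 := V (r - 1) - V r in
  Jet (j0 S) (jlin S d1) (jlin S d2) (jquad S d1 d1)
    (jquad S d1 d2 + jlin S (twist V r)) (jquad S d2 d2).

Lemma side3 (r : side false) : r + 1 + 1 = r - 1.
Proof. by move: r => [[|[|[|//]]] i]; apply/val_inj. Qed.
Lemma side4 (r : side true) : r + 1 + 2%:R = r - 1.
Proof. by move: r => [[|[|[|[|//]]]] i]; apply/val_inj. Qed.

Lemma jlinD (S : jet R) (v w : plane R) : jlin S (v + w) = jlin S v + jlin S w.
Proof. by rewrite /jlin !planeE; ring. Qed.
Lemma jlinZ (S : jet R) (k : R) (w : plane R) : jlin S (k *: w) = k * jlin S w.
Proof. by rewrite /jlin !planeE; ring. Qed.
Lemma jquadD (S : jet R) (v w w' : plane R) : jquad S v (w + w') = jquad S v w + jquad S v w'.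
Proof. by rewrite /jquad !planeE; ring. Qed.
Lemma jquadZ (S : jet R) (v : plane R) (k : R) (w : plane R) : jquad S v (k *: w) = k * jquad S v w.
Proof. by rewrite /jquad !planeE; ring. Qed.
Lemma jquadC (S : jet R) (v w : plane R) : jquad S v w = jquad S w v.
Proof. by rewrite /jquad; ring. Qed.

Definition dot (v w : plane R) : R := v.1 * w.1 + v.2 * w.2.

Section Orthogonal.
Variables d n : plane R.
Hypotheses (d_neq0 : d != 0) (n_unit : dot n n = 1) (n_orth : dot n d = 0).

Lemma dot_gt0 : 0 < dot d d.
Proof. by rewrite /dot -!expr2; exact: normsq_gt0. Qed.

Lemma ortho_expand w : w = dot n w *: n + (dot d w / dot d d) *: d.
Proof.
have D0 := lt0r_neq0 dot_gt0.
move: n_unit n_orth D0; rewrite /dot; move: n w => m w nn nd D0.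
have dE : d.1 * d.1 + d.2 * d.2 = (m.1 * d.2 - m.2 * d.1) ^+ 2.
  have : (m.1 * d.2 - m.2 * d.1) ^+ 2 + (m.1 * d.1 + m.2 * d.2) ^+ 2 =
      (m.1 * m.1 + m.2 * m.2) * (d.1 * d.1 + d.2 * d.2) by ring.
  by rewrite nn nd mul1r expr0n addr0.
have dE1 : d.1 = - m.2 * (m.1 * d.2 - m.2 * d.1).
  have : d.1 * (m.1 * m.1 + m.2 * m.2) - m.1 * (m.1 * d.1 + m.2 * d.2) =
    - m.2 * (m.1 * d.2 - m.2 * d.1) by ring.
  by rewrite nn nd mulr1 mulr0 subr0.
have dE2 : d.2 = m.1 * (m.1 * d.2 - m.2 * d.1).
  have : d.2 * (m.1 * m.1 + m.2 * m.2) - m.2 * (m.1 * d.1 + m.2 * d.2) =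
    m.1 * (m.1 * d.2 - m.2 * d.1) by ring.
  by rewrite nn nd mulr1 mulr0 subr0.
rewrite [LHS]surjective_pairing [RHS]surjective_pairing !planeE.
move: D0; rewrite dE; move: (m.1 * d.2 - m.2 * d.1) dE1 dE2 => k -> -> k0.
have {}k0 : k != 0 by move: k0; rewrite expf_eq0.
by congr pair; rewrite -[LHS]mulr1 -nn; field; exact: k0.
Qed.

Lemma jlin_ortho S w : jlin S w =
  dot n w * jlin S n + dot d w / dot d d * jlin S d.
Proof.
rewrite {1}[w]ortho_expand /jlin !planeE.
by move: (dot n w) (dot d w / _) => x y; ring.
Qed.

Lemma jquad_ortho S w : jquad S d w =
  dot n w * jquad S d n + dot d w / dot d d * jquad S d d.
Proof.
rewrite {1}[w]ortho_expand /jquad !planeE.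
by move: (dot n w) (dot d w / _) => x y; ring.
Qed.

End Orthogonal.

Section SideData.
Variables (V : side b -> plane R) (r : side b) (n : plane R).
Let d1 := V (r + 1) - V r.
Let d2 := V (r - 1) - V r.
Hypotheses (d1_neq0 : d1 != 0) (n_unit : dot n n = 1) (n_orth : dot n d1 = 0).

Lemma twist_next : twist V (r + 1) = (- 1) *: twist V r.
Proof.
rewrite /twist scalerA mulrC -scalerA addrK; case: b r V => r' V'; last first.
  by rewrite !scale0r.
congr (_ *: _); rewrite side4 scaleN1r [LHS]surjective_pairing.
rewrite [RHS]surjective_pairing -addrA !planeE.
have -> : r' + 1 + 1 = r' + 2%:R by rewrite -addrA.
by congr pair; ring.
Qed.

Lemma tau_end : d2 + 1 *: twist V r =
  V (r + 1 + 1) - V (r + 1) + (- (~~ b)%:R) *: (V (r + 1 - 1) - V (r + 1)).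
Proof.
rewrite /d2 /twist addrK scale1r; case: b r V => r' V'; last first.
  rewrite side3 [LHS]surjective_pairing [RHS]surjective_pairing !planeE.
  by rewrite /= mulr0n mulr1n; congr pair; ring.
have -> : r' + 1 + 1 = r' + 2%:R by rewrite -addrA.
rewrite [LHS]surjective_pairing [RHS]surjective_pairing !planeE.
by rewrite /= mulr0n mulr1n; congr pair; ring.
Qed.

(** The coefficients of [n] and [d1] in the image of [tau r]. *)
Definition normal_coef : {poly R} := (dot n d2)%:P + (dot n (twist V r))%:P * 'X.
Definition tangent_coef : {poly R} :=
  (dot d1 d2 / dot d1 d1)%:P + (dot d1 (twist V r) / dot d1 d1)%:P * 'X.

Let jlin_side S := jlin_ortho d1_neq0 n_unit n_orth S.
Let jquad_side S := jquad_ortho d1_neq0 n_unit n_orth S.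

Lemma coef_horner S t :
  normal_coef.[t] * jlin S n + tangent_coef.[t] * jlin S d1 =
  jlin S (d2 + t *: twist V r).
Proof.
rewrite jlinD jlinZ [in RHS](jlin_side S d2) [in RHS](jlin_side S (twist V r)).
rewrite /normal_coef /tangent_coef !(hornerD, hornerM, hornerC, hornerX).
move: (dot d1 (twist V r) / _) (dot d1 d2 / _) (dot n d2) => x y z; ring.
Qed.

Lemma side_val (g N : {poly R}) t S :
    g^`().[t] = jlin S d1 -> N.[t] = jlin S n ->
  (normal_coef * N + tangent_coef * g^`()).[t] = jlin S (d2 + t *: twist V r).
Proof. by move=> gt Nt; rewrite hornerD !hornerM gt Nt coef_horner. Qed.

Lemma side_der (g N : {poly R}) t S :
    g^`().[t] = jlin S d1 -> g^`()^`().[t] = jquad S d1 d1 ->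
    N.[t] = jlin S n -> N^`().[t] = jquad S d1 n ->
  (normal_coef * N + tangent_coef * g^`())^`().[t] =
  jlin S (twist V r) + jquad S d1 (d2 + t *: twist V r).
Proof.
move=> gt gt' Nt Nt'.
have A' : normal_coef^`() = (dot n (twist V r))%:P.
  by rewrite /normal_coef derivD derivM !derivC derivX mul0r !add0r mulr1.
have B' : tangent_coef^`() = (dot d1 (twist V r) / dot d1 d1)%:P.
  by rewrite /tangent_coef derivD derivM !derivC derivX mul0r !add0r mulr1.
rewrite derivD !derivM A' B' !(hornerD, hornerM, hornerC) gt gt' Nt Nt'.
rewrite jquadD jquadZ (jlin_side S (twist V r)) (jquad_side S d2).
rewrite (jquad_side S (twist V r)) /normal_coef /tangent_coef.
rewrite !(hornerD, hornerM, hornerC, hornerX).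
move: (dot d1 (twist V r) / _) (dot d1 d2 / _) (dot n d2) => x y z; ring.
Qed.

(** Along the side the image of [tau r] is [d2 + t *: twist V r]; expanding it
    over the orthogonal directions [n] and [d1] turns the normal derivative [N]
    and the trace [g] into the transverse derivative, and the jets at the ends
    are compatible with this expansion. *)
Lemma side_jet_edge S S' (g N : {poly R}) :
    jet3 g (j0 S, jlin S d1, jquad S d1 d1) (j0 S', jlin S' d1, jquad S' d1 d1) ->
    jet2 N (jlin S n, jquad S d1 n) (jlin S' n, jquad S' d1 n) ->
  side_jet b (local_jet V r S) (local_jet V (r + 1) S') g
    (normal_coef * N + tangent_coef * g^`()).
Proof.
move=> [/= [g0 g0' g0''] [g1 g1' g1'']] [/= [N0 N0'] [N1 N1']].
have d2' : V (r + 1 - 1) - V (r + 1) = (- 1) *: d1.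
  by rewrite addrK scaleN1r opprB.
have d1' : d2 + 1 *: twist V r =
    V (r + 1 + 1) - V (r + 1) + (- (~~ b)%:R) *: (V (r + 1 - 1) - V (r + 1)).
  by rewrite tau_end.
split; split; split; rewrite //= ?d2'.
- by rewrite g1' jlinZ; ring.
- by rewrite g1'' jquadZ jquadC jquadZ; ring.
- by rewrite (side_val (S := S)) // scale0r addr0.
- by rewrite (side_der (S := S)) // scale0r addr0 addrC.
- rewrite (side_val (S := S')) // d1' jlinD d2' !jlinZ; ring.
- rewrite (side_der (S := S')) // d1' jquadD d2' twist_next !jquadZ (jlinZ S' (- 1)).
  rewrite (jquadC S' (V (r + 1 + 1) - _)) (jquadC S' ((- 1) *: d1)) jquadZ.
  by move: (jquad S' d1 _) (jquad S' d1 d1) (jlin S' _) => x y z; ring.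
Qed.

End SideData.
End BoundaryData.

(** * Elements and cells of a mesh *)

Lemma bilin_derive (R : realType) (a b c d q v : plane R) :
  'D_v (bilin a b c d) q = bilin_d b c d q v.
Proof.
rewrite /derive; apply: cvg_lim; first exact: norm_hausdorff.
have lim : bilin_d b c d q v + (h * (v.1 * v.2)) *: d @[h --> (0 : R)^'] -->
    bilin_d b c d q v.
  have {2}-> : bilin_d b c d q v = bilin_d b c d q v + (0 * (v.1 * v.2)) *: d.
    by rewrite mul0r scale0r addr0.
  apply: cvgD; first exact: cvg_cst.
  apply: cvgZr_tmp; apply: cvgM; last exact: cvg_cst.
  exact: nbhs_dnbhs.
apply: cvg_trans lim; apply: near_eq_cvg.
near=> h; have h0 : h != 0 by near: h; exact: nbhs_dnbhs_neq.
rewrite /= [h *: v + q]addrC bilin_step scalerDr !scalerA mulVf // scale1r.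
by rewrite expr2 -mulrA mulKf.
Unshelve. all: by end_near. Qed.

Lemma bilin_d_e1 (R : realType) (b c d q : plane R) :
  bilin_d b c d q (1, 0) = bilin_u b d q.
Proof. by rewrite /bilin_d /= scale1r scale0r addr0. Qed.
Lemma bilin_d_e2 (R : realType) (b c d q : plane R) :
  bilin_d b c d q (0, 1) = bilin_v c d q.
Proof. by rewrite /bilin_d /= scale1r scale0r add0r. Qed.

Section Mesh.
Variables (R : realType) (Omega : set (plane R)) (M : mesh_data R).
Hypothesis hM : is_mesh Omega M.
Implicit Types (k : elt_idx M) (e : edge_idx M) (i : vtx_idx M) (x q : plane R).

Definition is_quad k : bool := if k is inr _ then true else false.

Definition corner k : side (is_quad k) -> vtx_idx M :=
  match k with inl i => tri_corner i | inr i => quad_corner i end.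

Definition cpt k (r : side (is_quad k)) : plane R := vtx (corner r).

Lemma paramE k q : param k q = elt_map (@cpt k) q.
Proof.
case: k => i; rewrite /elt_map /twist /bilin /cpt /= /tri_param /quad_param;
  rewrite ?corner_idx3 ?corner_idx4 ?scale0r ?scaler0 ?addr0 ?scale1r;
  rewrite [LHS]surjective_pairing [RHS]surjective_pairing !planeE;
  congr pair; ring.
Qed.

Lemma ref_domE k : ref_dom k = @ref_elt R (is_quad k).
Proof.
apply/seteqP; case: k => i; split=> q /=.
- by move=> [q1 q2] [[|[|[|//]]] l]; rewrite /lam /= ?(evD, evN, ev1, ev_U, ev_V);
    lra.
- move=> Kq; have := Kq 0; have := Kq 1; have := Kq 2%:R.
  rewrite /lam /= ?(evD, evN, ev1, ev_U, ev_V) /ref_tri /=; lra.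
- by move=> [q1 q2] [[|[|[|[|//]]]] l];
    rewrite /lam /= ?(evD, evN, ev1, ev_U, ev_V); lra.
- move=> Kq; have := Kq 0; have := Kq 1; have := Kq 2%:R; have := Kq 3%:R.
  rewrite /lam /= ?(evD, evN, ev1, ev_U, ev_V) /ref_quad /=; lra.
Qed.

Lemma param_shape k : param k = elt_map (@cpt k).
Proof. by apply/funext => q; rewrite paramE. Qed.

Lemma jacobianE k q : jacobian_det (param k) q = elt_jac (@cpt k) q.
Proof.
rewrite param_shape /jacobian_det /elt_map !bilin_derive /elt_jac /jac /det2.
by rewrite !bilin_d_e1 !bilin_d_e2.
Qed.

Lemma regular k : regular_map (@ref_elt R (is_quad k)) (@ref_eltO R (is_quad k))
  (@cpt k 0) (@cpt k 1 - @cpt k 0) (@cpt k (- 1) - @cpt k 0) (twist (@cpt k) 0).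
Proof.
apply: regular_shape => q Kq; rewrite -jacobianE.
by apply: (mesh_param_regular hM); rewrite ref_domE.
Qed.

Lemma cell_inj c c' x : cell (M := M) c x -> cell (M := M) c' x -> c = c'.
Proof.
move=> cx c'x; apply: (mesh_disjoint hM) => //.
by exists x.
Qed.

Lemma vtx_inj i j : vtx i = vtx j -> i = j.
Proof.
by move=> ij; have [] := @cell_inj (inr i) (inr j) (vtx i) erefl ij.
Qed.

Lemma side_edge k (r : side (is_quad k)) :
  exists e, joins e (corner r) (corner (r + 1)).
Proof.
by case: k r => i r; [exact: (mesh_tri_side hM)|exact: (mesh_quad_side hM)].
Qed.

Lemma joins_edge e i j (t : R) : joins e i j -> 0 < t < 1 ->
  edge e ((1 - t) *: vtx i + t *: vtx j).
Proof.
move=> [] ee t01; [exists t|exists (1 - t)].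
- by rewrite /= in_itv.
- by rewrite /edge_pt ee.
- by rewrite /= in_itv /=; lra.
- by rewrite /edge_pt ee /= subKr addrC.
Qed.

Lemma side_cell k (r : side (is_quad k)) (t : R) (x := param k (side_pt r t)) :
  0 <= t <= 1 ->
  [\/ 0 < t < 1 /\ exists2 e, joins e (corner r) (corner (r + 1)) & edge e x,
      t = 0 /\ x = vtx (corner r) | t = 1 /\ x = vtx (corner (r + 1))].
Proof.
rewrite /x paramE shape_side; have [->|t0] := eqVneq t 0.
  by constructor 2; rewrite subr0 scale1r scale0r addr0.
have [->|t1] := eqVneq t 1.
  by constructor 3; rewrite subrr scale1r scale0r add0r.
move=> /andP[t0' t1']; constructor 1.
have t01 : 0 < t < 1 by rewrite !lt_neqAle eq_sym t0 t1 t0' t1'.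
split=> //; have [e he] := side_edge r; exists e => //.
exact: joins_edge.
Qed.

(** The boundary of a closed element consists of points of edges and vertices.
    These are cells of their own, disjoint from all elements. *)
Lemma boundary_elt k k0 q : ref_elt (is_quad k) q ->
  ~ ref_eltO (is_quad k) q -> ~ elt k0 (param k q).
Proof.
move=> Kq nKo xk0; have ck0 : cell (M := M) (inl (inl k0)) (param k q) := xk0.
have [r [t [t01 qE]]] := boundary_side Kq nKo.
move: ck0; rewrite qE => ck; case: (side_cell r t01).
- by move=> [_ [e _ ex]]; have := @cell_inj _ (inl (inr e)) _ ck ex.
- by move=> [_ ex]; have := @cell_inj _ (inr (corner r)) _ ck ex.
- by move=> [_ ex]; have := @cell_inj _ (inr (corner (r + 1))) _ ck ex.
Qed.

Lemma eltE k : elt k = param k @` ref_eltO (is_quad k).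
Proof.
apply/seteqP; split=> [x xk|]; last first.
  rewrite /elt ref_domE -open_subsetE.
    by apply: image_subset => q Kq r; exact: ltW.
  by rewrite param_shape; exact: (image_open (regular k)).
have [q] := interior_subset xk; rewrite ref_domE => Kq qx.
exists q => //; apply: contrapT => /(boundary_elt Kq); apply.
by rewrite qx; exact: xk.
Qed.

Lemma closure_elt k : closure (elt k) = param k @` ref_elt (is_quad k).
Proof. by rewrite eltE param_shape; exact: (closure_image (regular k)). Qed.

Lemma param_inj k q q' : ref_elt (is_quad k) q -> ref_elt (is_quad k) q' ->
  param k q = param k q' -> q = q'.
Proof. by rewrite param_shape; exact: (bilin_inj (regular k)). Qed.

Lemma side_pt_end (b : bool) (r : side b) :
  side_pt r (1 : R) = side_pt (r + 1) 0.
Proof.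
by move: b r; apply: side_ind; rewrite /side_pt /spath /= !hornerE;
  congr pair; ring.
Qed.

Lemma side_pt0 k (r : side (is_quad k)) : param k (side_pt r 0) = vtx (corner r).
Proof. by rewrite paramE shape_side subr0 scale1r scale0r addr0. Qed.

(** The cells are disjoint, so the cell of a point of a closed element
    determines where its preimage lies in the reference element. *)
Lemma elt_point k k0 q : ref_elt (is_quad k) q -> elt k0 (param k q) ->
  k = k0 /\ ref_eltO (is_quad k) q.
Proof.
move=> Kq xk0; have ck0 : cell (M := M) (inl (inl k0)) (param k q) := xk0.
have [Koq|/(boundary_elt Kq)/(_ xk0)//] := pselect (ref_eltO (is_quad k) q).
split=> //; have ck : cell (M := M) (inl (inl k)) (param k q).
  by rewrite /= eltE; exists q.
by have [] := cell_inj ck ck0.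
Qed.

Lemma vtx_point k q i : ref_elt (is_quad k) q -> param k q = vtx i ->
  exists2 r : side (is_quad k), q = side_pt r 0 & i = corner r.
Proof.
move=> Kq xi; have ci : cell (M := M) (inr i) (param k q) := xi.
have [Koq|nKo] := pselect (ref_eltO (is_quad k) q).
  have ck : cell (M := M) (inl (inl k)) (param k q) by rewrite /= eltE; exists q.
  by have := cell_inj ck ci.
have [r [t [t01 qE]]] := boundary_side Kq nKo.
move: ci; rewrite qE => ck; case: (side_cell r t01).
- by move=> [_ [e _ ex]]; have := @cell_inj _ (inl (inr e)) _ ck ex.
- move=> [t0 ex]; exists r; first by rewrite t0.
  by have [] := @cell_inj _ (inr (corner r)) _ ck ex.
- move=> [t1 ex]; exists (r + 1); first by rewrite t1 side_pt_end.
  by have [] := @cell_inj _ (inr (corner (r + 1))) _ ck ex.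
Qed.

(** The point of side [r] that lies at the parameter [t] of the edge [e]. *)
Definition side_par k (r : side (is_quad k)) e (t : R) : R :=
  if (edge_ends e).1 == corner r then t else 1 - t.

Lemma joins_ends e k (r : side (is_quad k)) : joins e (corner r) (corner (r + 1)) ->
  edge_ends e = if (edge_ends e).1 == corner r then (corner r, corner (r + 1))
                else (corner (r + 1), corner r).
Proof.
move=> [] ee; rewrite ee /=; first by rewrite eqxx.
by case: eqP => // E; have := mesh_edge_ends hM e; rewrite ee /= E eqxx.
Qed.

Lemma edge_side e k (r : side (is_quad k)) t :
    joins e (corner r) (corner (r + 1)) ->
  edge_pt e t = param k (side_pt r (side_par r e t)).
Proof.
move=> /joins_ends ee; rewrite paramE shape_side /edge_pt /side_par ee.
case: ifP => _ //=; first by rewrite eqxx.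
case: eqP => [E|_]; last by rewrite subKr addrC.
by rewrite /cpt E -!scalerDl; congr (_ *: _); ring.
Qed.

Lemma edge_point k q e t : ref_elt (is_quad k) q -> 0 < t < 1 ->
    param k q = edge_pt e t ->
  exists2 r : side (is_quad k), joins e (corner r) (corner (r + 1)) &
    q = side_pt r (side_par r e t).
Proof.
move=> Kq t01 xe; have ce : cell (M := M) (inl (inr e)) (param k q).
  by rewrite xe; exists t => //=; rewrite in_itv.
have [Koq|nKo] := pselect (ref_eltO (is_quad k) q).
  have ck : cell (M := M) (inl (inl k)) (param k q) by rewrite /= eltE; exists q.
  by have := cell_inj ck ce.
have [r [s [s01 qE]]] := boundary_side Kq nKo.
move: ce; rewrite qE => ck; case: (side_cell r s01).
- move=> [_ [e' je' ex]]; have [ee'] := @cell_inj _ (inl (inr e')) _ ck ex.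
  subst e'; exists r => //; rewrite -qE; apply: param_inj => //.
    by apply: side_pt_in; rewrite /side_par; case: ifP => _; lra.
  by rewrite xe (edge_side t je').
- by move=> [_ ex]; have := @cell_inj _ (inr (corner r)) _ ck ex.
- by move=> [_ ex]; have := @cell_inj _ (inr (corner (r + 1))) _ ck ex.
Qed.

(** The closed elements cover the closure of the domain: what they leave out is
    open, hence covered by the edges and vertices, and an arc of a parabola
    meets every line in finitely many points only. *)
Lemma closure_Omega (n : edge_idx M -> plane R) :
    (forall e, unit_normal e (n e)) ->
  closure Omega = \bigcup_k (param k @` ref_elt (is_quad k)).
Proof.
move=> hn; apply/seteqP; split=> [x Ox|x [k _]]; last first.
  rewrite -closure_elt => xk.
  rewrite [closure Omega](closure_id _).1; last exact: closed_closure.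
  apply: closure_subset xk => y yk; rewrite (mesh_cover hM).
  by exists (inl (inl k)).
apply: contrapT => xC.
pose B := [set y | forall k, ~ (param k @` ref_elt (is_quad k)) y].
have nB : nbhs x B.
  apply: (@filter_forall _ _ (fun k => ~` (param k @` ref_elt (is_quad k))) (nbhs x)).
  move=> k; apply: open_nbhs_nbhs; split; last by move=> xk; apply: xC; exists k.
  by apply: closed_openC; rewrite param_shape; exact: (image_closed (regular k)).
have [a [Oa Ba]] := Ox _ (nbhs_interior nB).
have nOB : nbhs a (Omega `&` B).
  apply: filterI; last exact: Ba.
  by apply: open_nbhs_nbhs; split=> //; exact: (mesh_open hM).
have [eps eps0 ball_eps] := proj1 (@nbhs_normP _ _ a _) nOB.
pose h := eps / 2; have h0 : 0 < h by rewrite divr_gt0.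
pose y (s : R) : plane R := a + (h * s, h * s ^+ 2).
have yOB s : 0 < s < 1 -> Omega (y s) /\ B (y s).
  move=> /andP[s0 s1]; apply: ball_eps => /=.
  rewrite /y opprD addrA subrr sub0r normrN prod_normE gt_max /=.
  rewrite !ger0_norm ?mulr_ge0 ?exprn_ge0 ?ltW //.
  have he : h < eps by rewrite ltr_pdivrMr // ltr_pMr // ltr1n.
  have s2 : s ^+ 2 <= 1 by rewrite exprn_ile1 // ltW.
  by apply/andP; split; apply: le_lt_trans he; rewrite ger_pMr // ltW.
(* Along the arc these polynomials vanish at the points of the line of [e], and
   at those with the same abscissa as the vertex [i]. *)
pose Pe e : {poly R} := let V := vtx (edge_ends e).1 in
  ((n e).1 * (a.1 - V.1) + (n e).2 * (a.2 - V.2))%:P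
  + ((n e).1 * h)%:P * 'X + ((n e).2 * h)%:P * 'X ^+ 2.
pose Pv i : {poly R} := (a.1 - (vtx i).1)%:P + h%:P * 'X.
pose P := (\prod_e Pe e) * (\prod_i Pv i).
have P0 : P = 0.
  apply: poly_eq_on01 => s s01; rewrite horner0.
  have [Oy By] := yOB s s01.
  have : closure Omega (y s) by exact: subset_closure.
  rewrite (mesh_cover hM) => -[[[k|e]|i] _ /= cy].
  - case: (By k); rewrite eltE in cy.
    by apply: image_subset cy => q Kq r; exact: ltW.
  - have [t _ ty] := cy.
    suff Pe0 : (Pe e).[s] = 0.
      by rewrite /P (bigD1 e) //= !hornerM Pe0 !mul0r.
    have [_ nd] := hn e; rewrite /= in nd.
    have y1 : (1 - t) * (vtx (edge_ends e).1).1 + t * (vtx (edge_ends e).2).1 =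
      a.1 + h * s := congr1 (fun z : plane R => z.1) ty.
    have y2 : (1 - t) * (vtx (edge_ends e).1).2 + t * (vtx (edge_ends e).2).2 =
      a.2 + h * s ^+ 2 := congr1 (fun z : plane R => z.2) ty.
    rewrite /Pe !(hornerD, hornerM, hornerC, hornerX, horner_exp).
    move: nd y1 y2; move: (vtx (edge_ends e).1) (vtx (edge_ends e).2) (n e) => V V' m nd y1 y2.
    have -> : m.1 * (a.1 - V.1) + m.2 * (a.2 - V.2) + m.1 * h * s
        + m.2 * h * s ^+ 2
      = m.1 * (a.1 + h * s - V.1) + m.2 * (a.2 + h * s ^+ 2 - V.2) by ring.
    rewrite -y1 -y2 -[RHS](mulr0 t) -nd; ring.
  - suff Pv0 : (Pv i).[s] = 0.
      by rewrite /P (bigD1 i) //= !hornerM Pv0 mul0r mulr0.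
    have y1 : a.1 + h * s = (vtx i).1 := congr1 (fun z : plane R => z.1) cy.
    by rewrite /Pv !(hornerD, hornerM, hornerC, hornerX) -y1; ring.
move/eqP: P0; rewrite /P mulf_eq0 => /orP[] /prodf_eq0[j _ /eqP j0].
- have [nn _] := hn j.
  have n1 : (n j).1 = 0.
    have := congr1 (fun Q : {poly R} => Q`_1) j0.
    rewrite /Pe !coefD !coefCM coefX coefXn coefC coef0 /= mulr0 mulr1 addr0 add0r.
    by move/eqP; rewrite mulf_eq0 (gt_eqF h0) orbF => /eqP.
  have n2 : (n j).2 = 0.
    have := congr1 (fun Q : {poly R} => Q`_2) j0.
    rewrite /Pe !coefD !coefCM coefX coefXn coefC coef0 /= mulr0 mulr1 !add0r.
    by move/eqP; rewrite mulf_eq0 (gt_eqF h0) orbF => /eqP.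
  by move/eqP: nn; rewrite n1 n2 expr0n addr0 eq_sym oner_eq0.
- have := congr1 (fun Q : {poly R} => Q`_1) j0.
  rewrite /Pv coefD coefCM coefX coefC coef0 /= mulr1 add0r.
  by move/eqP; rewrite (gt_eqF h0).
Qed.

End Mesh.

(** ** Traces and twists on the sides *)

Section Traces.
Variable R : realType.
Implicit Types (P : {poly {poly R}}) (A B : {poly R}).

Lemma size_restr w n A B P : below w n P ->
  (size A <= w.1.+1)%N -> (size B <= w.2.+1)%N -> (size (restr A B P) <= n)%N.
Proof.
move=> degP szA szB; rewrite /restr.
rewrite (horner_coef_wide _ (size_poly _ _)) (leq_trans (size_sum _ _ _)) //.
apply/bigmax_leqP => j _; rewrite coef_map_id0 ?comp_poly0 // comp_polyE.
rewrite mulr_suml (leq_trans (size_sum _ _ _)) //.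
apply/bigmax_leqP => i _; rewrite -scalerAl.
have [le_n|lt_n] := leqP n (w.1 * i + w.2 * j)%N.
  by rewrite degP // scale0r size_poly0.
rewrite (leq_trans (size_scale_leq _ _)) // (leq_trans _ lt_n) //.
rewrite (mulnC w.1) (mulnC w.2).
by apply: size_leM; apply: size_leX.
Qed.

Lemma size_tr b (r : side b) n P : deg_lt b n P -> (size (tr r P) <= n)%N.
Proof.
have s1 : (size (1 - 'X : {poly R})%R <= 2)%N by rewrite size_1subX.
have sc : (size (1%R : {poly R}) <= 1)%N by rewrite size_poly1.
have sX : (size ('X : {poly R}) <= 2)%N by rewrite size_polyX.
have s0 m : (size (0%R : {poly R}) <= m)%N by rewrite size_poly0.
rewrite /tr; move: b r P; apply: side_ind => P degP; rewrite /spath /=.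
- by apply: (size_restr (degP (1, 1)%N _)).
- by apply: (size_restr (degP (1, 1)%N _)).
- by apply: (size_restr (degP (1, 1)%N _)).
- by apply: (size_restr (degP (1, 0)%N _)).
- by apply: (size_restr (degP (0, 1)%N _)).
- by apply: (size_restr (degP (1, 0)%N _)).
- by apply: (size_restr (degP (0, 1)%N _)).
Qed.

End Traces.

Section Twist.
Variable R : realType.

Lemma twist_mixed b (V : side b -> plane R) r :
  ((edir R r).1 * (tau R r).2 + (edir R r).2 * (tau R r).1) *: twist V 0 =
  twist V r.
Proof.
move: b r V; apply: side_ind => V; rewrite /edir /tau /=.
1-3: by rewrite /twist !scale0r scaler0.
- by rewrite mulr1 mul0r addr0 scale1r.
- rewrite -[in RHS](add0r (1 : side true)) twist_next.
  by congr (_ *: _); ring.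
- have -> : 2%:R = 0 + 1 + 1 :> side true by apply/val_inj.
  by rewrite !twist_next scalerA; congr (_ *: _); ring.
- have -> : 3%:R = 0 + 1 + 1 + 1 :> side true by apply/val_inj.
  by rewrite !twist_next !scalerA; congr (_ *: _); ring.
Qed.

Lemma edir_mixed b (V : side b -> plane R) (r : side b) :
  ((edir R r).1 * (edir R r).2 + (edir R r).2 * (edir R r).1) *: twist V 0 = 0.
Proof.
move: b r V; apply: side_ind => V; rewrite /edir /=.
1-3: by rewrite /twist !scale0r scaler0.
all: by rewrite -[RHS](scale0r (twist V 0)); congr (_ *: _); ring.
Qed.

Lemma jlin0 (S : jet R) : jlin S 0 = 0.
Proof. by rewrite /jlin !mul0r addr0. Qed.

End Twist.

(** * The interpolant *)
Section Interpolation.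
Variables (R : realType) (Omega : set (plane R)) (M : mesh_data R).
Variables (n : edge_idx M -> plane R).
Hypotheses (hM : is_mesh Omega M) (hn : forall e, unit_normal e (n e)).
Local Notation bipoly := {poly {poly R}}.
Implicit Types (k : elt_idx M) (e : edge_idx M) (i : vtx_idx M) (x q : plane R).
Implicit Types (S : jet R) (P : bipoly).

Definition edge_dir e : plane R := vtx (edge_ends e).2 - vtx (edge_ends e).1.

Lemma edge_dir_neq0 e : edge_dir e != 0.
Proof.
rewrite subr_eq0; apply/eqP => /(vtx_inj hM) E.
by have := mesh_edge_ends hM e; rewrite E eqxx.
Qed.

Lemma normal_unit e : dot (n e) (n e) = 1.
Proof. by have [nn _] := hn e; rewrite /dot -!expr2. Qed.
Lemma normal_orth e : dot (n e) (edge_dir e) = 0.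
Proof. by have [_ nd] := hn e. Qed.

(** Edge data follow the direction of the edge; a side may run the other way. *)
Definition orient k (r : side (is_quad k)) e (g : {poly R}) : {poly R} :=
  if (edge_ends e).1 == corner r then g else g \Po (1 - 'X).

Lemma orient_horner k (r : side (is_quad k)) e g t :
  (orient r e g).[t] = g.[side_par r e t].
Proof. by rewrite /orient /side_par; case: ifP; rewrite ?horner_flip. Qed.

Lemma side_parK k (r : side (is_quad k)) e : involutive (side_par r e : R -> R).
Proof. by move=> t; rewrite /side_par; case: (_ == _); rewrite // opprB addrC subrK. Qed.

Lemma side_par01 k (r : side (is_quad k)) e (t : R) :
  0 < side_par r e t < 1 = (0 < t < 1).
Proof.
by rewrite /side_par; case: ifP => // _; rewrite subr_gt0 ltrBlDl ltrDr andbC.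
Qed.

Section Side.
Variables (k : elt_idx M) (r : side (is_quad k)) (e : edge_idx M).
Hypothesis er : joins e (corner r) (corner (r + 1)).
Local Notation V := (@cpt R M k).
Let d1 := V (r + 1) - V r.

Definition side_sign : R := if (edge_ends e).1 == corner r then 1 else - 1.

Lemma side_dir : d1 = side_sign *: edge_dir e.
Proof.
rewrite /d1 /side_sign /edge_dir; have := joins_ends hM er.
by case: ifP => _ -> /=; rewrite ?scale1r // scaleN1r opprB.
Qed.

Lemma side_dir_neq0 : d1 != 0.
Proof.
rewrite side_dir scaler_eq0 negb_or edge_dir_neq0 andbT /side_sign.
by case: ifP; rewrite ?oppr_eq0 oner_eq0.
Qed.

Lemma side_dir_orth : dot (n e) d1 = 0.
Proof.
rewrite side_dir; have := normal_orth e; rewrite /dot !planeE.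
by move=> d0; rewrite -[RHS](mulr0 side_sign) -d0; ring.
Qed.

Lemma side_sign_sqr : side_sign * side_sign = 1.
Proof. by rewrite /side_sign; case: ifP; rewrite ?mulrNN mulr1. Qed.

Lemma orient_deriv g : (orient r e g)^`() = side_sign *: orient r e g^`().
Proof.
rewrite /orient /side_sign; case: ifP => _; first by rewrite scale1r.
by rewrite flip_deriv scaleN1r.
Qed.

Lemma size_orient (g : {poly R}) m : (size g <= m)%N -> (size (orient r e g) <= m)%N.
Proof.
by rewrite /orient; case: ifP => // _; apply: leq_trans; exact: size_flip.
Qed.

(** The data that the jets [S] at the vertices prescribe for the trace [g] on
    an edge, and for the normal derivative [g] of a function. *)
Definition edge_jet3 (S : vtx_idx M -> jet R) e g : Prop :=
  let Sa := S (edge_ends e).1 in let Sb := S (edge_ends e).2 in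
  let d := edge_dir e in
  jet3 g (j0 Sa, jlin Sa d, jquad Sa d d) (j0 Sb, jlin Sb d, jquad Sb d d).
Definition edge_jet2 (S : vtx_idx M -> jet R) e g : Prop :=
  let Sa := S (edge_ends e).1 in let Sb := S (edge_ends e).2 in
  let d := edge_dir e in
  jet2 g (jlin Sa (n e), jquad Sa d (n e)) (jlin Sb (n e), jquad Sb d (n e)).

(** Reversing the direction changes the sign of the odd derivatives only, on the
    edge as in the jets. *)
Lemma orient_jet3 (S : vtx_idx M -> jet R) g : edge_jet3 S e g ->
  let Sa := S (corner r) in let Sb := S (corner (r + 1)) in
  jet3 (orient r e g) (j0 Sa, jlin Sa d1, jquad Sa d1 d1)
    (j0 Sb, jlin Sb d1, jquad Sb d1 d1).
Proof.
rewrite /edge_jet3 /orient side_dir /side_sign.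
have := joins_ends hM er; case: ifP => _ -> /=; first by rewrite !scale1r.
move=> /jet3_flip /=; rewrite !jlinZ !jquadZ !(jquadC _ ((- 1) *: _)) !jquadZ.
by rewrite !mulN1r !opprK.
Qed.

Lemma orient_jet2 (S : vtx_idx M -> jet R) g : edge_jet2 S e g ->
  let Sa := S (corner r) in let Sb := S (corner (r + 1)) in
  jet2 (orient r e g) (jlin Sa (n e), jquad Sa d1 (n e))
    (jlin Sb (n e), jquad Sb d1 (n e)).
Proof.
rewrite /edge_jet2 /orient side_dir /side_sign.
have := joins_ends hM er; case: ifP => _ -> /=; first by rewrite !scale1r.
by move=> /jet2_flip /=; rewrite !(jquadC _ ((- 1) *: _)) !jquadZ !mulN1r
  !(jquadC _ (n e)).
Qed.

(** The transverse derivative of a function with trace [g] and normal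
    derivative [N] on the edge. *)
Definition transverse (g N : {poly R}) : {poly R} :=
  normal_coef V r (n e) * orient r e N
  + tangent_coef V r * (orient r e g)^`().

Lemma side_jet_data (S : vtx_idx M -> jet R) g N :
    edge_jet3 S e g -> edge_jet2 S e N ->
  side_jet (is_quad k) (local_jet V r (S (corner r)))
    (local_jet V (r + 1) (S (corner (r + 1))))
    (orient r e g) (transverse g N).
Proof.
move=> /orient_jet3 gj /orient_jet2 Nj; apply: side_jet_edge => //.
- exact: side_dir_neq0.
- exact: normal_unit.
- exact: side_dir_orth.
Qed.

Lemma det_edir_tau (b : bool) (s : side b) : det2 (edir R s) (tau R s) = 1.
Proof. by move: b s; apply: side_ind; rewrite /det2 /edir /tau /=; ring. Qed.

(** The reference directions along and across a side have determinant 1. *)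
Lemma side_det t : det2 d1 (V (r - 1) - V r + t *: twist V r) =
  jac (V 1 - V 0) (V (- 1) - V 0) (twist V 0) (side_pt r t).
Proof.
have detE (b c d q v w : plane R) : det2 (bilin_d b c d q v) (bilin_d b c d q w) =
    det2 v w * jac b c d q.
  rewrite /jac /bilin_d /det2 !planeE.
  by move: (bilin_u b d q) (bilin_v c d q) => u u'; ring.
by rewrite /d1 -(bilin_d_edir V r t) -bilin_d_tau detE det_edir_tau mul1r.
Qed.

Lemma side_det_neq0 t : 0 <= t <= 1 ->
  det2 d1 (V (r - 1) - V r + t *: twist V r) != 0.
Proof.
by move=> t01; rewrite side_det (reg_jac (regular hM k)) //; exact: side_pt_in.
Qed.

(** Otherwise the images of both reference directions would be tangent to the
    side. *)
Lemma normal_coef_neq0 t : 0 <= t <= 1 -> (normal_coef V r (n e)).[t] != 0.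
Proof.
move=> t01; apply: contraNneq (side_det_neq0 t01) => A0.
set w := _ + _; have nw : dot (n e) w = 0.
  rewrite -A0 /w /normal_coef; move: (twist V r) (V (r - 1) - V r) => z z'.
  by rewrite !(hornerD, hornerM, hornerC, hornerX) /dot !planeE; ring.
rewrite (ortho_expand side_dir_neq0 (normal_unit e) side_dir_orth w) nw scale0r.
by rewrite add0r -/d1 /det2 !planeE; apply/eqP; ring.
Qed.

(** The chain rule, with the transverse direction expanded as in
    [coef_horner]. *)
Lemma side_values P t S :
    chain_rule (V 1 - V 0) (V (- 1) - V 0) (twist V 0)
      P (side_pt r t) S ->
  [/\ (tr r P).[t] = j0 S, (tr r P)^`().[t] = jlin S d1,
      (td r P).[t] = (normal_coef V r (n e)).[t] * jlin S (n e)
        + (tangent_coef V r).[t] * jlin S d1,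
      (tr r P)^`()^`().[t] = jquad S d1 d1
    & (td r P)^`().[t] = jquad S d1 (V (r - 1) - V r + t *: twist V r)
        + jlin S (twist V r)].
Proof.
move=> S_P; have [D1 D2] := chain_rule_dir S_P; have [P0 _ _ _] := S_P.
have EE := coef_horner side_dir_neq0 (normal_unit e) side_dir_orth S t.
have DE : ev (side_pt r t) (dd (edir R r) (dd (edir R r) P)) = jquad S d1 d1.
  by rewrite D2 bilin_d_edir -/d1 -[RHS]addr0 -jlinZ edir_mixed jlin0.
have DT : ev (side_pt r t) (dd (edir R r) (dd (tau R r) P)) =
    jquad S d1 (V (r - 1) - V r + t *: twist V r) + jlin S (twist V r).
  by rewrite D2 bilin_d_edir bilin_d_tau -/d1 -jlinZ twist_mixed.
rewrite EE /td !deriv_tr !tr_horner P0 D1 bilin_d_edir.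
by split=> //; rewrite D1 bilin_d_tau.
Qed.

End Side.

Lemma joins_uniq e e' i j : joins e i j -> joins e' i j -> e = e'.
Proof.
have h01 : 0 < (2^-1 : R) < 1 by lra.
move=> /joins_edge/(_ h01) ex /joins_edge/(_ h01) ex'.
by have [] := @cell_inj _ _ _ hM (inl (inr e)) (inl (inr e')) _ ex ex'.
Qed.

(** By Cramer's rule all directions are combinations of [d1] and [d2]. *)
Lemma jet_eq S S' (d1 d2 : plane R) : det2 d1 d2 != 0 -> j0 S = j0 S' ->
    jlin S d1 = jlin S' d1 -> jlin S d2 = jlin S' d2 ->
    jquad S d1 d1 = jquad S' d1 d1 -> jquad S d1 d2 = jquad S' d1 d2 ->
    jquad S d2 d2 = jquad S' d2 d2 ->
  S = S'.
Proof.
move=> D0 S0 l1 l2 q11 q12 q22.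
have lE v : jlin S v = jlin S' v.
  by rewrite -(cramer_rule v D0) !jlinD !jlinZ l1 l2.
have q1E v : jquad S d1 v = jquad S' d1 v.
  by rewrite -(cramer_rule v D0) !jquadD !jquadZ q11 q12.
have q2E v : jquad S d2 v = jquad S' d2 v.
  by rewrite -(cramer_rule v D0) !jquadD !jquadZ q22 !(jquadC _ d2) q12.
have qE v w : jquad S v w = jquad S' v w.
  rewrite -(cramer_rule v D0) !(jquadC _ _ w) !jquadD !jquadZ.
  by rewrite !(jquadC _ w) q1E q2E.
move: (lE (1, 0)) (lE (0, 1)) (qE (1, 0) (1, 0)) (qE (1, 0) (0, 1)).
move: (qE (0, 1) (0, 1)); rewrite /jlin /jquad /=.
rewrite !(mul1r, mul0r, mulr0, mulr1, addr0, add0r).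
by case: S S' S0 {l1 l2 q11 q12 q22 lE q1E q2E qE} => ? ? ? ? ? ? [? ? ? ? ? ?] /=
  -> -> -> -> -> ->.
Qed.

Section EdgeData.
Variables (S : vtx_idx M -> jet R) (G N : edge_idx M -> {poly R}).
Hypotheses (GS : forall e, edge_jet3 S e (G e)).
Hypotheses (NS : forall e, edge_jet2 S e (N e)).

(** The polynomial [P] on the element [k] takes the value [G] and the normal
    derivative [N] on its edges. *)
Definition boundary_data k P : Prop :=
  forall (r : side (is_quad k)) e, joins e (corner r) (corner (r + 1)) ->
    tr r P = orient r e (G e) /\ td r P = transverse r e (G e) (N e).

Section OneElement.
Variables (k : elt_idx M) (P : bipoly).
Hypothesis bdP : boundary_data k P.
Local Notation V := (@cpt R M k).
Local Notation jet_at q T :=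
  (chain_rule (V 1 - V 0) (V (- 1) - V 0) (twist V 0) P q T).

(** The trace gives the value and the tangential derivative; the transverse
    derivative then gives the normal one, because [normal_coef] has no zero. *)
Lemma edge_values e q t T : ref_elt (is_quad k) q -> 0 < t < 1 ->
    param k q = edge_pt e t -> jet_at q T ->
  [/\ j0 T = (G e).[t], jlin T (edge_dir e) = (G e)^`().[t]
    & jlin T (n e) = (N e).[t]].
Proof.
move=> Kq t01 qe TP; have [r er qE] := edge_point hM Kq t01 qe.
rewrite qE in TP; have [t0 t1 h0 _ _] := side_values er TP.
have [trE tdE] := bdP er.
have t1' : jlin T (V (r + 1) - V r) = side_sign r e * (G e)^`().[t].
  by rewrite -t1 trE orient_deriv // hornerZ orient_horner side_parK.
have sq := side_sign_sqr r e.
split.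
- by rewrite -t0 trE orient_horner side_parK.
- rewrite -[LHS]mul1r -sq -mulrA -jlinZ -side_dir // t1' mulrA sq mul1r //.
- have A0 := normal_coef_neq0 er (_ : 0 <= side_par r e t <= 1).
  apply: (mulfI (A0 _)); first by have := side_par01 r e t; rewrite t01; lra.
  apply: (addIr ((tangent_coef V r).[side_par r e t] * jlin T (V (r + 1) - V r))).
  rewrite -h0 tdE /transverse hornerD !hornerM orient_horner side_parK -trE t1.
  by [].
Qed.

(** The sides [r] and [r - 1] together give the derivatives in two independent
    directions, and the transverse derivative on [r] gives the mixed one. *)
Lemma vertex_jet (r : side (is_quad k)) T : jet_at (side_pt r 0) T ->
  T = S (corner r).
Proof.
move=> TP; have [e er] := side_edge hM r; have [e' er'] := side_edge hM (r - 1).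
have [trE tdE] := bdP er; have [trE' _] := bdP er'.
have := side_jet_data er (GS e) (NS e).
rewrite -trE -tdE => -[[[g0 g1 g2] _] [[h0 h1] _]].
have [t0 t1 t2 t3 t4] := side_values er TP.
have EE := coef_horner (side_dir_neq0 er) (normal_unit e) (side_dir_orth er) T 0.
rewrite t2 EE in h0; rewrite t4 in h1; rewrite t0 in g0; rewrite t1 in g1.
rewrite t3 in g2; move: g0 g1 g2 h0 h1 => /= g0 g1 g2; rewrite scale0r addr0 => h0.
have h00 : 0 <= (0 : R) <= 1 by rewrite lexx ler01.
have D0 : det2 (V (r + 1) - V r) (V (r - 1) - V r) != 0.
  by have := side_det_neq0 r h00; rewrite scale0r addr0.
have lt : jlin T (twist V r) = jlin (S (corner r)) (twist V r).
  by rewrite -(cramer_rule (twist V r) D0) !jlinD !jlinZ g1 h0.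
rewrite lt => /addIr h1.
have TP' : jet_at (side_pt (r - 1) 1) T by rewrite side_pt_end subrK.
have [_ _ _ t3' _] := side_values er' TP'.
have := side_jet_data er' (GS e') (NS e').
rewrite -trE' => -[[_ [_ _ g2']] _]; rewrite t3' in g2'.
apply: (jet_eq D0) => //.
move: g2' => /=; rewrite !subrK.
have -> : V r - V (r - 1) = (- 1) *: (V (r - 1) - V r) by rewrite scaleN1r opprB.
by rewrite !jquadZ !(jquadC _ ((- 1) *: _)) !jquadZ !mulN1r !opprK.
Qed.

End OneElement.
End EdgeData.
End Interpolation.

(** ** Gluing *)

(** The derivative of order [(a, b)] recorded by a jet, for [a + b <= 2]. *)
Definition jet_entry (R : realType) (S : jet R) (a b : nat) : R :=
  (match a, b with
   | 0, 0 => j0 S | 1, 0 => jx S | 0, 1 => jy S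
   | 2, 0 => jxx S | 1, 1 => jxy S | _, _ => jyy S end)%N.

Lemma order2_ind (Q : nat -> nat -> Prop) :
    Q 0%N 0%N -> Q 1%N 0%N -> Q 0%N 1%N -> Q 2%N 0%N -> Q 1%N 1%N -> Q 0%N 2%N ->
  forall a b, (a + b <= 2)%N -> Q a b.
Proof. by move=> ? ? ? ? ? ? [|[|[|a]]] [|[|[|b]]]; rewrite ?addnS ?addSn. Qed.

Section Glue.
Variables (R : realType) (Omega : set (plane R)) (M : mesh_data R).
Variables (n : edge_idx M -> plane R).
Hypotheses (hM : is_mesh Omega M) (hn : forall e, unit_normal e (n e)).
Local Notation bipoly := {poly {poly R}}.
Implicit Types (k : elt_idx M) (e : edge_idx M) (i : vtx_idx M) (x q : plane R).
Variables (S : vtx_idx M -> jet R) (G N : edge_idx M -> {poly R}).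
Hypotheses (GS : forall e, edge_jet3 S e (G e)).
Hypotheses (NS : forall e, edge_jet2 n S e (N e)).
Variable P : elt_idx M -> bipoly.
Hypothesis bdP : forall k, boundary_data n G N k (P k).

Definition elt_jet k q : jet R :=
  transported_jet (cpt (1 : side (is_quad k)) - cpt (0 : side (is_quad k)))
    (cpt (- 1 : side (is_quad k)) - cpt (0 : side (is_quad k)))
    (twist (@cpt R M k) 0) (P k) q.

Lemma elt_jet_chain k q : ref_elt (is_quad k) q ->
  chain_rule (@cpt R M k 1 - @cpt R M k 0) (@cpt R M k (- 1) - @cpt R M k 0)
    (twist (@cpt R M k) 0) (P k) q (elt_jet k q).
Proof. exact: (transported_chain (regular hM k)). Qed.

Lemma elt_jet0 k q : j0 (elt_jet k q) = ev q (P k).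
Proof. by []. Qed.

Lemma elt_jet_edge k q e t : ref_elt (is_quad k) q -> 0 < t < 1 ->
    param k q = edge_pt e t ->
  [/\ j0 (elt_jet k q) = (G e).[t], jlin (elt_jet k q) (edge_dir e) = (G e)^`().[t]
    & jlin (elt_jet k q) (n e) = (N e).[t]].
Proof.
move=> Kq t01 qe.
exact: (edge_values hM hn (@bdP k) Kq t01 qe (elt_jet_chain Kq)).
Qed.

Lemma elt_jet_vtx k q i : ref_elt (is_quad k) q -> param k q = vtx i ->
  elt_jet k q = S i.
Proof.
move=> Kq qi; have [r qE ->] := vtx_point hM Kq qi.
apply: (vertex_jet hM hn GS NS (@bdP k)); rewrite -qE.
exact: elt_jet_chain.
Qed.

(** On an edge the gradient has the tangential component [G'] and the normal
    component [N] for every element; at a vertex even the whole jet is given. *)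
Lemma elt_jet_agree k q k' q' : ref_elt (is_quad k) q -> ref_elt (is_quad k') q' ->
    param k q = param k' q' ->
  j0 (elt_jet k q) = j0 (elt_jet k' q') /\
  forall v, jlin (elt_jet k q) v = jlin (elt_jet k' q') v.
Proof.
move=> Kq Kq' qq'.
have : closure Omega (param k q).
  by rewrite (closure_Omega hM hn); exists k => //; exists q.
rewrite (mesh_cover hM) => -[[[k0|e]|i] _ /= cx].
- have [E _] := elt_point hM Kq cx.
  have [E' _] := elt_point hM Kq' (eq_ind _ (elt k0) cx _ qq').
  move: q q' Kq Kq' qq' cx; rewrite E E' => q q' Kq Kq' qq' _.
  by have -> := param_inj hM Kq Kq' qq'.
- have [t t01 te] := cx; rewrite /= in_itv /= in t01.
  have [a0 a1 a2] := elt_jet_edge Kq t01 (esym te).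
  have [b0 b1 b2] := elt_jet_edge Kq' t01 (etrans (esym qq') (esym te)).
  split=> [|v]; first exact: (etrans a0 (esym b0)).
  have dn := edge_dir_neq0 hM e.
  have ex T := jlin_ortho dn (normal_unit hn e) (normal_orth hn e) T v.
  by rewrite (ex (elt_jet k q)) (ex (elt_jet k' q')) a1 a2 b1 b2.
- have E := elt_jet_vtx Kq cx; have E' := elt_jet_vtx Kq' (etrans (esym qq') cx).
  split=> [|v]; last by rewrite E E'.
  exact: (etrans (congr1 (@j0 R) E) (esym (congr1 (@j0 R) E'))).
Qed.

(** Well defined by [elt_jet_agree]: elements agree at the points they share. *)
Definition glued x : R :=
  xget 0 [set z | exists k q,
    [/\ ref_elt (is_quad k) q, param k q = x & z = ev q (P k)]].

Lemma gluedE k q : ref_elt (is_quad k) q -> glued (param k q) = ev q (P k).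
Proof.
move=> Kq; rewrite /glued; case: xgetP => [z _ [k' [q' [Kq' qq' ->]]]|].
  have [E _] := elt_jet_agree Kq' Kq qq'.
  by rewrite !elt_jet0 in E.
by move=> /(_ (ev q (P k))) []; exists k, q.
Qed.

Lemma ref_eltO_sub (b : bool) : @ref_eltO R b `<=` ref_elt b.
Proof. by move=> q Kq r; exact: ltW. Qed.

Lemma gluedO k q : ref_eltO (is_quad k) q ->
  glued (elt_map (@cpt R M k) q) = ev q (P k).
Proof. by move=> /ref_eltO_sub Kq; rewrite -gluedE // paramE. Qed.

Lemma glued_limit k q : ref_elt (is_quad k) q ->
  limit_jet (elt k) glued (param k q) (elt_jet k q).
Proof.
move=> Kq; rewrite (eltE hM) param_shape.
exact: (transported_limit_jet (regular hM k) (@gluedO k)).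
Qed.

Lemma glued_diff k x : elt k x ->
  differentiable glued x /\ forall v, differentiable ('D_v glued) x.
Proof.
rewrite (eltE hM) param_shape => -[q Koq <-].
have [d1 _] := transported_grad (regular hM k) (@gluedO k) Koq.
split=> // v.
by have [] := transported_hess (regular hM k) (@gluedO k) v Koq.
Qed.

Lemma closure_elt_point k x : closure (elt k) x ->
  exists2 q, ref_elt (is_quad k) q & param k q = x.
Proof. by rewrite (closure_elt hM) => -[q Kq qx]; exists q. Qed.

Lemma glued_mesh_limit v k q : ref_elt (is_quad k) q ->
  mesh_limit M ('D_v glued) (param k q) (jlin (elt_jet k q) v).
Proof.
move=> Kq k' /closure_elt_point[q' Kq' qq'].
have [_ E] := elt_jet_agree Kq Kq' (esym qq').
by rewrite E -qq'; exact: (lim_jlin (glued_limit Kq')).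
Qed.

Lemma glued_vtx i a b : (a + b <= 2)%N ->
  mesh_limit M (Dxy a b glued) (vtx i)
    (jet_entry (S i) a b).
Proof.
move=> ab k /closure_elt_point[q Kq qi].
have := glued_limit Kq; rewrite qi (elt_jet_vtx Kq qi) => -[L0 L1 Lxx Lxy Lyy].
move: a b ab; apply: order2_ind.
- exact: L0.
- by have := L1 (1, 0); rewrite /jlin mul0r mul1r addr0; apply.
- by have := L1 (0, 1); rewrite /jlin mul0r mul1r add0r; apply.
- exact: Lxx.
- exact: Lxy.
- exact: Lyy.
Qed.

(** The closed elements are finitely many closed sets that cover the closure of
    the domain, and the function is continuous on each of them. *)
Lemma glued_continuous : {within closure Omega, continuous glued}.
Proof.
apply/subspace_continuousP => x.
rewrite (closure_Omega hM hn) => xO.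
apply/cvgrPdist_lt => eps eps0; rewrite near_withinE.
have : \forall y \near x, forall k, (param k @` ref_elt (is_quad k)) y ->
    `|glued x - glued y| < eps.
  apply: (@filter_forall _ _ (fun k => [set y | (param k @` ref_elt (is_quad k)) y ->
    `|glued x - glued y| < eps]) (nbhs x)) => k.
  have [[q Kq qx]|xk] := pselect ((param k @` ref_elt (is_quad k)) x).
    have c : glued y @[y --> within (param k @` ref_elt (is_quad k)) (nbhs x)] -->
        glued x.
      rewrite -qx (gluedE Kq) param_shape.
      apply: (transport_cvg (regular hM k) (r := fun q => ev q (P k))) => //.
        by move=> q' Kq'; rewrite -gluedE // paramE.
      exact: continuous_ev.
    by move/cvgrPdist_lt: c => /(_ _ eps0); rewrite near_withinE.
  have nx : nbhs x (~` (param k @` ref_elt (is_quad k))).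
    apply: open_nbhs_nbhs; split=> //; apply: closed_openC.
    by rewrite param_shape; exact: (image_closed (regular hM k)).
  by apply: filterS nx => y ny yk; case: ny.
by apply: filterS => y H [k _ yk]; exact: (H k).
Qed.

Lemma glued_C1 : C1_closure Omega M glued.
Proof.
split; first exact: glued_continuous.
  by move=> k x /glued_diff[].
move=> v x; rewrite (closure_Omega hM hn) => -[k _ [q Kq <-]].
by exists (jlin (elt_jet k q) v); exact: glued_mesh_limit.
Qed.

Lemma glued_C2 i : C2_at M glued (vtx i).
Proof.
split=> [k _|a b ab].
  by rewrite near_withinE; apply: filterE => y /glued_diff.
by eexists; exact: glued_vtx.
Qed.

Lemma edge_pt_closure e t : 0 < t < 1 ->
  exists k q, ref_elt (is_quad k) q /\ param k q = edge_pt e t.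
Proof.
move=> t01; have : closure Omega (edge_pt e t).
  rewrite (mesh_cover hM); exists (inl (inr e)) => //.
  by exists t => //; rewrite /= in_itv.
by rewrite (closure_Omega hM hn) => -[k _ [q Kq qe]]; exists k, q.
Qed.

Lemma glued_normal e t : 0 < t < 1 ->
  mesh_limit M ('D_(n e) glued) (edge_pt e t) (N e).[t].
Proof.
move=> t01; have [k [q [Kq qe]]] := edge_pt_closure e t01.
by have [_ _ <-] := elt_jet_edge Kq t01 qe; rewrite -qe; exact: glued_mesh_limit.
Qed.

Lemma glued_edge e t : 0 < t < 1 -> glued (edge_pt e t) = (G e).[t].
Proof.
move=> t01; have [k [q [Kq qe]]] := edge_pt_closure e t01.
by have [<- _ _] := elt_jet_edge Kq t01 qe; rewrite -qe gluedE.
Qed.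

Lemma glued_argyris p : (forall k, deg_lt (is_quad k) p.+1 (P k)) ->
  (forall e, size (N e) <= p)%N -> argyris Omega n p glued.
Proof.
move=> degP szN; split.
- exact: glued_C1.
- move=> i; exists (fun q => ev q (P (inl i))).
    by apply/(poly_spaceP false); exists (P (inl i)) => //; exact: (degP (inl i)).
  move=> q Kq; apply: (@gluedE (inl i)).
  by rewrite -(ref_domE (inl i)).
- move=> i; exists (fun q => ev q (P (inr i))).
    by apply/(poly_spaceP true); exists (P (inr i)) => //; exact: (degP (inr i)).
  move=> q Kq; apply: (@gluedE (inr i)).
  by rewrite -(ref_domE (inr i)).
- exact: glued_C2.
- by move=> e; exists (N e) => // t t01; exact: glued_normal.
Qed.

End Glue.

(** ** Uniqueness *)

Section Uniqueness.
Variables (R : realType) (Omega : set (plane R)) (M : mesh_data R).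
Variables (n : edge_idx M -> plane R).
Hypotheses (hM : is_mesh Omega M) (hn : forall e, unit_normal e (n e)).
Local Notation bipoly := {poly {poly R}}.
Implicit Types (k : elt_idx M) (e : edge_idx M) (i : vtx_idx M) (x q : plane R).
Variables (S : vtx_idx M -> jet R) (G N : edge_idx M -> {poly R}).
Hypotheses (GS : forall e, edge_jet3 S e (G e)).
Hypotheses (NS : forall e, edge_jet2 n S e (N e)).

Lemma jet_ext (A B : jet R) : j0 A = j0 B -> jx A = jx B -> jy A = jy B ->
  jxx A = jxx B -> jxy A = jxy B -> jyy A = jyy B -> A = B.
Proof. by case: A B => ? ? ? ? ? ? [? ? ? ? ? ?] /= -> -> -> -> -> ->. Qed.

Lemma jlin_e1 (A : jet R) : jlin A (1, 0) = jx A.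
Proof. by rewrite /jlin /= mul1r mul0r addr0. Qed.
Lemma jlin_e2 (A : jet R) : jlin A (0, 1) = jy A.
Proof. by rewrite /jlin /= mul1r mul0r add0r. Qed.

(** The filter of the neighbourhoods within an element is proper at the points
    of its closure. *)
Lemma limit_unique (A : set (plane R)) (f : plane R -> R) x (a b : R) :
    closure A x -> f y @[y --> within A (nbhs x)] --> a ->
    f y @[y --> within A (nbhs x)] --> b ->
  a = b.
Proof.
move=> Ax fa fb.
have FF : ProperFilter (within A (nbhs x)).
  apply: Build_ProperFilter => H.
  by have [y [Ay ny]] := Ax _ H; exact: ny Ay.
by apply: (cvg_unique _ fa fb); exact: norm_hausdorff.
Qed.

Variables (p : nat) (hp : (5 <= p)%N).
Variables (tR : edge_idx M -> 'I_(p - 5) -> R) (tS : edge_idx M -> 'I_(p - 4) -> R).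
Hypotheses (tR_inj : forall e, injective (tR e)) (tS_inj : forall e, injective (tS e)).
Hypotheses (tR01 : forall e l, 0 < tR e l < 1) (tS01 : forall e l, 0 < tS e l < 1).
Hypotheses (szG : forall e, (size (G e) <= p.+1)%N).
Hypotheses (szN : forall e, (size (N e) <= p)%N).

Variable psi : plane R -> R.
Hypothesis psi_vtx : forall i a b, (a + b <= 2)%N ->
  mesh_limit M (Dxy a b psi) (vtx i) (jet_entry (S i) a b).
Hypothesis psi_normal : forall e, exists2 f : {poly R}, (size f <= p)%N &
  forall t, 0 < t < 1 -> mesh_limit M ('D_(n e) psi) (edge_pt e t) f.[t].
Hypothesis psi_R : forall e l, psi (edge_pt e (tR e l)) = (G e).[tR e l].
Hypothesis psi_S : forall e l,
  mesh_limit M ('D_(n e) psi) (edge_pt e (tS e l)) (N e).[tS e l].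

Section OnElement.
Variables (k : elt_idx M) (Q : bipoly).
Hypothesis degQ : deg_lt (is_quad k) p.+1 Q.
Hypothesis psiQ : forall q, ref_elt (is_quad k) q -> psi (param k q) = ev q Q.
Local Notation V := (@cpt R M k).

Let T q := transported_jet (V 1 - V 0) (V (- 1) - V 0) (twist V 0) Q q.

Let T_chain q : ref_elt (is_quad k) q ->
  chain_rule (V 1 - V 0) (V (- 1) - V 0) (twist V 0) Q q (T q).
Proof. exact: (transported_chain (regular hM k)). Qed.

Let T_limit q : ref_elt (is_quad k) q -> limit_jet (elt k) psi (param k q) (T q).
Proof.
move=> Kq; rewrite (eltE hM) param_shape.
apply: (transported_limit_jet (regular hM k)) => // q' /ref_eltO_sub Kq'.
by rewrite -psiQ // paramE.
Qed.

Let elt_closure q : ref_elt (is_quad k) q -> closure (elt k) (param k q).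
Proof. by move=> Kq; rewrite (closure_elt hM); exists q. Qed.

Let T_vtx (r : side (is_quad k)) : T (side_pt r 0) = S (corner r).
Proof.
have h0 : 0 <= (0 : R) <= 1 by rewrite lexx ler01.
have Kq := side_pt_in r h0; have cl := elt_closure Kq.
have [L0 L1 Lxx Lxy Lyy] := T_limit Kq.
have lim a b c : (a + b <= 2)%N ->
    Dxy a b psi y @[y --> within (elt k) (nbhs (param k (side_pt r 0)))] --> c ->
    c = jet_entry (S (corner r)) a b.
  move=> ab Lc; have cl' := cl; rewrite side_pt0 in cl'.
  apply: (limit_unique cl Lc).
  by have := @psi_vtx (corner r) a b ab k cl'; rewrite -{1}side_pt0.
apply: jet_ext.
- exact: (lim 0%N 0%N _ isT L0).
- by rewrite -jlin_e1; exact: (lim 1%N 0%N _ isT (L1 (1, 0))).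
- by rewrite -jlin_e2; exact: (lim 0%N 1%N _ isT (L1 (0, 1))).
- exact: (lim 2%N 0%N _ isT Lxx).
- exact: (lim 1%N 1%N _ isT Lxy).
- exact: (lim 0%N 2%N _ isT Lyy).
Qed.

Let T_end (r : side (is_quad k)) : T (side_pt r 1) = S (corner (r + 1)).
Proof. by rewrite side_pt_end T_vtx. Qed.

Let side_par_inj (r : side (is_quad k)) e (m : nat) (t : 'I_m -> R) :
  injective t -> injective (fun l => side_par r e (t l)).
Proof.
by move=> ti l l' /(congr1 (side_par r e)); rewrite !side_parK => /ti.
Qed.

(** The vertex conditions give the end jets of the trace, and the edge
    conditions its inner values. *)
Let trace_eq (r : side (is_quad k)) e : joins e (corner r) (corner (r + 1)) ->
  tr r Q = orient r e (G e).
Proof.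
move=> er.
have h0 : 0 <= (0 : R) <= 1 by rewrite lexx ler01.
have h1 : 0 <= (1 : R) <= 1 by rewrite lexx ler01.
have [a0 a1 _ a2 _] := side_values hM hn er (T_chain (side_pt_in r h0)).
have [b0 b1 _ b2 _] := side_values hM hn er (T_chain (side_pt_in r h1)).
rewrite T_vtx in a0 a1 a2; rewrite T_end in b0 b1 b2.
have p56 : (p.+1 = p - 5 + 6)%N by lia.
have ti := @side_par_inj r e _ _ (@tR_inj e).
apply: (hermite3_unique ti _ _ _ _ (orient_jet3 hM er (GS e))).
- by move=> l; rewrite side_par01.
- by rewrite -p56; exact: size_tr.
- by rewrite -p56; exact: size_orient.
- by split; split; [exact: a0|exact: a1|exact: a2|exact: b0|exact: b1|exact: b2].
- move=> l; rewrite orient_horner side_parK tr_horner.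
  rewrite -psiQ; first by rewrite -(edge_side hM _ er) psi_R.
  by apply: side_pt_in; have := side_par01 r e (tR e l); rewrite tR01; lra.
Qed.

(** The normal derivative [f] of [psi] need not be [N] a priori.  Both yield
    transverse derivatives with the same value and derivative at the two ends,
    and [normal_coef] does not vanish there; so [f] and [N] have the same end
    jets and, by the edge conditions, the same inner values. *)
Let transverse_eq (r : side (is_quad k)) e :
  joins e (corner r) (corner (r + 1)) ->
  td r Q = transverse n r e (G e) (N e).
Proof.
move=> er; have trE := trace_eq er; have [f szf fE] := psi_normal e.
set A := normal_coef V r (n e); set B := tangent_coef V r.
have h0 : 0 <= (0 : R) <= 1 by rewrite lexx ler01.
have h1 : 0 <= (1 : R) <= 1 by rewrite lexx ler01.
have normal t c : 0 < t < 1 -> mesh_limit M ('D_(n e) psi) (edge_pt e t) c ->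
    c = jlin (T (side_pt r (side_par r e t))) (n e).
  move=> t01 Lc; have t01' : 0 <= side_par r e t <= 1.
    by have := side_par01 r e t; rewrite t01; lra.
  have Kq := side_pt_in r t01'; have cl := elt_closure Kq.
  have := Lc k; rewrite (edge_side hM t er) => /(_ cl) Lc'.
  exact: (limit_unique cl Lc' (lim_jlin (T_limit Kq) (v := n e))).
(* [f] is the normal derivative inside the side, hence as a polynomial. *)
have tdE : td r Q = A * orient r e f + B * (tr r Q)^`().
  apply: poly_eq_on01 => t t01.
  have t01' : 0 < side_par r e t < 1 by rewrite side_par01.
  have t01w : 0 <= t <= 1 by lra.
  have [_ c1 -> _ _] := side_values hM hn er (T_chain (side_pt_in r t01w)).
  rewrite [in RHS]hornerD [in RHS]hornerM [X in _ = _ + X]hornerM.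
  rewrite orient_horner -c1.
  by rewrite (normal _ _ t01' (fE _ t01')) side_parK.
pose D := orient r e f - orient r e (N e).
have AD : A * D = td r Q - transverse n r e (G e) (N e).
  by rewrite tdE trE /D /transverse -/A -/B; ring.
have [N0 N1] := orient_jet2 hM er (NS e).
have D_end t Se : 0 <= t <= 1 -> T (side_pt r t) = Se ->
    (orient r e (N e)).[t] = jlin Se (n e) ->
    (orient r e (N e))^`().[t] = jquad Se (V (r + 1) - V r) (n e) ->
    D.[t] = 0 /\ D^`().[t] = 0.
  move=> t01 TS n0 n1; have A0 := normal_coef_neq0 hM hn er t01.
  have [_ c1 c2 c3 c4] := side_values hM hn er (T_chain (side_pt_in r t01)).
  rewrite TS trE in c1 c2 c3 c4.
  have d0 := side_dir_neq0 hM er.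
  have v := side_val d0 (normal_unit hn e) (side_dir_orth hM hn er) c1 n0.
  have w := side_der d0 (normal_unit hn e) (side_dir_orth hM hn er) c1 c3 n0 n1.
  rewrite (coef_horner d0 (normal_unit hn e) (side_dir_orth hM hn er)) in c2.
  have AD0 : (A * D).[t] = 0 by rewrite AD hornerD hornerN c2 v subrr.
  have AD1 : (A * D)^`().[t] = 0.
    rewrite AD derivB hornerD hornerN c4 w.
    by rewrite [X in X - _]addrC subrr.
  have D0 : D.[t] = 0.
    by move/eqP: AD0; rewrite hornerM mulf_eq0 (negPf A0) => /eqP.
  split=> //; move/eqP: AD1; rewrite derivM hornerD !hornerM D0 mulr0 add0r.
  by rewrite mulf_eq0 (negPf A0) => /eqP.
have [D00 D01] := D_end 0 _ h0 (T_vtx r) N0.1 N0.2.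
have [D10 D11] := D_end 1 _ h1 (T_end r) N1.1 N1.2.
have p44 : (p = p - 4 + 4)%N by lia.
suff D0 : D = 0.
  by apply/eqP; rewrite -subr_eq0 -AD D0 mulr0.
apply: (hermite2_unique (a := (0, 0)) (b := (0, 0))
  (@side_par_inj r e _ _ (@tS_inj e))).
- by move=> l; rewrite side_par01.
- rewrite -p44; apply: size_leD; first exact: size_orient.
  by rewrite size_polyN; exact: size_orient.
- by rewrite size_poly0.
- by [].
- by rewrite /jet2 deriv0 !horner0.
- move=> l; rewrite horner0 hornerD hornerN !orient_horner side_parK.
  by rewrite (normal _ _ (tS01 e l) (fE _ (tS01 e l)))
    (normal _ _ (tS01 e l) (@psi_S e l)) subrr.
Qed.

Lemma psi_boundary : boundary_data n G N k Q.
Proof. by move=> r e er; split; [exact: trace_eq|exact: transverse_eq]. Qed.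

End OnElement.
End Uniqueness.

(** ** Existence of the edge and element polynomials *)

Section SideSizes.
Variables (R : realType) (b : bool) (V : side b -> plane R) (r : side b).

(** The twist vanishes on triangles. *)
Lemma size_twist (v : plane R) (x k : R) :
  (size (x%:P + (dot v (twist V r) * k)%:P * 'X : {poly R})%R <= b.+1)%N.
Proof.
case: b V r => V' r'; first exact: size_affine.
have -> : dot v (twist V' r') = 0.
  by rewrite /twist mulr0n scale0r /dot !mulr0 addr0.
by rewrite mul0r polyC0 mul0r addr0; exact: size_polyC_leq1.
Qed.

Lemma size_normal_coef (n : plane R) : (size (normal_coef V r n) <= b.+1)%N.
Proof. by rewrite /normal_coef -[dot n (twist _ _)]mulr1; exact: size_twist. Qed.

Lemma size_tangent_coef : (size (tangent_coef V r) <= b.+1)%N.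
Proof. exact: size_twist. Qed.

End SideSizes.

Section Existence.
Variables (R : realType) (Omega : set (plane R)) (M : mesh_data R).
Variables (n : edge_idx M -> plane R).
Hypotheses (hM : is_mesh Omega M) (hn : forall e, unit_normal e (n e)).
Variables (S : vtx_idx M -> jet R) (p : nat).
Hypothesis hp : (5 <= p)%N.

Lemma size_transverse (k : elt_idx M) (r : side (is_quad k)) e (g N : {poly R}) :
    (size g <= p.+1)%N -> (size N <= p)%N ->
  (size (transverse n r e g N) <= p + is_quad k)%N.
Proof.
move=> szg szN; have pE : (p + is_quad k = (is_quad k + p.-1).+1)%N by lia.
rewrite pE; apply: size_leD; apply: size_leM.
- exact: size_normal_coef.
- by rewrite prednK; [exact: size_orient|lia].
- exact: size_tangent_coef.
- rewrite prednK; last by lia.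
  have [->|g0] := eqVneq (orient r e g) 0; first by rewrite deriv0 size_poly0.
  by rewrite -ltnS (leq_trans (lt_size_deriv g0)) // size_orient.
Qed.

Lemma edge_params m (pt : edge_idx M -> 'I_m -> plane R) :
    (forall e, injective (pt e) /\ forall l, edge e (pt e l)) ->
  exists t : edge_idx M -> 'I_m -> R,
  [/\ forall e, injective (t e), forall e l, 0 < t e l < 1
    & forall e l, pt e l = edge_pt e (t e l)].
Proof.
move=> ptP.
have /choice[t tP] : forall el : edge_idx M * 'I_m, exists t : R,
    0 < t < 1 /\ pt el.1 el.2 = edge_pt el.1 t.
  move=> [e l] /=; have [_ /(_ l)[t t01 <-]] := ptP e.
  by exists t; rewrite /= in_itv /= in t01.
exists (fun e l => t (e, l)); split=> [e l l' tE|e l|e l].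
- have [inj _] := ptP e; apply: inj.
  by rewrite (tP (e, l)).2 (tP (e, l')).2 /= tE.
- exact: (tP (e, l)).1.
- exact: (tP (e, l)).2.
Qed.

Lemma edge_traces (t v : edge_idx M -> 'I_(p - 5) -> R) :
    (forall e, injective (t e)) -> (forall e l, 0 < t e l < 1) ->
  exists G : edge_idx M -> {poly R}, forall e,
  [/\ (size (G e) <= p.+1)%N, edge_jet3 S e (G e) & forall l, (G e).[t e l] = v e l].
Proof.
move=> t_inj t01; have pE : (p.+1 = p - 5 + 6)%N by lia.
have /choice[G GP] : forall e, exists g : {poly R},
    [/\ (size g <= p.+1)%N, edge_jet3 S e g & forall l, g.[t e l] = v e l].
  by move=> e; rewrite pE; exact: hermite3.
by exists G.
Qed.

Lemma edge_normals (t v : edge_idx M -> 'I_(p - 4) -> R) :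
    (forall e, injective (t e)) -> (forall e l, 0 < t e l < 1) ->
  exists N : edge_idx M -> {poly R}, forall e,
  [/\ (size (N e) <= p)%N, edge_jet2 n S e (N e) & forall l, (N e).[t e l] = v e l].
Proof.
move=> t_inj t01; have pE : (p = p - 4 + 4)%N by lia.
have /choice[N NP] : forall e, exists g : {poly R},
    [/\ (size g <= p)%N, edge_jet2 n S e g & forall l, g.[t e l] = v e l].
  move=> e; have h a b : exists g : {poly R},
      [/\ (size g <= p)%N, jet2 g a b & forall l, g.[t e l] = v e l].
    have := @hermite2 R (p - 4) (t e) (v e) a b (t_inj e) (t01 e).
    by rewrite -pE.
  exact: h.
by exists N.
Qed.

(** The edge data of the sides of an element are compatible by [side_jet_data],
    so [local_exists] applies to each element. *)
Lemma elt_exists (G N : edge_idx M -> {poly R})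
    (pts : forall k : elt_idx M, pt_idx (is_quad k) p -> plane R)
    (v : forall k : elt_idx M, pt_idx (is_quad k) p -> R) :
    (forall k, unisolvent (pts k) (@inner_space R (is_quad k) p)) ->
    (forall e, size (G e) <= p.+1)%N -> (forall e, edge_jet3 S e (G e)) ->
    (forall e, size (N e) <= p)%N -> (forall e, edge_jet2 n S e (N e)) ->
  exists P : elt_idx M -> {poly {poly R}}, forall k,
  [/\ deg_lt (is_quad k) p.+1 (P k), boundary_data n G N k (P k)
    & forall l, ev (pts k l) (P k) = v k l].
Proof.
move=> uni szG GS szN NS.
suff /choice[P PP] : forall k, exists P, [/\ deg_lt (is_quad k) p.+1 P,
    boundary_data n G N k P & forall l, ev (pts k l) P = v k l] by exists P.
move=> k; have /choice[ed edP] := @side_edge _ _ _ hM k.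
have [||r|P [degP bdP ptsP]] := @local_exists R (is_quad k) p
    (fun r => local_jet (@cpt R M k) r (S (corner r)))
    (fun r => orient r (ed r) (G (ed r)))
    (fun r => transverse n r (ed r) (G (ed r)) (N (ed r))) (pts k) (v k) hp (uni k).
- by move=> r; apply: size_orient.
- by move=> r; apply: size_transverse.
- exact: (side_jet_data hM hn (edP r) (GS _) (NS _)).
exists P; split=> // r e er.
by rewrite (joins_uniq hM er (edP r)); exact: bdP.
Qed.

Lemma argyris_elt psi : argyris Omega n p psi -> forall k : elt_idx M,
  exists2 Q, deg_lt (is_quad k) p.+1 Q &
    forall q, ref_elt (is_quad k) q -> psi (param k q) = ev q Q.
Proof.
move=> psiA [] i.
  have [f /(poly_spaceP false)[Q degQ fQ] psif] := argyris_tri psiA i.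
  exists Q => // q; rewrite -(ref_domE (inl i)) => Kq.
  by rewrite -fQ; exact: psif.
have [f /(poly_spaceP true)[Q degQ fQ] psif] := argyris_quad psiA i.
exists Q => // q; rewrite -(ref_domE (inr i)) => Kq.
by rewrite -fQ; exact: psif.
Qed.

End Existence.

Theorem theorem1 (R : realType) (p : nat) (Omega : set (plane R))
    (M : mesh_data R) (n : edge_idx M -> plane R)
    (Rpt : edge_idx M -> 'I_(p - 5) -> plane R)
    (Spt : edge_idx M -> 'I_(p - 4) -> plane R)
    (Qquad : quad_idx M -> quad_pt_idx p -> plane R)
    (Qtri : tri_idx M -> tri_pt_idx p -> plane R)
    (hp : (5 <= p)%N)
    (hM : is_mesh Omega M)
    (hn : forall e, unit_normal e (n e))
    (hR : forall e, injective (Rpt e) /\ forall l, edge e (Rpt e l))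
    (hS : forall e, injective (Spt e) /\ forall l, edge e (Spt e l))
    (hQquad : forall i,
       [/\ injective (fun l => quad_param i (Qquad i l)),
           forall l, ref_quad (Qquad i l)
         & unisolvent (Qquad i) (@inner_quad R p)])
    (hQtri : forall i,
       [/\ injective (fun l => tri_param i (Qtri i l)),
           forall l, ref_tri (Qtri i l)
         & unisolvent (Qtri i) (@inner_tri R p)])
    (sigmaV : vtx_idx M -> nat -> nat -> R)
    (sigmaE : edge_idx M -> 'I_(p - 5) -> R)
    (w : edge_idx M -> 'I_(p - 4) -> R)
    (sigmaQ : quad_idx M -> quad_pt_idx p -> R)
    (sigmaT : tri_idx M -> tri_pt_idx p -> R) :
  let interpolant (phi : plane R -> R) : Prop :=
    argyris Omega n p phi /\
    [/\ forall i a b, (a + b <= 2)%N ->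
          mesh_limit M (Dxy a b phi) (vtx i) (sigmaV i a b),
        forall e,
          (forall l, phi (Rpt e l) = sigmaE e l) /\
          (forall l, mesh_limit M ('D_(n e) phi) (Spt e l) (w e l)),
        forall i l, phi (quad_param i (Qquad i l)) = sigmaQ i l
      & forall i l, phi (tri_param i (Qtri i l)) = sigmaT i l] in
  exists phi, interpolant phi /\
    forall psi, interpolant psi ->
      forall x, closure Omega x -> psi x = phi x.
Proof.
move=> interpolant.
pose S i := Jet (sigmaV i 0%N 0%N) (sigmaV i 1%N 0%N) (sigmaV i 0%N 1%N)
  (sigmaV i 2%N 0%N) (sigmaV i 1%N 1%N) (sigmaV i 0%N 2%N).
have SE i a b : (a + b <= 2)%N -> jet_entry (S i) a b = sigmaV i a b.
  by apply: (@order2_ind (fun a b => jet_entry (S i) a b = sigmaV i a b)).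
have [tR [tR_inj tR01 tRE]] := edge_params hR.
have [tS [tS_inj tS01 tSE]] := edge_params hS.
have [G GP] := edge_traces S hp sigmaE tR_inj tR01.
have [N NP] := edge_normals n S hp w tS_inj tS01.
have szG e : (size (G e) <= p.+1)%N by have [] := GP e.
have GS e : edge_jet3 S e (G e) by have [] := GP e.
have GR e l : (G e).[tR e l] = sigmaE e l by have [] := GP e.
have szN e : (size (N e) <= p)%N by have [] := NP e.
have NS e : edge_jet2 n S e (N e) by have [] := NP e.
have NR e l : (N e).[tS e l] = w e l by have [] := NP e.
pose pts (k : elt_idx M) : pt_idx (is_quad k) p -> plane R :=
  match k with inl i => Qtri i | inr i => Qquad i end.
pose v (k : elt_idx M) : pt_idx (is_quad k) p -> R :=
  match k with inl i => sigmaT i | inr i => sigmaQ i end.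
have uni k : unisolvent (pts k) (@inner_space R (is_quad k) p).
  by case: k => i; [have [] := hQtri i|have [] := hQquad i].
have pts_in k l : ref_elt (is_quad k) (pts k l).
  rewrite -ref_domE; case: k l => i l; first by have [_ h _] := hQtri i; exact: h.
  by have [_ h _] := hQquad i; exact: h.
have [P PP] := elt_exists hM hn hp v uni szG GS szN NS.
have degP k : deg_lt (is_quad k) p.+1 (P k) by have [] := PP k.
have bdP k : boundary_data n G N k (P k) by have [] := PP k.
have valP k l : ev (pts k l) (P k) = v k l by have [] := PP k.
exists (glued P); split.
  split; first exact: (glued_argyris hM hn GS NS).
  split.
  - move=> i a b ab; rewrite -SE //; exact: (glued_vtx hM hn GS NS).
  - move=> e; split=> l.
      by rewrite tRE (glued_edge hM hn GS NS bdP) ?GR.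
    by rewrite tSE -NR; exact: (glued_normal hM hn GS NS).
  - move=> i l; rewrite -[RHS](valP (inr i) l).
    exact: (gluedE hM hn GS NS bdP (pts_in (inr i) l)).
  - move=> i l; rewrite -[RHS](valP (inl i) l).
    exact: (gluedE hM hn GS NS bdP (pts_in (inl i) l)).
move=> psi [psiA [psiV psiE psiQ psiT]] x.
rewrite (closure_Omega hM hn) => -[k _ [q Kq <-]].
have [Q degQ QE] := argyris_elt psiA k.
have bdQ : boundary_data n G N k Q.
  apply: (psi_boundary hM hn GS NS hp tR_inj tS_inj tR01 tS01 szG szN _ _ _ _ degQ QE).
  - by move=> i a b ab; rewrite SE //; exact: psiV.
  - exact: (argyris_normal psiA).
  - by move=> e l; rewrite -tRE GR; exact: (psiE e).1.
  - by move=> e l; rewrite -tSE NR; exact: (psiE e).2.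
rewrite (gluedE hM hn GS NS bdP Kq) QE //; congr (ev q _).
apply: (local_unique hp (uni k) degQ (degP k)).
- move=> r; have [e er] := side_edge hM r.
  by have [-> ->] := bdQ r e er; have [-> ->] := bdP k r e er.
- move=> l; rewrite -QE // valP.
  by case: k q Kq Q degQ QE bdQ l => i q Kq Q degQ QE bdQ l; [exact: psiT|exact: psiQ].
Qed.
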